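(* Let $\mathbf{Q}=(q_{ij})_{1\le i,j\le l}$ be a complex matrix with $q_{ij}q_{ji}=1$ for $1\le i,j\le l$, let $\mathcal{A}_{\mathbf{Q}}$ be the associated associative algebra and $V_{\mathbf{Q}}$ the universal vacuum $\mathcal{A}_{\mathbf{Q}}$-module with vacuum $\mathbf{1}$. Then there exists a unique irreducible quantum vertex algebra structure on $V_{\mathbf{Q}}$ with $\mathbf{1}$ as the vacuum vector such that $Y(u^{(i)},x)=X_i(x)$ and $Y(v^{(i)},x)=Y_i(x)$ for $i=1,\dots,l$. Moreover, if $W$ is any $\mathcal{A}_{\mathbf{Q}}$-module such that for every $w\in W$, $X_{i,m}w=Y_{i,m}w=0$ for $1\le i\le l$ and all sufficiently large $m$, then there exists a unique $V_{\mathbf{Q}}$-module structure $Y_W$ on $W$ with $Y_W(u^{(i)},x)=X_i(x)$ and $Y_W(v^{(i)},x)=Y_i(x)$ for $i=1,\dots,l$. Conversely, every $V_{\mathbf{Q}}$-module $(W,Y_W)$ is an $\mathcal{A}_{\mathbf{Q}}$-module with $X_i(x)=Y_W(u^{(i)},x)$ and $Y_i(x)=Y_W(v^{(i)},x)$ for $i=1,\dots,l$.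
   Context: $\mathcal{A}_{\mathbf{Q}}$ is the unital complex associative algebra with generators $X_{i,n},Y_{i,n}$ ($1\le i\le l$, $n\in\mathbb{Z}$) and relations $X_{i,m}X_{j,n}=q_{ij}X_{j,n}X_{i,m}$, $Y_{i,m}Y_{j,n}=q_{ij}Y_{j,n}Y_{i,m}$, $X_{i,m}Y_{j,n}-q_{ji}Y_{j,n}X_{i,m}=\delta_{ij}\delta_{m+n+1,0}$. Let $\mathcal{A}^+_{\mathbf{Q}}$ be the subalgebra generated by $X_{i,m},Y_{i,m}$ with $m\ge0$. $V_{\mathbf{Q}}=\mathcal{A}_{\mathbf{Q}}/(\mathcal{A}_{\mathbf{Q}}\mathcal{A}^+_{\mathbf{Q}})$ as a left module, $\mathbf{1}=1+\mathcal{A}_{\mathbf{Q}}\mathcal{A}^+_{\mathbf{Q}}$, $u^{(i)}=X_{i,-1}\mathbf{1}$, $v^{(i)}=Y_{i,-1}\mathbf{1}$, $X_i(x)=\sum_{n\in\mathbb{Z}}X_{i,n}x^{-n-1}$, $Y_i(x)=\sum_nY_{i,n}x^{-n-1}$ (acting on the relevant module). A nonlocal vertex algebra is a vector space $V$ with vector $\mathbf{1}$ and linear $Y:V\to\mathrm{Hom}(V,V((x)))$, $Y(v,x)=\sum_nv_nx^{-n-1}$, such that $Y(\mathbf{1},x)v=v$, $Y(v,x)\mathbf{1}\in V[[x]]$ with constant term $v$, and for $u,v,w$ some $l\ge0$ gives $(x_0+x_2)^lY(u,x_0+x_2)Y(v,x_2)w=(x_0+x_2)^lY(Y(u,x_0)v,x_2)w$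 (binomials expanded in nonnegative powers of the second variable). A module $(W,Y_W)$ has $Y_W:V\to\mathrm{Hom}(W,W((x)))$, $Y_W(\mathbf{1},x)=1_W$, and the same weak associativity. A weak quantum vertex algebra is a nonlocal vertex algebra with: for $u,v$ there exist $u^{(i)},v^{(i)}\in V$, $f_i\in\mathbb{C}((x))$, $k\ge0$ with $(x_1-x_2)^kY(u,x_1)Y(v,x_2)=(x_1-x_2)^k\sum_if_i(x_2-x_1)Y(v^{(i)},x_2)Y(u^{(i)},x_1)$. A quantum vertex algebra is a weak quantum vertex algebra with a unitary rational quantum Yang-Baxter operator $\mathcal{S}(x):V\otimes V\to V\otimes V\otimes\mathbb{C}((x))$ ($\mathcal{S}(x)\mathcal{S}^{21}(-x)=1$, $\mathcal{S}^{12}(x_1)\mathcal{S}^{13}(x_1-x_2)\mathcal{S}^{23}(x_2)=\mathcal{S}^{23}(x_2)\mathcal{S}^{13}(x_1-x_2)\mathcal{S}^{12}(x_1)$) such that for $\mathcal{S}(x)(v\otimes u)=\sum_iv^{(i)}\otimes u^{(i)}\otimes f_i(x)$: $x_0^{-1}\delta\left(\frac{x_1-x_2}{x_0}\right)Y(u,x_1)Y(v,x_2)-x_0^{-1}\delta\left(\frac{x_2-x_1}{-x_0}\right)\sum_if_i(-x_0)Y(v^{(i)},x_2)Y(u^{(i)},x_1)=x_2^{-1}\delta\left(\frac{x_1-x_0}{x_2}\right)Y(Y(u,x_0)v,x_2)$, $[\mathcal{D}\otimes1,\mathcal{S}(x)]=-\frac{d}{dx}\mathcal{S}(x)$, $\mathcal{S}(z)(Y(x)\otimes1)=(Y(x)\otimes1)\mathcal{S}^{23}(z)\mathcal{S}^{13}(z+x)$,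 with $\mathcal{D}v=v_{-2}\mathbf{1}$. An irreducible quantum vertex algebra is a quantum vertex algebra that is irreducible as a module over itself (such an algebra of countable dimension is nondegenerate, and then $\mathcal{S}(x)$ is uniquely determined). *)

(* Defs.v *)
From HB Require Import structures.
From mathcomp Require Import all_boot all_order all_algebra complex.
From mathcomp Require Import Rstruct.
From Stdlib Require Import ClassicalEpsilon.

Set Implicit Arguments.
Unset Strict Implicit.
Unset Printing Implicit Defensive.

Import Order.TTheory GRing.Theory Num.Theory.
Local Open Scope ring_scope.

Definition C : numClosedFieldType := (Rdefinitions.R)[i].

Definition fin_supp {M : zmodType} (F : int -> M) : Prop :=
  exists N : nat, forall n : int, (N%:Z < `|n|) -> F n = 0.

(** [fsum F] = sum of all values of a finitely supported family
   (all sums used below are finitely supported under the truncation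
   hypotheses that are part of the structures). *)
Definition fsum {M : zmodType} (F : int -> M) : M :=
  match excluded_middle_informative (fin_supp F) with
  | left H =>
      let N := proj1_sig (constructive_indefinite_description _ H) in
      \sum_(k < (N.*2).+1) F (k%:Z - N%:Z)
  | right _ => 0
  end.

Definition fsumn {M : zmodType} (F : nat -> M) : M :=
  fsum (fun z : int => match z with Posz n => F n | Negz _ => 0 end).

Definition binz (r : int) (j : nat) : C :=
  (\prod_(i < j) ((r - i%:Z)%:~R : C)) / (j`!)%:R.

Definition sgn (k : int) : C := (-1) ^ k.

(** * Formal Laurent series in one variable:  f(x) = sum_n f n x^n. *)
Definition laur := int -> C.
Definition laurent (f : laur) : Prop := exists N : int, forall n, n < N -> f n = 0.

Definition lmul (f g : laur) : laur := fun n => fsum (fun k => f k * g (n - k)).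

(** * Operations on two-variable formal series [F s t] = coefficient of
   y1^s y2^t, with values in a vector space M.  Binomials are expanded in
   nonnegative powers of the second variable. *)

Definition mul_diff_pow {M : lmodType C} (k : nat) (F : int -> int -> M) :
  int -> int -> M := fun s t =>
  \sum_(j < k.+1) ((binz k j * sgn j) *: F (s - (k - j)%:Z) (t - j%:Z)).

Definition mul_sum_pow {M : lmodType C} (k : nat) (F : int -> int -> M) :
  int -> int -> M := fun s t =>
  \sum_(j < k.+1) (binz k j *: F (s - (k - j)%:Z) (t - j%:Z)).

(** f(y2 - y1) * G, with (y2 - y1)^r expanded in nonnegative powers of y1 *)
Definition mul_f21 {M : lmodType C} (f : laur) (G : int -> int -> M) :
  int -> int -> M := fun s t =>
  fsumn (fun j => fsum (fun r =>
    (f r * binz r j * sgn j) *: G (s - j%:Z) (t - (r - j%:Z)))).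

(** * Vertex operators.  [Yv u n w] is u_n w, where Y(u,x)w = sum_n u_n w x^{-n-1}. *)
Section VertexOps.
Variables (V W : lmodType C).

Definition bilinear_op (YW : V -> int -> W -> W) : Prop :=
  (forall u n a w1 w2, YW u n (a *: w1 + w2) = a *: YW u n w1 + YW u n w2) /\
  (forall n w a u1 u2, YW (a *: u1 + u2) n w = a *: YW u1 n w + YW u2 n w).

Definition truncated (YW : V -> int -> W -> W) : Prop :=
  forall u w, exists N : int, forall n, N <= n -> YW u n w = 0.

(** coefficient of x0^a x2^b in Y(u, x0 + x2) Y(v, x2) w, where
   (x0+x2)^{-m-1} is expanded in nonnegative powers of x2 *)
Definition YY_shift (YW : V -> int -> W -> W) (u v : V) (w : W) :
  int -> int -> W := fun a b =>
  fsum (fun m =>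
    match (- m - 1 - a) with
    | Posz j => binz (- m - 1) j *: YW u m (YW v (j%:Z - b - 1) w)
    | Negz _ => 0
    end).

(** coefficient of x0^a x2^b in Y_W(Y(u,x0)v, x2) w *)
Definition Y_iter (Yv : V -> int -> V -> V) (YW : V -> int -> W -> W)
  (u v : V) (w : W) : int -> int -> W := fun a b =>
  YW (Yv u (- a - 1) v) (- b - 1) w.

Definition weak_assoc (Yv : V -> int -> V -> V) (YW : V -> int -> W -> W) : Prop :=
  forall u v w, exists l : nat, forall a b,
    mul_sum_pow l (YY_shift YW u v w) a b = mul_sum_pow l (Y_iter Yv YW u v w) a b.

(** coefficient of x1^s x2^t in Y(u,x1)Y(v,x2)w *)
Definition YY (YW : V -> int -> W -> W) (u v : V) (w : W) : int -> int -> W :=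
  fun s t => YW u (- s - 1) (YW v (- t - 1) w).

(** coefficient of x1^s x2^t in Y(v,x2)Y(u,x1)w *)
Definition YYop (YW : V -> int -> W -> W) (v u : V) (w : W) : int -> int -> W :=
  fun s t => YW v (- t - 1) (YW u (- s - 1) w).

End VertexOps.

Section VA.
Variable V : lmodType C.
Implicit Types (Yv : V -> int -> V -> V) (vac : V).

Definition nonlocal_VA Yv vac : Prop :=
  bilinear_op Yv /\ [/\ truncated Yv,
      (forall n v, Yv vac n v = if n == -1 then v else 0),
      (forall v n, 0 <= n -> Yv v n vac = 0),
      (forall v, Yv v (-1) vac = v) &
      weak_assoc Yv Yv].

Definition VA_module (W : lmodType C) Yv vac (YW : V -> int -> W -> W) : Prop :=
  [/\ bilinear_op YW, truncated YW,
      (forall n w, YW vac n w = if n == -1 then w else 0) &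
      weak_assoc Yv YW].

(** An element  sum_i a_i (x) b_i (x) f_i(x)  of V (x) V (x) C((x))  is
    represented by the list of the triples ((a_i, b_i), f_i). *)
Definition tens2 := seq (V * V * laur).

Definition weak_QVA Yv vac : Prop :=
  nonlocal_VA Yv vac /\
  forall u v, exists (L : tens2) (k : nat),
    List.Forall (fun e => laurent e.2) L /\
    forall w s t,
      mul_diff_pow k (YY Yv u v w) s t =
      mul_diff_pow k (fun s' t' => \sum_(e <- L) mul_f21 e.2 (YYop Yv e.1.1 e.1.2 w) s' t') s t.

Definition pair2 (phi psi : {scalar V}) (L : tens2) : laur :=
  fun n => \sum_(e <- L) phi e.1.1 * psi e.1.2 * e.2 n.

(** coefficient of x1^a x2^b of h(x1) g(x1 - x2) f(x2) *)
Definition ser3 (h g f : laur) (a b : int) : C :=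
  fsumn (fun j => fsum (fun r => h (a - r + j%:Z) * g r * binz r j * sgn j * f (b - j%:Z))).

(** A linear map S(x) : V (x) V -> V (x) V (x) C((x)) given on pure tensors:
    S(x)(a (x) b) = S a b.  Tensor identities are checked by pairing with
    linear functionals (which separate points of algebraic tensor products). *)
Definition S_linear (S : V -> V -> tens2) : Prop :=
  (forall a b, List.Forall (fun e => laurent e.2) (S a b)) /\
  (forall phi psi n c a1 a2 b,
     pair2 phi psi (S (c *: a1 + a2) b) n =
     c * pair2 phi psi (S a1 b) n + pair2 phi psi (S a2 b) n) /\
  (forall phi psi n c a b1 b2,
     pair2 phi psi (S a (c *: b1 + b2)) n =
     c * pair2 phi psi (S a b1) n + pair2 phi psi (S a b2) n).

(** unitarity  S(x) S^{21}(-x) = 1 *)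
Definition S_unitary (S : V -> V -> tens2) : Prop :=
  forall a b (phi psi : {scalar V}) n,
    \sum_(e <- S b a) \sum_(d <- S e.1.2 e.1.1)
       phi d.1.1 * psi d.1.2 * lmul d.2 (fun k => sgn k * e.2 k) n
    = phi a * psi b * (if n == 0 then 1 else 0).

(** quantum Yang-Baxter equation
   S^12(x1) S^13(x1-x2) S^23(x2) = S^23(x2) S^13(x1-x2) S^12(x1) *)
Definition S_YBE (S : V -> V -> tens2) : Prop :=
  forall a b c (phi1 phi2 phi3 : {scalar V}) s t,
    \sum_(e1 <- S b c) \sum_(e2 <- S a e1.1.2) \sum_(e3 <- S e2.1.1 e1.1.1)
       phi1 e3.1.1 * phi2 e3.1.2 * phi3 e2.1.2 * ser3 e3.2 e2.2 e1.2 s t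
  = \sum_(e1 <- S a b) \sum_(e2 <- S e1.1.1 c) \sum_(e3 <- S e1.1.2 e2.1.2)
       phi1 e2.1.1 * phi2 e3.1.1 * phi3 e3.1.2 * ser3 e1.2 e2.2 e3.2 s t.

Definition unitary_QYBO (S : V -> V -> tens2) : Prop :=
  [/\ S_linear S, S_unitary S & S_YBE S].

Definition Dop Yv vac (v : V) : V := Yv v (-2) vac.

Definition S_Jacobi Yv (S : V -> V -> tens2) : Prop :=
  forall u v w a b c,
    fsumn (fun j => (binz (- a - 1) j * sgn j) *:
             YY Yv u v w (b - (- a - 1) + j%:Z) (c - j%:Z))
  - \sum_(e <- S v u)
      fsumn (fun j => fsum (fun r =>
        (e.2 r * sgn r * sgn (r - a - 1) * binz (r - a - 1) j * sgn j) *: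
          YYop Yv e.1.1 e.1.2 w (b - j%:Z) (c - (r - a - 1) + j%:Z)))
  = fsumn (fun j => (binz (b + j%:Z) j * sgn j) *:
             Yv (Yv u (j%:Z - a - 1) v) (- (b + j%:Z) - c - 2) w).

(** [D (x) 1, S(x)] = - d/dx S(x) *)
Definition S_D_comm Yv vac (S : V -> V -> tens2) : Prop :=
  forall a b (phi psi : {scalar V}) n,
    \sum_(e <- S a b) phi (Dop Yv vac e.1.1) * psi e.1.2 * e.2 n
    - pair2 phi psi (S (Dop Yv vac a) b) n
  = - ((n + 1)%:~R * pair2 phi psi (S a b) (n + 1)).

(** hexagon identity  S(z)(Y(x) (x) 1) = (Y(x) (x) 1) S^23(z) S^13(z+x);
    coefficient of x^al z^be *)
Definition S_hexagon Yv (S : V -> V -> tens2) : Prop :=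
  forall a b c (phi psi : {scalar V}) al be,
    pair2 phi psi (S (Yv a (- al - 1) b) c) be
  = \sum_(e1 <- S a c) \sum_(e2 <- S b e1.1.2)
      psi e2.1.2 * fsumn (fun k => fsum (fun r =>
         phi (Yv e1.1.1 (k%:Z - al - 1) e2.1.1) * e1.2 r * binz r k
           * e2.2 (be - (r - k%:Z)))).

Definition QVA Yv vac (S : V -> V -> tens2) : Prop :=
  [/\ weak_QVA Yv vac, unitary_QYBO S, S_Jacobi Yv S,
      S_D_comm Yv vac S & S_hexagon Yv S].

Definition S_eq (S S' : V -> V -> tens2) : Prop :=
  forall a b (phi psi : {scalar V}) n, pair2 phi psi (S a b) n = pair2 phi psi (S' a b) n.

Definition subspace (P : V -> Prop) : Prop :=
  P 0 /\ (forall c x y, P x -> P y -> P (c *: x + y)).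

Definition irreducible_VA Yv : Prop :=
  (exists v : V, v <> 0) /\
  forall P : V -> Prop, subspace P -> (forall u n w, P w -> P (Yv u n w)) ->
    (forall w, P w -> w = 0) \/ (forall w, P w).

End VA.

Section AQ.
Variable l : nat.
Variable Q : 'M[C]_l.

Definition AQ_module (W : lmodType C) (X Y : 'I_l -> int -> W -> W) : Prop :=
  [/\ (forall i n c w1 w2, X i n (c *: w1 + w2) = c *: X i n w1 + X i n w2),
      (forall i n c w1 w2, Y i n (c *: w1 + w2) = c *: Y i n w1 + Y i n w2),
      (forall i j m n w, X i m (X j n w) = Q i j *: X j n (X i m w)),
      (forall i j m n w, Y i m (Y j n w) = Q i j *: Y j n (Y i m w)) &
      (forall i j m n w, X i m (Y j n w) - Q j i *: Y j n (X i m w)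
                          = if (i == j) && (m + n + 1 == 0) then w else 0)].

Definition vacuum_like (W : lmodType C) (X Y : 'I_l -> int -> W -> W) (w : W) : Prop :=
  forall i m, 0 <= m -> X i m w = 0 /\ Y i m w = 0.

(** (V, X, Y, vac) is the universal vacuum A_Q-module
    V_Q = A_Q / A_Q A_Q^+ with vacuum 1 = 1 + A_Q A_Q^+, characterized by its
    universal property. *)
Definition universal_vacuum_module (V : lmodType C) (X Y : 'I_l -> int -> V -> V)
  (vac : V) : Prop :=
  [/\ AQ_module X Y, vacuum_like X Y vac &
      forall (W : lmodType C) (XW YW : 'I_l -> int -> W -> W) (w : W),
        AQ_module XW YW -> vacuum_like XW YW w ->
        exists f : V -> W,
          [/\ linear f, f vac = w,
              (forall i m v, f (X i m v) = XW i m (f v)),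
              (forall i m v, f (Y i m v) = YW i m (f v)) &
              (forall g : V -> W, linear g -> g vac = w ->
                 (forall i m v, g (X i m v) = XW i m (g v)) ->
                 (forall i m v, g (Y i m v) = YW i m (g v)) ->
                 forall v, g v = f v)]].

Definition locally_truncated (W : lmodType C) (X Y : 'I_l -> int -> W -> W) : Prop :=
  forall (w : W) (i : 'I_l), exists N : int, forall m, N <= m -> X i m w = 0 /\ Y i m w = 0.

End AQ.

(* Main.v *)
(* On a smooth module [W], families of fields [b c], indexed by words [c] of generators, form a
   module over the algebra: a mode [a_m] acts by the residue formula for the iterate
   [Y(a_m v, x)], the index [c] recording the twist of [v] by the diagonal automorphism with
   eigenvalues [\prod_(a <- c) qf a b].  The identity field is vacuum-like in it, so the
   universal property of [V] defines the vertex operators, on [V] and on every smooth module.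
   Identities between formal series are handled as identities between their residues against
   [z^s x^p (z - x)^m]; these are functions of three integers subject to [z = x + (z - x)], so
   that two of them agree as soon as they do so on suitable half-spaces.  In this form the
   Jacobi identity, in which moving a monomial of weight [c] past [v] replaces [v] by its
   twist, propagates from generators to all monomials.

   Hence [S(x)] can be taken constant: it multiplies the tensor product of two weight vectors by
   the bicharacter that extends [qf].

   A vector is determined by the vacuum coefficients of the words of annihilation modes applied
   to it: they define a map to a Fock space, and inverting the number operator reconstructs the
   vector degree by degree.  This gives irreducibility.  It also gives the uniqueness of [S]: two
   choices differ by a tensor with [\sum_i f_i(x2 - x1) Y(a_i, x2) Y(b_i, x1) = 0], a property
   inherited when annihilation modes are applied to the [a_i] or to the [b_i], so that all
   vacuum coefficients of the tensor vanish.

   For the converse, weak associativity with the vacuum gives [Y(Y(c, y) 1, x) = Y(c, x + y)] on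
   a module, which transports skew symmetry of the generators from [V] to the module; together
   with weak associativity in both orders this yields the commutation relations. *)
From Stdlib Require Import ClassicalEpsilon.
Require Import Defs.
From HB Require Import structures.
From mathcomp Require Import all_boot all_order all_algebra complex.
From mathcomp Require Import boolp functions.
From mathcomp Require Import zify ring.
Import Order.TTheory GRing.Theory Num.Theory.
Local Open Scope ring_scope.

Set Implicit Arguments.
Unset Strict Implicit.
Unset Printing Implicit Defensive.

(** * Finitely supported sums *)

(** Moving a generator past [v] replaces [v] by its twist, and a general module [W] carries no
    operator implementing that twist. A vertex operator on [W] therefore cannot be built as a single
    field; the fields of all twists have to be constructed together.

    The obstacle in propagating the Jacobi identity is that the two products and the iterate live in
    different expansion regions of three variables [z], [x1], [x2]. The remedy is multiplication by
    [z^S (z - x2)^T]: large powers kill the modes of the new generator on [w] and on [b], and make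
    it local with [b], so that every expression becomes the generator acting leftmost on the
    identity already known. This multiplication loses nothing, because the functionals involved
    vanish for large powers of [z - x1].

    Irreducibility and the uniqueness of [S] rest on the pairing [kap] of each generator with its
    partner [bar], which makes annihilation modes dual to creation modes. *)

Definition sfin {M : zmodType} (F : nat -> M) : Prop :=
  exists N : nat, forall j : nat, (N <= j)%N -> F j = 0.

Section Sums.
Variable M : zmodType.
Implicit Types (F G : nat -> M) (H : int -> M).

Lemma fsum_widen H (N k : nat) : (forall n : int, N%:Z < `|n| -> H n = 0) ->
  \sum_(i < ((N + k).*2).+1) H (i%:Z - (N + k)%:Z) =
  \sum_(i < (N.*2).+1) H (i%:Z - N%:Z).
Proof.
move=> h; elim: k => [|k IH]; first by rewrite addn0.
rewrite addnS doubleS big_ord_recl big_ord_recr /= -IH.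
rewrite h; last by lia.
rewrite add0r [X in _ + X]h ?addr0; last by rewrite /bump /=; lia.
by apply: eq_bigr => i _; congr H; rewrite /bump /=; lia.
Qed.

(** The bound chosen inside [fsum] is arbitrary; two valid bounds differ by zero terms. All later
    computations choose their own bound through this lemma. *)
Lemma fsumE H (N : nat) : (forall n : int, N%:Z < `|n| -> H n = 0) ->
  fsum H = \sum_(i < (N.*2).+1) H (i%:Z - N%:Z).
Proof.
move=> h; rewrite /fsum.
case: excluded_middle_informative => [H0|]; last by case; exists N.
case: (ClassicalEpsilon.constructive_indefinite_description _ H0) => K hK /=.
case/orP: (leq_total N K) => le_NK.
  by rewrite -(subnKC le_NK) fsum_widen.
by rewrite -(subnKC le_NK) fsum_widen.
Qed.

Lemma fsumnE F (N : nat) : (forall j, (N <= j)%N -> F j = 0) ->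
  fsumn F = \sum_(j < N) F j.
Proof.
move=> h; rewrite /fsumn (@fsumE _ N); last first.
  by case=> [n|n] hn //; apply: h; lia.
rewrite -addnn -addnS big_split_ord /= big1 ?add0r; last first.
  by move=> i _; case E: (_ - _) => //; have := ltn_ord i; lia.
rewrite big_ord_recr /= [X in _ + X](_ : _ = 0) ?addr0; last first.
  by rewrite PoszD addrC addKr h.
by apply: eq_bigr => i _; rewrite PoszD addrC addKr.
Qed.

Lemma eq_fsumn F G : F =1 G -> fsumn F = fsumn G.
Proof. by move/funext->. Qed.

Lemma fsumn0 F : (forall j, F j = 0) -> fsumn F = 0.
Proof. by move=> h; rewrite (@fsumnE _ 0) ?big_ord0. Qed.

Lemma fsumn1 F : (forall j, F j.+1 = 0) -> fsumn F = F 0%N.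
Proof. by move=> h; rewrite (@fsumnE _ 1) ?big_ord1 //; case. Qed.

Lemma fsumn_pick F k : (forall j, j != k -> F j = 0) -> fsumn F = F k.
Proof.
move=> h; rewrite (@fsumnE _ k.+1) => [|j lj]; last by rewrite h //; lia.
rewrite big_ord_recr /= big1 ?add0r // => i _; rewrite h //.
by have := ltn_ord i; lia.
Qed.

Lemma fsumnS F : sfin F -> fsumn F = F 0%N + fsumn (F \o S).
Proof.
case=> N h; rewrite (@fsumnE _ N.+1) => [|j lj]; last by rewrite h //; lia.
by rewrite big_ord_recl (@fsumnE _ N) // => j lj; rewrite /= h //; lia.
Qed.

Lemma fsumnD F G : sfin F -> sfin G ->
  fsumn (fun j => F j + G j) = fsumn F + fsumn G.
Proof.
case=> N hN [K hK]; rewrite !(@fsumnE _ (N + K)) ?big_split // => j lj.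
- by rewrite hK //; lia.
- by rewrite hN //; lia.
by rewrite hN ?hK ?addr0 //; lia.
Qed.

End Sums.

Lemma fsumn_additive (M M' : zmodType) (L : M -> M') (F : nat -> M) : {morph L : x y / x - y} ->
  sfin F -> L (fsumn F) = fsumn (L \o F).
Proof.
move=> LB [N hN].
have L0 : L 0 = 0 by rewrite -(subrr 0) LB subrr.
have LD x y : L (x + y) = L x + L y.
  have -> : x + y = x - (0 - y) by rewrite sub0r opprK.
  by rewrite !LB L0 sub0r opprK.
rewrite (fsumnE hN) (big_morph L LD L0) (@fsumnE _ _ N) // => j lj /=.
by rewrite hN.
Qed.

(** * Generalized binomial coefficients *)

Lemma binz_0 r : binz r 0 = 1.
Proof. by rewrite /binz big_ord0 fact0 divr1. Qed.

Lemma binzE0 j : binz 0 j = (j == 0%N)%:R.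
Proof.
case: j => [|j]; first by rewrite binz_0.
by rewrite /binz big_ord_recl /= subrr !mul0r.
Qed.

Lemma factC_neq0 n : (n`!)%:R != 0 :> C.
Proof. by rewrite pnatr_eq0 -lt0n fact_gt0. Qed.

Lemma binz_fallS (r : int) j :
  \prod_(i < j.+1) ((r + 1 - i%:Z)%:~R : C) = (r + 1)%:~R * \prod_(i < j) ((r - i%:Z)%:~R : C).
Proof.
rewrite big_ord_recl subr0; apply: congr2 => //; apply: eq_bigr => i _.
by congr (_%:~R); rewrite /= /bump; lia.
Qed.

Lemma binz_pascal (r : int) j : binz (r + 1) j.+1 = binz r j.+1 + binz r j.
Proof.
have pascal_field (F : fieldType) (a c d s f : F) :
    s != 0 -> f != 0 -> d = c + s -> d * a / (s * f) = a * c / (s * f) + a / f.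
  by move=> s0 f0 ->; field; rewrite s0 f0.
rewrite /binz binz_fallS big_ord_recr /= factS natrM.
apply: (@pascal_field C); rewrite ?factC_neq0 ?pnatr_eq0 //.
have -> : j.+1%:R = (j.+1%:Z)%:~R :> C by [].
by rewrite -intrD; apply: (congr1 (fun z : int => z%:~R : C)); lia.
Qed.

Lemma binz_small (n j : nat) : (n < j)%N -> binz n j = 0.
Proof.
move=> h; rewrite /binz (bigD1 (Ordinal h)) //= subrr mul0r mul0r //.
Qed.

Lemma binz_bin (n k : nat) : binz n k = 'C(n, k)%:R.
Proof.
elim: n k => [|n IH] [|k]; rewrite ?binz_0 ?bin0 ?binzE0 //.
by rewrite -addn1 PoszD binz_pascal !IH addn1 binS natrD.
Qed.

Lemma binz_sub (n j : nat) : (j <= n)%N -> binz n (n - j) = binz n j.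
Proof. by move=> h; rewrite !binz_bin bin_sub. Qed.

Lemma sgnS (k : int) : sgn (k + 1) = - sgn k.
Proof. by rewrite /sgn expfzDr ?oppr_eq0 ?oner_eq0 // expr1z mulrN1. Qed.

Lemma sgn0 : sgn 0 = 1. Proof. by rewrite /sgn expr0z. Qed.

Lemma sgnD (j k : int) : sgn (j + k) = sgn j * sgn k.
Proof. by rewrite /sgn expfzDr // oppr_eq0 oner_eq0. Qed.

Lemma sgnM (k : int) : sgn k * sgn k = 1.
Proof. by rewrite /sgn -expfzMl mulrNN mulr1 exp1rz. Qed.

Lemma sgnSn (j : nat) : sgn j.+1 = - sgn j.
Proof. by rewrite -sgnS; congr sgn; lia. Qed.

Lemma sgn_neq0 k : sgn k != 0.
Proof. by apply: contra_eq_neq (sgnM k) => ->; rewrite mul0r eq_sym oner_eq0. Qed.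

(** Upper negation: reversing the product changes the sign of every factor. *)
Lemma binz_neg (r : int) j : binz (r - 1 + j%:Z) j * sgn j = binz (- r) j.
Proof.
rewrite /binz mulrAC; congr (_ / _).
rewrite [RHS](reindex_inj rev_ord_inj) /=.
have -> : sgn j = \prod_(i < j) (-1) by rewrite prodr_const card_ord.
rewrite -big_split /=; apply: eq_bigr => i _.
rewrite mulrN1 -mulrNz; apply: (congr1 (fun z : int => z%:~R : C)).
by have := ltn_ord i; rewrite /=; lia.
Qed.

Lemma int_updown (P : int -> Prop) (a : int) : P a ->
  (forall n, P n -> P (n + 1)) -> (forall n, P (n + 1) -> P n) -> forall n, P n.
Proof.
move=> Pa up dn n.
have U k : P (a + k%:Z).
  elim: k => [|k IH]; first by rewrite addr0.
  by have := up _ IH; congr P; lia.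
have D k : P (a - k%:Z).
  elim: k => [|k IH]; first by rewrite subr0.
  by apply: dn; move: IH; congr P; lia.
case: (leP a n) => h.
  by have := U `|n - a|%N; congr P; lia.
by have := D `|n - a|%N; congr P; lia.
Qed.

(** By Pascal's rule both sides have the same increment in [m], namely the case of the preceding
    [N], so the identity spreads from [m = 0] to all integers. *)
Lemma binz_vandermonde (m n : int) N :
  \sum_(i < N.+1) binz m i * binz n (N - i) = binz (m + n) N.
Proof.
elim: N m n => [|N IH] m n; first by rewrite big_ord1 subn0 !binz_0 mulr1.
have step a : \sum_(i < N.+2) binz (a + 1) i * binz n (N.+1 - i)
   = \sum_(i < N.+2) binz a i * binz n (N.+1 - i) + binz (a + n) N.
  rewrite big_ord_recl [in RHS]big_ord_recl -addrA !binz_0; congr (_ + _).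
  rewrite -IH -big_split /=; apply: eq_bigr => i _.
  by rewrite /bump /= add1n binz_pascal mulrDl subSS.
move: m; apply: (@int_updown _ 0).
- rewrite big_ord_recl binz_0 mul1r subn0 big1 ?addr0 ?add0r // => i _.
  by rewrite binzE0 mul0r.
- by move=> a IHa; rewrite step IHa -binz_pascal; congr (binz _ _); lia.
move=> a; rewrite step.
have -> : a + 1 + n = a + n + 1 by lia.
by rewrite binz_pascal => /addIr.
Qed.

(** * Residue calculus *)

Ltac idx := intros; repeat first [reflexivity | lia | progress f_equal].

(** The bound on [p] is uniform in [s], so that an expansion of [(z - x)^m] in powers of [x] meets
    only finitely many nonzero coefficients. *)
Definition utrunc {M : zmodType} (f : int -> int -> M) : Prop :=
  exists K : int, forall s p, K <= p -> f s p = 0.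

(* If [f s p] is the coefficient of [z^(-s-1) x^(-p-1)] in a two-variable series, then
   [ext f s p m] is the residue of the series multiplied by [z^s x^p (z - x)^m], the power
   being expanded in nonnegative powers of [x]. *)
Definition ext {M : lmodType C} (f : int -> int -> M) (s p m : int) : M :=
  fsumn (fun j : nat => (binz m j * sgn j) *: f (s + m - j%:Z) (p + j%:Z)).

(* Same for a series in [x] and [y = z - x], [c m p] being the coefficient of
   [y^(-m-1) x^(-p-1)], with [z^s] expanded in nonnegative powers of [y]. *)
Definition iter_ext {M : lmodType C} (c : int -> int -> M) (s p m : int) : M :=
  fsumn (fun j : nat => binz s j *: c (m + j%:Z) (s + p - j%:Z)).

(* [F s p m] is the value of a linear functional on [z^s x^p (z - x)^m]. *)
Definition pascal {M : zmodType} (F : int -> int -> int -> M) : Prop :=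
  forall s p m : int, F (s + 1) p m = F s (p + 1) m + F s p (m + 1).

(** Multiplication by [(z - x)^k], written without binomials: it makes sense for untruncated series
    and commutes visibly with other operations. *)
Fixpoint dlt {M : zmodType} (k : nat) (f : int -> int -> M) (s p : int) : M :=
  if k is k'.+1 then dlt k' f (s + 1) p - dlt k' f s (p + 1) else f s p.

Section Ext.
Variable M : lmodType C.
Implicit Types f g c : int -> int -> M.

Lemma ext_sfin f (s p m : int) : utrunc f ->
  sfin (fun j : nat => (binz m j * sgn j) *: f (s + m - j%:Z) (p + j%:Z)).
Proof.
case=> K h; exists `|K - p|%N => j hj; rewrite h ?scaler0 //; lia.
Qed.

Lemma extE K N f (s p m : int) : (forall s p, K <= p -> f s p = 0) -> K <= p + N%:Z ->
  ext f s p m = \sum_(j < N) (binz m j * sgn j) *: f (s + m - j%:Z) (p + j%:Z).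
Proof.
move=> h le; apply: fsumnE => j hj; rewrite h ?scaler0 //; lia.
Qed.

Lemma eq_ext f g (s p m : int) : (forall s p, f s p = g s p) -> ext f s p m = ext g s p m.
Proof. by move=> e; apply: eq_fsumn => j; rewrite e. Qed.

Lemma ext_trunc K f (s p m : int) : (forall s p, K <= p -> f s p = 0) -> K <= p ->
  ext f s p m = 0.
Proof. by move=> h le; apply: fsumn0 => j; rewrite h ?scaler0 //; lia. Qed.

Lemma ext_zero f (s p m : int) : (forall s p, f s p = 0) -> ext f s p m = 0.
Proof. by move=> h; apply: fsumn0 => j; rewrite h scaler0. Qed.

Lemma ext0 f (s p : int) : ext f s p 0 = f s p.
Proof.
rewrite /ext fsumn1; last by move=> j; rewrite binzE0 mul0r scale0r.
by rewrite binz_0 sgn0 mul1r scale1r subr0 !addr0.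
Qed.

Lemma extS f : utrunc f -> pascal (ext f).
Proof.
move=> hf s p m.
pose F (j : nat) := (binz m j * sgn j) *: f (s + m - j%:Z) (p + 1 + j%:Z).
pose G (j : nat) := (binz m j.+1 * sgn j.+1) *: f (s + 1 + m - j.+1%:Z) (p + j.+1%:Z).
pose a := f (s + 1 + m) p.
have hF : sfin F by apply: ext_sfin.
have hG : sfin G.
  by case: hf => K h; exists `|K - p|%N => j hj; rewrite /G h ?scaler0 //; lia.
have -> : ext f (s + 1) p m = a + fsumn G.
  rewrite /ext fsumnS; last exact: ext_sfin.
  by rewrite binz_0 sgn0 mul1r scale1r subr0 addr0.
have -> : ext f s (p + 1) m = fsumn F by [].
have -> : ext f s p (m + 1) = a + fsumn (fun j => G j - F j).
  rewrite /ext fsumnS; last exact: ext_sfin.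
  rewrite binz_0 sgn0 mul1r scale1r subr0 addr0 /a; congr (_ + _); first by idx.
  apply: eq_fsumn => j; rewrite /= /F /G binz_pascal mulrDl scalerDl; congr (_ + _).
    by idx.
  by rewrite sgnSn mulrN scaleNr; idx.
rewrite fsumnD //; last by case: hF => N hN; exists N => j hj; rewrite hN ?oppr0.
rewrite addrCA; congr (_ + _); rewrite addrCA.
rewrite -[LHS]addr0; congr (_ + _); rewrite -fsumnD //.
  by rewrite fsumn0 // => j; rewrite subrr.
by case: hF => N hN; exists N => j hj; rewrite hN ?oppr0.
Qed.

Lemma extD f g (s p m : int) : utrunc f -> utrunc g ->
  ext (fun s p => f s p + g s p) s p m = ext f s p m + ext g s p m.
Proof.
move=> hf hg; rewrite /ext -fsumnD; try exact: ext_sfin.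
by apply: eq_fsumn => j; rewrite scalerDr.
Qed.

Lemma ext_dlt k f (s p : int) : utrunc f -> ext f s p k%:Z = dlt k f s p.
Proof.
move=> hf; elim: k s p => [|k IH] s p; first exact: ext0.
rewrite /= -!IH (extS hf); have -> : k%:Z + 1 = k.+1%:Z by lia.
by rewrite addrC addKr.
Qed.

Lemma iter_ext_sfin K c (s p m : int) : (forall m p, K <= m -> c m p = 0) ->
  sfin (fun j : nat => binz s j *: c (m + j%:Z) (s + p - j%:Z)).
Proof. by move=> h; exists `|K - m|%N => j hj; rewrite h ?scaler0 //; lia. Qed.

Lemma iter_ext0 c (p m : int) : iter_ext c 0 p m = c m p.
Proof.
rewrite /iter_ext fsumn1; last by move=> j; rewrite binzE0 scale0r.
by rewrite binz_0 scale1r subr0 addr0 add0r.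
Qed.

Lemma iter_ext_trunc K c (s p m : int) : (forall m p, K <= m -> c m p = 0) -> K <= m ->
  iter_ext c s p m = 0.
Proof. by move=> h le; apply: fsumn0 => j; rewrite h ?scaler0 //; lia. Qed.

Lemma iter_extE K N c (s p m : int) : (forall m p, K <= m -> c m p = 0) -> K <= m + N%:Z ->
  iter_ext c s p m = \sum_(j < N) binz s j *: c (m + j%:Z) (s + p - j%:Z).
Proof.
move=> h le; apply: fsumnE => j hj; rewrite h ?scaler0 //; lia.
Qed.

Lemma eq_iter_ext f g (s p m : int) : (forall s p, f s p = g s p) ->
  iter_ext f s p m = iter_ext g s p m.
Proof. by move=> e; apply: eq_fsumn => j; rewrite e. Qed.

Lemma iter_extS K c : (forall m p, K <= m -> c m p = 0) -> pascal (iter_ext c).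
Proof.
move=> h s p m; rewrite /iter_ext fsumnS; last exact: iter_ext_sfin h.
rewrite [X in _ = X + _]fsumnS; last exact: iter_ext_sfin h.
rewrite -[RHS]addrA !binz_0; congr (_ + _); first by idx.
rewrite -fsumnD; last 2 first.
- by exists `|K - m|%N => j hj; rewrite /= h ?scaler0 //; lia.
- by exists `|K - m|%N => j hj; rewrite /= h ?scaler0 //; lia.
apply: eq_fsumn => j; rewrite /= binz_pascal scalerDl.
by congr (_ + _); idx.
Qed.

End Ext.

Section ExtLin.
Variables (M M' : lmodType C) (L : M -> M').
Hypothesis Llin : linear L.

Lemma linP0 : L 0 = 0.
Proof. by have := Llin (-1) 0 0; rewrite scaler0 addr0 scaleN1r addNr. Qed.
Lemma linPD x y : L (x + y) = L x + L y.
Proof. by have := Llin 1 x y; rewrite !scale1r. Qed.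
Lemma linPZ a x : L (a *: x) = a *: L x.
Proof. by have := Llin a x 0; rewrite linP0 !addr0. Qed.
Lemma linPN x : L (- x) = - L x.
Proof. by rewrite -scaleN1r linPZ scaleN1r. Qed.
Lemma linPB x y : L (x - y) = L x - L y.
Proof. by rewrite linPD linPN. Qed.
Lemma linP_sum (I : Type) (r : seq I) (P : pred I) (F : I -> M) :
  L (\sum_(i <- r | P i) F i) = \sum_(i <- r | P i) L (F i).
Proof. exact: (big_morph L linPD linP0). Qed.

Lemma ext_lin (f : int -> int -> M) s p m : utrunc f ->
  L (ext f s p m) = ext (fun s p => L (f s p)) s p m.
Proof.
move=> hf; rewrite /ext fsumn_additive; last exact: ext_sfin.
  by apply: eq_fsumn => j; rewrite /= linPZ.
by move=> x y; rewrite linPB.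
Qed.

Lemma iter_ext_lin K (c : int -> int -> M) s p m : (forall m p, K <= m -> c m p = 0) ->
  L (iter_ext c s p m) = iter_ext (fun m p => L (c m p)) s p m.
Proof.
move=> hc; rewrite /iter_ext fsumn_additive; last exact: iter_ext_sfin hc.
  by apply: eq_fsumn => j; rewrite /= linPZ.
by move=> x y; rewrite linPB.
Qed.

Lemma utrunc_lin (f : int -> int -> M) : utrunc f -> utrunc (fun s p => L (f s p)).
Proof. by case=> K h; exists K => s p le; rewrite h ?linP0. Qed.

End ExtLin.

Lemma scale_linear (M : lmodType C) (a : C) : linear ( *:%R a : M -> M).
Proof. by move=> b x y; rewrite scalerDr !scalerA mulrC. Qed.

Section ExtMore.
Variable M : lmodType C.
Implicit Types f g c : int -> int -> M.

Lemma utruncD f g : utrunc f -> utrunc g -> utrunc (fun s p => f s p + g s p).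
Proof.
case=> K h [K' h']; exists (Num.max K K') => s p; rewrite ge_max => /andP[le le'].
by rewrite h ?h' ?addr0.
Qed.

Lemma utruncZ a f : utrunc f -> utrunc (fun s p => a *: f s p).
Proof. exact: (utrunc_lin (scale_linear a)). Qed.

Lemma utruncB f g : utrunc f -> utrunc g -> utrunc (fun s p => f s p - g s p).
Proof.
move=> hf hg; apply: utruncD => //; have [K h] := hg.
by exists K => s p le; rewrite h ?oppr0.
Qed.

Lemma extZ a f (s p m : int) : utrunc f -> ext (fun s p => a *: f s p) s p m = a *: ext f s p m.
Proof. by move=> hf; rewrite (ext_lin (scale_linear a)). Qed.

Lemma extB f g (s p m : int) : utrunc f -> utrunc g ->
  ext (fun s p => f s p - g s p) s p m = ext f s p m - ext g s p m.
Proof.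
move=> hf hg; rewrite -[- ext g s p m]scaleN1r -extZ // -extD //.
  by apply: eq_ext => *; rewrite scaleN1r.
exact: utruncZ.
Qed.

Lemma iter_extD K c c' (s p m : int) : (forall m p, K <= m -> c m p = 0) ->
  (forall m p, K <= m -> c' m p = 0) ->
  iter_ext (fun m p => c m p + c' m p) s p m = iter_ext c s p m + iter_ext c' s p m.
Proof.
move=> h h'; rewrite /iter_ext -fsumnD; try by apply: iter_ext_sfin; eauto.
by apply: eq_fsumn => j; rewrite scalerDr.
Qed.

Lemma iter_extB K c c' (s p m : int) : (forall m p, K <= m -> c m p = 0) ->
  (forall m p, K <= m -> c' m p = 0) ->
  iter_ext (fun m p => c m p - c' m p) s p m = iter_ext c s p m - iter_ext c' s p m.
Proof.
move=> h h'; rewrite (@iter_extD K) // => [|n q le]; last by rewrite h' ?oppr0.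
congr (_ + _); rewrite -scaleN1r (iter_ext_lin (scale_linear (-1)) _ _ _ h').
by apply: eq_iter_ext => *; rewrite scaleN1r.
Qed.

Lemma dltS k f (s p : int) : dlt k.+1 f s p = dlt k (fun s p => f (s + 1) p - f s (p + 1)) s p.
Proof. by elim: k s p => //= k IH s p; rewrite -!IH. Qed.

Lemma eq_dlt k f g (s p : int) : (forall s p, f s p = g s p) -> dlt k f s p = dlt k g s p.
Proof. by move=> e; elim: k s p => //= k IH s p; rewrite !IH. Qed.

Lemma dlt_le k k' f : (k <= k')%N -> (forall s p, dlt k f s p = 0) ->
  forall s p, dlt k' f s p = 0.
Proof.
move=> /subnK <-; elim: (k' - k)%N => // n IH h s p.
by rewrite /= !IH // subrr.
Qed.

Lemma dltD k f g (s p : int) : dlt k (fun s p => f s p + g s p) s p = dlt k f s p + dlt k g s p.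
Proof. by elim: k s p => //= k IH s p; rewrite !IH opprD addrACA. Qed.

Lemma dlt_swap k f (s p : int) : dlt k (fun p s => f s p) p s = sgn k *: dlt k f s p.
Proof.
elim: k s p => [|k IH] s p /=; first by rewrite sgn0 scale1r.
by rewrite !IH sgnSn -scalerBr scaleNr -scalerN opprB.
Qed.

End ExtMore.

Lemma dlt_lin (M M' : lmodType C) (L : M -> M') k f s p : linear L ->
  L (dlt k f s p) = dlt k (fun s p => L (f s p)) s p.
Proof. by move=> h; elim: k s p => //= k IH s p; rewrite linPB // !IH. Qed.

Lemma dltB (M : lmodType C) k (f g : int -> int -> M) s p :
  dlt k (fun s p => f s p - g s p) s p = dlt k f s p - dlt k g s p.
Proof.
rewrite dltD; congr (_ + _); rewrite (@dlt_lin _ _ (@GRing.opp M)) //.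
by move=> a x y; rewrite opprD scalerN.
Qed.

Lemma dltZ (M : lmodType C) k a (f : int -> int -> M) s p :
  dlt k (fun s p => a *: f s p) s p = a *: dlt k f s p.
Proof. by rewrite (dlt_lin _ _ _ _ (scale_linear a)). Qed.

(** * Uniqueness principles for functionals on [z^s x^p (z - x)^m] *)

Section Pascal.
Variable M : lmodType C.
Implicit Types F G : int -> int -> int -> M.

Lemma pascalB F G : pascal F -> pascal G -> pascal (fun s p m => F s p m - G s p m).
Proof. by move=> hF hG s p m; rewrite hF hG opprD addrACA. Qed.

Lemma pascalD F G : pascal F -> pascal G -> pascal (fun s p m => F s p m + G s p m).
Proof. by move=> hF hG s p m; rewrite hF hG addrACA. Qed.

Lemma pascalZ a F : pascal F -> pascal (fun s p m => a *: F s p m).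
Proof. by move=> hF s p m; rewrite hF scalerDr. Qed.

(** [(z - x)^m = (-1)^m (x - z)^m]: the opposite product, expanded in powers of [z], obeys the same
    rule. *)
Lemma pascal_swap (f : int -> int -> M) :
  utrunc f -> pascal (fun s p m => sgn m *: ext f p s m).
Proof.
by move=> hf s p m; rewrite sgnS scaleNr -scalerBr (extS hf) addrK.
Qed.

(** A nonnegative power of [z - x] is a polynomial in [z] and [x], so the values at [m = 0]
    determine it. *)
Lemma pascal_nat F : pascal F -> (forall s p, F s p 0 = 0) ->
  forall (n : nat) s p, F s p n%:Z = 0.
Proof.
move=> hF h0; elim=> // n IH s p; have := hF s p n%:Z.
by rewrite !IH add0r; have -> : n%:Z + 1 = n.+1 by lia.
Qed.

(* The identity [z - x] lets exponents of [z] be traded for exponents of [x]. *)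
Lemma pascal_uniq_m0 F : pascal F -> (forall s p, F s p 0 = 0) ->
  (forall m, exists K : int, forall s p, K <= p -> F s p m = 0) ->
  forall s p m, F s p m = 0.
Proof.
move=> hF h0 hK; suff H m : forall s p, F s p m = 0 by move=> s p m; apply: H.
apply: (int_updown (P := fun m => forall s p, F s p m = 0) h0) => {}m H s p.
  by have := hF s p m; rewrite !H add0r.
have [K h] := hK m.
have E n : F s p m = F (s - n%:Z) (p + n%:Z) m.
  elim: n => [|n ->]; first by rewrite subr0 addr0.
  have -> : F (s - n%:Z) (p + n%:Z) m = F (s - n.+1%:Z + 1) (p + n%:Z) m.
    by congr F; lia.
  by rewrite hF H addr0; congr F; lia.
by rewrite (E `|K - p|%N) h //; lia.
Qed.

(** Once the values at [s + 1] vanish, raising [m] costs only a lowering of [p] and a sign, so large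
    [m] decides. *)
Lemma pascal_lower F s : pascal F -> (forall p m, F (s + 1) p m = 0) ->
  (exists K : int, forall p m, K <= m -> F s p m = 0) -> forall p m, F s p m = 0.
Proof.
move=> hF h1 [K h] p m.
suff H n : forall p m, K <= m + n%:Z -> F s p m = 0 by apply: (H `|K - m|%N); lia.
elim: n => [|n IH] {}p {}m le; first by apply: h; lia.
have := hF s (p - 1) m; rewrite h1 subrK (IH (p - 1) (m + 1)) ?addr0 //; lia.
Qed.

(** Reduces an identity to a single exponent of [z]: exponent [0] corresponds to iterate formulas, a
    large exponent to weak associativity. *)
Lemma pascal_uniq_s F s0 : pascal F -> (forall p m, F s0 p m = 0) ->
  (exists K : int, forall s p m, K <= m -> F s p m = 0) -> forall s p m, F s p m = 0.
Proof.
move=> hF h0 [K h]; apply: (int_updown h0) => s H p m.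
  by rewrite hF !H addr0.
by apply: pascal_lower => //; exists K => *; apply: h.
Qed.

(** Below the half-space [S <= s] the rule trades a raise of [p] for a lowering of [m] and a sign,
    until [p] reaches [P]. *)
Lemma pascal_uniq_sp F (S P : int) : pascal F -> (forall s p m, S <= s -> F s p m = 0) ->
  (forall s p m, P <= p -> F s p m = 0) -> forall s p m, F s p m = 0.
Proof.
move=> hF hS hP s p m.
suff H n : forall s, S <= s + n%:Z -> forall p m, F s p m = 0.
  by apply: (H `|S - s|%N); lia.
elim: n => [|n IH] {}s le {}p {}m; first by apply: hS; lia.
have h1 : forall p m, F (s + 1) p m = 0 by apply: IH; lia.
have E k : exists a : C, F s p m = a *: F s (p + k%:Z) (m - k%:Z).
  elim: k => [|k [a ->]]; first by exists 1; rewrite scale1r addr0 subr0.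
  exists (- a); have := hF s (p + k%:Z) (m - k.+1%:Z); rewrite h1.
  have -> : m - k.+1%:Z + 1 = m - k%:Z by lia.
  have -> : p + k%:Z + 1 = p + k.+1%:Z by lia.
  move/esym/eqP; rewrite addrC addr_eq0 => /eqP ->.
  by rewrite scalerN scaleNr.
by have [a ->] := E `|P - p|%N; rewrite hP ?scaler0 //; lia.
Qed.

Lemma pascal_pow F k (s p m : int) : pascal F ->
  \sum_(j < k.+1) binz k j *: F s (p + j%:Z) (m + (k - j)%N%:Z) = F (s + k%:Z) p m.
Proof.
move=> hF; elim: k s p m => [|k IH] s p m.
  by rewrite big_ord1 binz_0 scale1r !addr0.
have -> : s + k.+1%:Z = (s + k%:Z) + 1 by lia.
rewrite hF -!IH big_ord_recl [X in _ = _ + X]big_ord_recl addrCA !binz_0.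
congr (_ + _); first by rewrite /=; idx.
have E (i : 'I_k.+1) : binz k.+1 (lift ord0 i) *:
    F s (p + (lift ord0 i : nat)%:Z) (m + (k.+1 - lift ord0 i)%N%:Z) =
  binz k i.+1 *: F s (p + i.+1%:Z) (m + (k - i)%N%:Z) +
  binz k i *: F s (p + i.+1%:Z) (m + (k - i)%N%:Z).
  rewrite -scalerDl -binz_pascal lift0; congr (_ *: _).
  by have -> : k%:Z + 1 = k.+1 by lia.
rewrite (eq_bigr _ (fun i _ => E i)) big_split /= addrC; congr (_ + _).
  by apply: eq_bigr => i _; idx.
rewrite big_ord_recr /= binz_small // scale0r addr0.
by apply: eq_bigr => i _; have := ltn_ord i; rewrite /bump /=; idx.
Qed.

End Pascal.

(** The Jacobi identity in residues: [f] is the product with the field in [z] on the left, [g] the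
    opposite product, [c] the iterate in [y = z - x]. *)
Definition jacobi {M : lmodType C} (f g c : int -> int -> M) : Prop :=
  forall s p m, ext f s p m - sgn m *: ext g p s m = iter_ext c s p m.

(** Both sides obey the Pascal rule and agree at [s = 0] by the iterate formula. For large [m]
    locality kills the left side and truncation the right one, which determines the remaining
    exponents. *)
Lemma jacobi_of_iterate (M : lmodType C) (f g c : int -> int -> M) (k : nat) (K : int) :
  utrunc f -> utrunc g -> (forall m p, K <= m -> c m p = 0) ->
  (forall s p, dlt k (fun s p => f s p - g p s) s p = 0) ->
  (forall p m, ext f 0 p m - sgn m *: ext g p 0 m = c m p) ->
  jacobi f g c.
Proof.
move=> hf hg hc loc it s p m.
pose A s p m := ext f s p m - sgn m *: ext g p s m.
have hA : pascal A by apply: pascalB; [exact: extS|exact: pascal_swap].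
have hk (n : nat) s' p' : A s' p' (k + n)%N%:Z = 0.
  elim: n s' p' => [|n IH] s' p'.
    rewrite addn0 /A !ext_dlt //.
    rewrite (dlt_swap k (fun s p => g p s) s' p') scalerA sgnM scale1r.
    by rewrite -[RHS](loc s' p') dltB.
  have -> : (k + n.+1)%N%:Z = (k + n)%N%:Z + 1 by lia.
  by have := hA s' p' (k + n)%N%:Z; rewrite !IH add0r.
apply/eqP; rewrite -subr_eq0 -/(A s p m); apply/eqP.
apply: (@pascal_uniq_s _ (fun s p m => A s p m - iter_ext c s p m) 0).
- by apply: pascalB => //; apply: iter_extS hc.
- by move=> p' m'; rewrite iter_ext0 /A it subrr.
exists (Num.max k%:Z K) => s' p' m'; rewrite ge_max => /andP[le1 le2].
rewrite (iter_ext_trunc _ _ hc) // subr0.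
by have := hk `|m' - k%:Z|%N s' p'; congr (A _ _ _ = 0); lia.
Qed.

(** * Subspaces as modules *)

Section Subspace.
Variables (M : lmodType C) (P : M -> Prop) (hP : subspace P).

Definition subspace_pred of subspace P : {pred M} := fun x => `[<P x>].

Fact subspace_pred_closed : submod_closed (subspace_pred hP).
Proof.
case: hP => P0 PL; split; first exact/asboolP.
by move=> a x y /asboolP Px /asboolP Py; apply/asboolP; apply: PL.
Qed.

HB.instance Definition _ :=
  GRing.isSubmodClosed.Build C M (subspace_pred hP) subspace_pred_closed.

Definition subspace_type : Type := {x : M | x \in subspace_pred hP}.

HB.instance Definition _ := SubType.on subspace_type.
HB.instance Definition _ := [Choice of subspace_type by <:].
HB.instance Definition _ := [SubChoice_isSubLmodule of subspace_type by <:].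

Lemma subspace_typeP (x : subspace_type) : P (\val x).
Proof. by apply/asboolP; apply: (valP x). Qed.

Definition subspace_mk (x : M) (Px : P x) : subspace_type :=
  exist _ x (introT (asboolP _) Px).

End Subspace.

(** * The quadratic algebra *)

(* [X_i] and [Y_i] are treated uniformly: [qf a b] is the factor by which the modes of the
   generators [a] and [b] are exchanged, [kap a b] the coefficient of the delta function. *)
Record qdata : Type := QData {
  qidx :> finType;
  qf : qidx -> qidx -> C;
  kap : qidx -> qidx -> C;
  bar : qidx -> qidx;
  qfV : forall a b, qf a b * qf b a = 1;
  kap_qf : forall a b c, kap a b != 0 -> qf a c * qf b c = 1;
  kapC : forall a b, kap b a = - (qf b a * kap a b);
  kap_bar : forall a, kap a (bar a) != 0;
  bar_kap : forall a b, kap a b != 0 -> b = bar a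
}.

Section Modules.
Variable D : qdata.

Definition qmodule (W : lmodType C) (Z : D -> int -> W -> W) : Prop :=
  (forall a n, linear (Z a n)) /\
  forall a b m n w, Z a m (Z b n w) =
    qf a b *: Z b n (Z a m w) + (kap a b * (m + n + 1 == 0)%:R) *: w.

Definition vaclike (W : lmodType C) (Z : D -> int -> W -> W) (w : W) : Prop :=
  forall a m, 0 <= m -> Z a m w = 0.

Definition smooth (W : lmodType C) (Z : D -> int -> W -> W) : Prop :=
  forall w, exists K : int, forall a m, K <= m -> Z a m w = 0.

Definition universal (V : lmodType C) (Z : D -> int -> V -> V) (vac : V) : Prop :=
  [/\ qmodule Z, vaclike Z vac &
      forall (W : lmodType C) (ZW : D -> int -> W -> W) (w : W),
        qmodule ZW -> vaclike ZW w ->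
        exists f : V -> W,
          [/\ linear f, f vac = w, (forall a m v, f (Z a m v) = ZW a m (f v)) &
              forall g : V -> W, linear g -> g vac = w ->
                (forall a m v, g (Z a m v) = ZW a m (g v)) -> g =1 f]].

Definition tau (c : seq D) (b : D) : C := \prod_(a <- c) qf a b.

Lemma tau_nil b : tau [::] b = 1. Proof. by rewrite /tau big_nil. Qed.
Lemma tau_cons a c b : tau (a :: c) b = qf a b * tau c b.
Proof. by rewrite /tau big_cons. Qed.
Lemma tau_cat c d b : tau (c ++ d) b = tau c b * tau d b.
Proof. by rewrite /tau big_cat. Qed.

Lemma qf_neq0 (a b : D) : qf a b != 0.
Proof. by apply: contra_eq_neq (qfV a b) => ->; rewrite mul0r eq_sym oner_eq0. Qed.

Lemma tau_neq0 c b : tau c b != 0.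
Proof. by rewrite /tau prodf_seq_neq0; apply/allP => a _; apply: qf_neq0. Qed.

(** Generators with a nonzero contact term have inverse weights; this makes the rescaling of
    generators by [tau c] compatible with the inhomogeneous relation. *)
Lemma tau_kap c a b : kap a b != 0 -> tau c a * tau c b = 1.
Proof.
move=> h; elim: c => [|d c IH]; first by rewrite !tau_nil mulr1.
rewrite !tau_cons mulrACA IH mulr1.
have : (qf a d * qf b d) * (qf d a * qf d b) = 1 by rewrite mulrACA !qfV mulr1.
by rewrite (kap_qf d h) mul1r.
Qed.

Lemma kap_tau c a b : kap a b * (tau c a * tau c b) = kap a b.
Proof.
have [->|h] := eqVneq (kap a b) 0; first by rewrite mul0r.
by rewrite tau_kap ?mulr1.
Qed.

Section Universal.
Variables (V : lmodType C) (Z : D -> int -> V -> V) (vac : V).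
Hypothesis univ : universal Z vac.

(** The universal property for a target that is only a subspace [P] of [M]. Fields and Fock
    functions satisfy the relations on such a subspace, not on the ambient function space. *)
Lemma universal_hom (M : lmodType C) (P : M -> Prop) (act : D -> int -> M -> M) (w : M) :
  subspace P -> (forall a n x, P x -> P (act a n x)) ->
  (forall a n k x y, P x -> P y -> act a n (k *: x + y) = k *: act a n x + act a n y) ->
  (forall a b m n x, P x -> act a m (act b n x) =
    qf a b *: act b n (act a m x) + (kap a b * (m + n + 1 == 0)%:R) *: x) ->
  P w -> (forall a m, 0 <= m -> act a m w = 0) ->
  exists f : V -> M, [/\ linear f, f vac = w,
    (forall a m v, f (Z a m v) = act a m (f v)) & forall v, P (f v)].
Proof.
move=> hP Pact act_lin act_rel Pw vacw.
pose T : lmodType C := subspace_type hP.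
pose ZT a n (x : T) : T :=
  @subspace_mk _ _ hP (act a n (\val x)) (Pact a n _ (subspace_typeP x)).
have [||f [flin fvac fZ _]] := (let: And3 _ _ h := univ in h) T ZT (subspace_mk hP Pw).
- split=> [a n k x y|a b m n x]; apply: val_inj; rewrite linearP ?linearZ /=; last first.
    by rewrite act_rel //; apply: subspace_typeP.
    by apply: act_lin; apply: subspace_typeP.
- by move=> a m le; apply: val_inj; rewrite /= vacw // linear0.
exists (fun v => \val (f v)); split.
- by move=> k x y; rewrite flin linearP.
- by rewrite fvac.
- by move=> a m v; rewrite fZ.
- by move=> v; apply: subspace_typeP.
Qed.

(** The morphism with image in [P] and the identity both fix [vac], hence coincide by uniqueness. *)
Lemma universal_ind (P : V -> Prop) : subspace P -> P vac ->
  (forall a n v, P v -> P (Z a n v)) -> forall v, P v.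
Proof.
have [[Zlin Zrel] Zvac U] := univ => hP Pvac PZ v.
have [f [flin fvac fZ Pf]] := universal_hom hP PZ
  (fun a n k x y _ _ => Zlin a n k x y) (fun a b m n x _ => Zrel a b m n x) Pvac Zvac.
have [g [_ _ _ guniq]] := U V Z vac (conj Zlin Zrel) Zvac.
have -> : v = g v by apply: (guniq id).
by rewrite -(guniq f).
Qed.

End Universal.
End Modules.

(** * Fields *)

Lemma bound_below (P : nat -> int -> Prop) (N : nat) :
  (forall j : nat, exists K : int, forall q, K <= q -> P j q) ->
  exists K : int, forall j q, (j < N)%N -> K <= q -> P j q.
Proof.
move=> h; elim: N => [|N [K IH]]; first by exists 0.
have [K' h'] := h N; exists (Num.max K K') => j q; rewrite ltnS leq_eqVlt ge_max.
by case/orP => [/eqP -> /andP[_ /h']|lt /andP[le _]] //; apply: IH.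
Qed.

Lemma sum_antidiag (M : zmodType) (h : nat -> nat -> M) (n N : nat) : (n < N)%N ->
  \sum_(i < N) \sum_(j < N) (if (i + j == n)%N then h i j else 0) =
  \sum_(i < n.+1) h i (n - i)%N.
Proof.
move=> lt; rewrite (big_ord_widen N (fun i => h i (n - i)%N)) // [RHS]big_mkcond /=.
apply: eq_bigr => i _; case: ifPn => le; last first.
  by rewrite big1 // => j _; case: eqP => //; lia.
have lj : (n - i < N)%N by lia.
rewrite (bigD1 (Ordinal lj)) //= big1 => [|j]; last first.
  by rewrite -val_eqE /= => ne; case: eqP => //; lia.
by rewrite addr0; case: eqP => //; lia.
Qed.

Section Fields.
Variables (D : qdata) (W : lmodType C) (Z : D -> int -> W -> W).
Hypotheses (hZ : qmodule Z) (hs : smooth Z).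

Lemma Zlin a n : linear (Z a n). Proof. by case: hZ. Qed.

(* [b c] is the field attached to a vector twisted by the diagonal automorphism [tau c]. *)
Definition fields : lmodType C := (seq D -> int -> W -> W).
Implicit Types (x y : fields).

(** The last clause allows a word to be replaced by any other with the same eigenvalues, in
    particular by a permutation of it. *)
Definition isfield x : Prop :=
  [/\ forall c p, linear (x c p),
      forall c w, exists K : int, forall p, K <= p -> x c p w = 0 &
      forall c c', tau c =1 tau c' -> forall p w, x c p w = x c' p w].

Definition fleft (a : D) x c w : int -> int -> W := fun s p => Z a s (x c p w).
Definition fright (a : D) x c w : int -> int -> W := fun p s => x (a :: c) p (Z a s w).

(** In the second residue [a] stands to the right of the field, which adds [a] to the twist. The
    factor [tau c a] comes from twisting the vector [a_m v] itself. *)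
Definition fact (a : D) (m : int) x : fields := fun c p w =>
  tau c a *: (ext (fleft a x c w) 0 p m - sgn m *: ext (fright a x c w) p 0 m).

Definition fvac : fields := fun _ n w => if n == -1 then w else 0.

Lemma fleft_utrunc a x c w : isfield x -> utrunc (fleft a x c w).
Proof.
case=> _ h _; have [K hK] := h c w; exists K => s p le.
by rewrite /fleft hK // (linP0 (Zlin a s)).
Qed.

Lemma fright_utrunc a x c w : isfield x -> utrunc (fright a x c w).
Proof.
case=> h _ _; have [K hK] := hs w; exists K => p s le.
by rewrite /fright hK // (linP0 (h _ _)).
Qed.

Lemma isfield_subspace : subspace isfield.
Proof.
split; first by split=> // [c p k u v|c w]; [rewrite scaler0 addr0|exists 0].
move=> k x y [x1 x2 x3] [y1 y2 y3]; split.
- move=> c p l u v; have -> w : (k *: x + y) c p w = k *: x c p w + y c p w by [].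
  by rewrite x1 y1 !scalerDr !scalerA mulrC addrACA.
- move=> c w; have [K hK] := x2 c w; have [K' hK'] := y2 c w.
  exists (Num.max K K') => p; rewrite ge_max => /andP[l1 l2].
  have -> : (k *: x + y) c p w = k *: x c p w + y c p w by [].
  by rewrite hK ?hK' ?scaler0 ?addr0.
move=> c c' e p w; have E d : (k *: x + y) d p w = k *: x d p w + y d p w by [].
by rewrite !E (x3 _ _ e) (y3 _ _ e).
Qed.

Lemma fact_lin a n k x y : isfield x -> isfield y ->
  fact a n (k *: x + y) = k *: fact a n x + fact a n y.
Proof.
move=> hx hy; apply/funext => c; apply/funext => p; apply/funext => w.
have E d q u : (k *: x + y) d q u = k *: x d q u + y d q u by [].
have E' d q u (x' y' : fields) : (k *: x' + y') d q u = k *: x' d q u + y' d q u by [].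
have lu := fleft_utrunc a c w; have ru := fright_utrunc a c w.
rewrite E' /fact.
rewrite (@eq_ext _ (fleft a (k *: x + y) c w)
  (fun s q => k *: fleft a x c w s q + fleft a y c w s q)); last first.
  by move=> s q; rewrite /fleft E Zlin.
rewrite (@eq_ext _ (fright a (k *: x + y) c w)
  (fun q s => k *: fright a x c w q s + fright a y c w q s)) //.
rewrite !extD ?extZ; try by [apply: lu|apply: ru|apply/utruncZ/lu|apply/utruncZ/ru].
rewrite scalerA mulrC -scalerA -scalerDr; congr (_ *: _).
by rewrite scalerBr scalerDr opprD !scalerA [k * _]mulrC -!scalerA addrACA.
Qed.

Lemma isfield_fact a n x : isfield x -> isfield (fact a n x).
Proof.
move=> hx; have [x1 x2 x3] := hx; split.
- move=> c p k u v; rewrite /fact.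
  rewrite (@eq_ext _ (fleft a x c (k *: u + v))
    (fun s q => k *: fleft a x c u s q + fleft a x c v s q)); last first.
    by move=> s q; rewrite /fleft x1 Zlin.
  rewrite (@eq_ext _ (fright a x c (k *: u + v))
    (fun q s => k *: fright a x c u q s + fright a x c v q s)); last first.
    by move=> s q; rewrite /fright Zlin x1.
  have lu w := fleft_utrunc a c w hx; have ru w := fright_utrunc a c w hx.
  rewrite !extD ?extZ; try by [apply: lu|apply: ru|apply/utruncZ/lu|apply/utruncZ/ru].
  rewrite scalerA mulrC -scalerA -scalerDr; congr (_ *: _).
  by rewrite scalerBr scalerDr opprD !scalerA [k * _]mulrC -!scalerA addrACA.
- move=> c w; have [K hK] := x2 c w; have [K' hK'] := hs w.
  (* Only finitely many modes [Z a j w] with [0 <= j] are nonzero, so one bound serves them all. *)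
  have [L hL] := @bound_below (fun j q => x (a :: c) q (Z a j%:Z w) = 0) `|K'|%N
    (fun j => x2 (a :: c) (Z a j w)).
  exists (Num.max K (L + `|n|%N%:Z + `|K'|%N%:Z)) => p; rewrite ge_max => /andP[l1 l2].
  rewrite /fact (@ext_trunc _ K) //; last first.
    by move=> s q le; rewrite /fleft hK // (linP0 (Zlin _ _)).
  rewrite sub0r (@extE _ K' `|K'|%N); last 2 first.
  - by move=> q s le; rewrite /fright hK' // (linP0 (x1 _ _)).
  - by lia.
  rewrite big1 ?scaler0 ?oppr0 ?scaler0 // => i _.
  by rewrite /fright add0r hL ?scaler0 //; have := ltn_ord i; lia.
move=> c c' e p w; rewrite /fact e; congr (_ *: (_ - _ *: _)).
  by apply: eq_ext => s q; rewrite /fleft (x3 c c').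
by apply: eq_ext => s q; rewrite /fright (x3 (a :: c) (a :: c')) // => d; rewrite !tau_cons e.
Qed.

Lemma isfield_fvac : isfield fvac.
Proof.
split=> //; last by move=> c w; exists 0 => p le; rewrite /fvac; case: eqP => //; lia.
by move=> c p k u v; rewrite /fvac; case: eqP => //; rewrite scaler0 addr0.
Qed.

Lemma fact_fvac a m : 0 <= m -> fact a m fvac = 0.
Proof.
move=> le; apply/funext => c; apply/funext => p; apply/funext => w.
have hv := isfield_fvac; rewrite /fact.
pose F s p m := ext (fleft a fvac c w) s p m - sgn m *: ext (fright a fvac c w) p s m.
have hF : pascal F.
  apply: pascalB; first by apply: extS; apply: fleft_utrunc.
  by apply: pascal_swap; apply: fright_utrunc.
have h0 s q : F s q 0 = 0.
  rewrite /F !ext0 sgn0 scale1r /fleft /fright /fvac; case: eqP => _; rewrite ?subrr //.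
  by rewrite (linP0 (Zlin _ _)) subr0.
have := pascal_nat hF h0 `|m|%N 0 p; rewrite /F gez0_abs // => ->.
by rewrite scaler0.
Qed.

(** The expansion coefficients of [1 / (z - x)] are all [1], and each mode is met by exactly one of
    the two expansions: the left one for [n < 0], the right one for [0 <= n]. *)
Lemma fact_fvacE a n w : fact a (-1) fvac [::] n w = Z a n w.
Proof.
have cf j : binz (-1) j * sgn j = 1.
  have := binz_neg 1 j; rewrite subrr add0r => <-.
  rewrite -mulrA sgnM mulr1 /binz; apply: (canLR (mulfK _)); first exact: factC_neq0.
  rewrite mul1r; elim: j => [|j IH]; first by rewrite big_ord0 fact0.
  rewrite factS natrM -IH big_ord_recl subr0; apply: congr2 => //; apply: eq_bigr => i _.
  by apply: (congr1 (fun z : int => z%:~R : C)); rewrite /= /bump; lia.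
rewrite /fact tau_nil scale1r /ext (_ : sgn (-1) = -1); last first.
  by have := sgnS (-1); rewrite addNr sgn0 => ->; rewrite opprK.
rewrite scaleN1r opprK; case: (leP 0 n) => le.
  rewrite fsumn0 ?add0r => [|j]; last first.
    rewrite /fleft /fvac; case: eqP => [|_]; first by lia.
    by rewrite (linP0 (Zlin _ _)) scaler0.
  rewrite (@fsumn_pick _ _ `|n|%N) => [|j ne].
    by rewrite cf scale1r /fright /fvac; case: eqP; [idx|lia].
  by rewrite /fright /fvac; case: eqP; rewrite ?scaler0 //; lia.
rewrite [X in _ + X]fsumn0 ?addr0 => [|j]; last first.
  by rewrite /fright /fvac; case: eqP; rewrite ?scaler0 //; lia.
rewrite (@fsumn_pick _ _ `|(n + 1)%R|%N) => [|j ne].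
  by rewrite cf scale1r /fleft /fvac; case: eqP; [idx|lia].
rewrite /fleft /fvac; case: eqP => [|_]; first by lia.
by rewrite (linP0 (Zlin _ _)) scaler0.
Qed.

Local Notation cf m j := (binz m j * sgn j).

Lemma factE (b : D) (n : int) x c (q : int) u (K K' : int) (N : nat) : isfield x ->
  (forall q, K <= q -> x c q u = 0) -> (forall s, K' <= s -> Z b s u = 0) ->
  K <= q + N%:Z -> K' <= N%:Z ->
  fact b n x c q u = tau c b *:
    (\sum_(j < N) cf n j *: Z b (n - j%:Z) (x c (q + j%:Z) u) -
     \sum_(j < N) (sgn n * cf n j) *: x (b :: c) (q + n - j%:Z) (Z b j%:Z u)).
Proof.
move=> [x1 _ _] hK hK' l1 l2; rewrite /fact (@extE _ K N) //; last first.
  by move=> s q' le; rewrite /fleft hK // (linP0 (Zlin _ _)).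
rewrite (@extE _ K' N); last 2 first.
- by move=> q' s le; rewrite /fright hK' // (linP0 (x1 _ _)).
- by rewrite add0r.
rewrite scaler_sumr; congr (_ *: (_ - _)); apply: eq_bigr => j _.
  by rewrite /fleft add0r.
by rewrite /fright scalerA add0r.
Qed.

Lemma fact_act0 (b : D) (n : int) x c (q : int) : isfield x -> fact b n x c q 0 = 0.
Proof. by move=> hx; have [h _ _] := isfield_fact b n hx; rewrite (linP0 (h _ _)). Qed.

Lemma fright_bound (b : D) x c w : isfield x ->
  exists K : int, forall (j : nat) q, K <= q -> x c q (Z b j w) = 0.
Proof.
case=> x1 x2 _; have [K' hK'] := hs w.
have [K hK] := @bound_below (fun j q => x c q (Z b j%:Z w) = 0) `|K'|%N
  (fun j => x2 c (Z b j w)).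
exists K => j q le; case: (ltnP j `|K'|%N) => lj; first exact: hK.
by rewrite hK' ?(linP0 (x1 _ _)) //; lia.
Qed.

(** The four positions of [a] and [b] around the field. The factor [qf a b] appears because [b] acts
    on a field already twisted by [a]. All sums are cut at one large [N], so that the two orders of
    action can be compared term by term. *)
Lemma fact2E (a b : D) (m n : int) x c (p : int) w : isfield x ->
  exists N0 : nat, forall N : nat, (N0 <= N)%N ->
  fact a m (fact b n x) c p w = (tau c a * tau c b) *:
   (\sum_(i < N) \sum_(j < N)
       (cf m i * cf n j) *: Z a (m - i%:Z) (Z b (n - j%:Z) (x c (p + i%:Z + j%:Z) w))
  - \sum_(i < N) \sum_(j < N) (cf m i * (sgn n * cf n j)) *:
       Z a (m - i%:Z) (x (b :: c) (p + i%:Z + n - j%:Z) (Z b j%:Z w))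
  - qf a b *: (\sum_(i < N) \sum_(j < N) ((sgn m * cf m i) * cf n j) *:
       Z b (n - j%:Z) (x (a :: c) (p + m - i%:Z + j%:Z) (Z a i%:Z w))
  - \sum_(i < N) \sum_(j < N) ((sgn m * cf m i) * (sgn n * cf n j)) *:
       x (b :: a :: c) (p + m - i%:Z + n - j%:Z) (Z b j%:Z (Z a i%:Z w)))).
Proof.
move=> hx; have [x1 x2 _] := hx; have hf := isfield_fact b n hx; have [_ f2 _] := hf.
have [K1 h1] := x2 c w; have [Kw hw] := hs w.
have [K3 h3] := fright_bound a (a :: c) w hx.
have [K4 h4] : exists K : int, forall (i : nat) s, K <= s -> Z b s (Z a i w) = 0.
  have [K hK] := @bound_below (fun i s => Z b s (Z a i%:Z w) = 0) `|Kw|%N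
    (fun i => let: ex_intro K h := hs (Z a i w) in ex_intro _ K (h b)).
  exists K => i s le; case: (ltnP i `|Kw|%N) => li; first exact: hK.
  by rewrite hw ?(linP0 (Zlin _ _)) //; lia.
have [K5 h5] := f2 c w.
exists (`|K1| + `|Kw| + `|K3| + `|K4| + `|K5| + `|p| + `|m|)%N => N leN.
rewrite (@factE _ _ _ _ _ _ K5 Kw N) //; try lia; last by move=> s; apply: hw.
rewrite -scalerA; congr (_ *: _).
rewrite (eq_bigr (fun i : 'I_N => tau c b *:
   (\sum_(j < N) (cf m i * cf n j) *:
      Z a (m - i%:Z) (Z b (n - j%:Z) (x c (p + i%:Z + j%:Z) w))
    - \sum_(j < N) (cf m i * (sgn n * cf n j)) *:
      Z a (m - i%:Z) (x (b :: c) (p + i%:Z + n - j%:Z) (Z b j%:Z w))))); last first.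
  move=> i _; rewrite (@factE _ _ _ _ _ _ K1 Kw N) //; try lia; last by move=> s; apply: hw.
  rewrite (linPZ (Zlin _ _)) scalerA mulrC -scalerA; congr (_ *: _).
  rewrite (linPB (Zlin _ _)) !(linP_sum (Zlin _ _)) scalerBr !scaler_sumr.
  by congr (_ - _); apply: eq_bigr => j _; rewrite (linPZ (Zlin _ _)) scalerA.
rewrite [X in _ - X](eq_bigr (fun i : 'I_N => (qf a b * tau c b) *:
   (\sum_(j < N) ((sgn m * cf m i) * cf n j) *:
      Z b (n - j%:Z) (x (a :: c) (p + m - i%:Z + j%:Z) (Z a i%:Z w))
    - \sum_(j < N) ((sgn m * cf m i) * (sgn n * cf n j)) *:
      x (b :: a :: c) (p + m - i%:Z + n - j%:Z) (Z b j%:Z (Z a i%:Z w))))); last first.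
  move=> i _; rewrite -tau_cons.
  case: (ltnP i `|Kw|%N) => li.
    rewrite (@factE _ _ _ _ _ _ K3 K4 N) //; try lia; first last.
    - by move=> s; apply: h4.
    - by move=> q; apply: h3.
    rewrite scalerA mulrC -scalerA; congr (_ *: _).
    rewrite scalerBr !scaler_sumr.
    by congr (_ - _); apply: eq_bigr => j _; rewrite scalerA.
  have -> : Z a i%:Z w = 0 by rewrite hw //; lia.
  rewrite fact_act0 // !big1 ?subrr ?scaler0 // => j _.
    by rewrite (linP0 (Zlin _ _)) (linP0 (x1 _ _)) scaler0.
  by rewrite (linP0 (x1 _ _)) (linP0 (Zlin _ _)) scaler0.
rewrite -!scaler_sumr !sumrB mulrC -scalerA -scalerBr; congr (_ *: _).
Qed.

(** Contribution of the delta function: on [i + j = k] with [k = m + n + 1], Vandermonde gives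
    [(-1)^k binom(k - 1, k)], which is zero unless [k = 0]. *)
Lemma contact_sum (m n : int) (y : int -> W) (N : nat) : (`|(m + n + 1)%R| < N)%N ->
  \sum_(i < N) \sum_(j < N) (cf m i * cf n j * ((m - i%:Z) + (n - j%:Z) + 1 == 0)%:R)
     *: y (i%:Z + j%:Z) = (m + n + 1 == 0)%:R *: y 0.
Proof.
move=> lt; case: (ltP (m + n + 1) 0) => le.
  rewrite (_ : (m + n + 1 == 0) = false) ?scale0r; last by lia.
  rewrite big1 // => i _; rewrite big1 // => j _.
  by rewrite (_ : (_ == 0) = false) ?mulr0 ?scale0r //; lia.
set k := `|(m + n + 1)%R|%N in lt.
rewrite (eq_bigr (fun i : 'I_N => \sum_(j < N)
  (if (i + j == k)%N then (cf m i * cf n j) *: y k%:Z else 0))); last first.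
  move=> i _; apply: eq_bigr => j _.
  rewrite (_ : (_ == 0) = (i + j == k)%N); last by rewrite /k; lia.
  case: eqP => [e|_]; rewrite ?mulr0 ?scale0r // mulr1; congr (_ *: y _).
  by rewrite -e PoszD.
rewrite (sum_antidiag (fun i j => (cf m i * cf n j) *: y k%:Z)) // -scaler_suml.
have -> : \sum_(i < k.+1) cf m i * cf n (k - i)%N = sgn k * binz (m + n) k.
  rewrite -binz_vandermonde mulr_sumr; apply: eq_bigr => i _.
  rewrite mulrACA [sgn i * _]mulrC -sgnD [RHS]mulrC; congr (_ * sgn _).
  by have := ltn_ord i; lia.
case: (ltnP 0 k) => k0.
  rewrite (_ : (m + n + 1 == 0) = false); last by move: k0; rewrite /k; lia.
  have -> : m + n = (k.-1)%:Z by move: k0; rewrite /k; lia.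
  by rewrite binz_small ?mulr0 ?scale0r //; lia.
have -> : k = 0%N by lia.
rewrite sgn0 binz_0 mulr1 (_ : (m + n + 1 == 0) = true) //.
by move: k0; rewrite /k; lia.
Qed.

(** Mixed terms match after an exchange of sums. The terms with both generators on the right involve
    nonnegative modes only, hence no contact term; those with both on the left produce exactly the
    contact term of the relation. *)
Lemma fact_rel (a b : D) (m n : int) x : isfield x ->
  fact a m (fact b n x) = qf a b *: fact b n (fact a m x) +
    (kap a b * (m + n + 1 == 0)%:R) *: x.
Proof.
move=> hx; have [x1 _ x3] := hx; have [_ Zrel] := hZ.
apply/funext => c; apply/funext => p; apply/funext => w.
have [N1 h1] := fact2E a b m n c p w hx; have [N2 h2] := fact2E b a n m c p w hx.
have [ha hb] : `|(m + n + 1)%R| < (N1 + N2 + `|(m + n + 1)%R|).+1 /\ (0 <= 0)%N by lia.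
set N := (N1 + N2 + `|(m + n + 1)%R|).+1 in ha.
have -> : (qf a b *: fact b n (fact a m x) + (kap a b * (m + n + 1 == 0)%:R) *: x) c p w
  = qf a b *: fact b n (fact a m x) c p w + (kap a b * (m + n + 1 == 0)%:R) *: x c p w.
  by [].
rewrite (h1 N) ?(h2 N); try by rewrite /N; lia.
set LL := (\sum_(i < N) _ in LHS); set LR := (X in LL - X - _).
set RL := (X in LL - LR - _ *: (X - _)); set RR := (X in LL - LR - _ *: (RL - X)).
set LL' := (X in qf a b *: (_ *: (X - _ - _))).
set LR' := (X in qf a b *: (_ *: (LL' - X - _))).
set RL' := (X in qf a b *: (_ *: (LL' - LR' - _ *: (X - _)))).
set RR' := (X in qf a b *: (_ *: (LL' - LR' - _ *: (RL' - X)))).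
have eLR : LR' = RL.
  rewrite /LR' exchange_big; apply: eq_bigr => i _; apply: eq_bigr => j _.
  by rewrite mulrC; idx.
have eRL : RL' = LR.
  rewrite /RL' exchange_big; apply: eq_bigr => i _; apply: eq_bigr => j _.
  by rewrite mulrC; idx.
have eRR : RR' = qf a b *: RR.
  rewrite /RR' exchange_big scaler_sumr; apply: eq_bigr => i _.
  rewrite scaler_sumr; apply: eq_bigr => j _; rewrite scalerA [X in X *: _]mulrC.
  rewrite (x3 (a :: b :: c) (b :: a :: c)); last by move=> d; rewrite !tau_cons mulrCA.
  rewrite Zrel (_ : (_ == 0) = false); last by lia.
  rewrite mulr0 scale0r addr0 (linPZ (x1 _ _)) !scalerA; congr (_ *: _).
    by rewrite [LHS]mulrC; congr (_ * _); rewrite mulrC.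
  by idx.
have eLL : LL = qf a b *: LL' + (kap a b * (m + n + 1 == 0)%:R) *: x c p w.
  rewrite /LL' exchange_big /= mulrC -scalerA.
  have := contact_sum (fun k => kap a b *: x c (p + k) w) ha; rewrite addr0 => <-.
  rewrite scaler_sumr -big_split; apply: eq_bigr => i _ /=.
  rewrite scaler_sumr -big_split; apply: eq_bigr => j _ /=.
  rewrite Zrel scalerDr !scalerA; congr (_ + _).
    rewrite [X in X *: _ = _]mulrC [cf n j * cf m i]mulrC.
    by have -> : p + j%:Z + i%:Z = p + i%:Z + j%:Z by lia.
  have -> : p + (i%:Z + j%:Z) = p + i%:Z + j%:Z by lia.
  by rewrite [kap a b * _]mulrC !mulrA.
rewrite eLR eRL eRR eLL.
set k := (X in _ + X *: x c p w).
(* The contact term carries no twist: [tau c a * tau c b] is [1] wherever [kap a b] is nonzero. *)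
have ek : k *: x c p w = (tau c a * tau c b) *: (k *: x c p w).
  by rewrite scalerA /k mulrA [(_ * _) * kap a b]mulrC kap_tau.
rewrite [in RHS]ek [tau c b * _]mulrC [qf a b *: (_ *: _)]scalerA [qf a b * _]mulrC.
rewrite -[(_ * qf a b) *: _]scalerA -scalerDr; congr (_ *: _).
rewrite !scalerBr !scalerA qfV !scale1r.
rewrite mul1r opprB; move: (qf a b *: LL') (qf a b *: RL) (qf a b *: RR) (k *: _) => A B E F.
by rewrite opprB -!addrA; congr (_ + _); rewrite addrC [- LR + _]addrC [E - B]addrC -!addrA.
Qed.

End Fields.

(** * Vertex operators *)

Section ExtShift.
Variable M : lmodType C.

Lemma ext_shiftl (f : int -> int -> M) (s p m : int) :
  ext f (s + 1) p m = ext (fun s p => f (s + 1) p) s p m.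
Proof. by apply: eq_fsumn => j; idx. Qed.

Lemma ext_shiftr (f : int -> int -> M) (s p m : int) :
  ext f s (p + 1) m = ext (fun s p => f s (p + 1)) s p m.
Proof. by apply: eq_fsumn => j; idx. Qed.

Lemma utrunc_shiftl (f : int -> int -> M) : utrunc f -> utrunc (fun s p => f (s + 1) p).
Proof. by case=> K h; exists K => s p le; apply: h. Qed.

Lemma utrunc_shiftr (f : int -> int -> M) : utrunc f -> utrunc (fun s p => f s (p + 1)).
Proof. by case=> K h; exists (K - 1) => s p le; apply: h; lia. Qed.

Lemma dlt_extr k (G : int -> int -> int -> M) (t s p n : int) : (forall s, utrunc (G s)) ->
  dlt k (fun s p => ext (G s) t p n) s p =
  ext (fun t q => dlt k (fun s q => G s t q) s q) t p n.
Proof.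
elim: k G => [//|k IH] G hG; rewrite dltS.
pose G' s t q := G (s + 1) t q - G s t (q + 1).
rewrite (@eq_dlt _ _ _ (fun s p => ext (G' s) t p n)); last first.
  by move=> s' p'; rewrite ext_shiftr -extB //; apply: utrunc_shiftr.
rewrite IH; last by move=> s'; apply: utruncB => //; apply: utrunc_shiftr.
by apply: eq_ext => t' q'; rewrite dltS.
Qed.

Lemma dlt_extl k (G : int -> int -> int -> M) (t s p n : int) : (forall s, utrunc (G s)) ->
  dlt k (fun s p => ext (G s) p t n) s p =
  ext (fun q t => dlt k (fun s q => G s q t) s q) p t n.
Proof.
elim: k G => [//|k IH] G hG; rewrite dltS.
pose G' s q t := G (s + 1) q t - G s (q + 1) t.
rewrite (@eq_dlt _ _ _ (fun s p => ext (G' s) p t n)); last first.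
  by move=> s' p'; rewrite ext_shiftl -extB //; apply: utrunc_shiftl.
rewrite IH; last by move=> s'; apply: utruncB => //; apply: utrunc_shiftl.
by apply: eq_ext => t' q'; rewrite dltS.
Qed.

End ExtShift.

Section Vertex.
Variables (D : qdata) (V : lmodType C) (ZV : D -> int -> V -> V) (vac : V).
Hypothesis univ : universal ZV vac.

Lemma univ_qmodule : qmodule ZV. Proof. by case: univ. Qed.

Lemma univ_smooth : smooth ZV.
Proof.
have [[Zl Zrel] Zvac _] := univ; move=> v.
apply: (universal_ind univ (P := fun v => exists K : int, forall a m, K <= m -> ZV a m v = 0)).
- split; first by exists 0 => a m _; rewrite (linP0 (Zl _ _)).
  move=> k x y [K hK] [K' hK']; exists (Num.max K K') => a m.
  by rewrite ge_max Zl => /andP[l1 l2]; rewrite hK ?hK' // scaler0 addr0.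
- by exists 0 => a m le; rewrite Zvac.
move=> b n w [K hK]; exists (Num.max K (- n)) => a m; rewrite ge_max => /andP[l1 l2].
rewrite Zrel hK // (linP0 (Zl _ _)) scaler0 add0r.
by rewrite (_ : (_ == 0) = false) ?mulr0 ?scale0r //; lia.
Qed.

Lemma theta_ex c : exists f : V -> V,
  [/\ linear f, f vac = vac & forall a m v, f (ZV a m v) = tau c a *: ZV a m (f v)].
Proof.
have [[Zl Zrel] Zvac _] := univ.
have [||||||f [f1 f2 f3 _]] := universal_hom univ (P := fun _ : V => True)
  (act := fun a m v => tau c a *: ZV a m v) (w := vac); try by [].
- by move=> a n k x y _ _; rewrite Zl scalerDr !scalerA mulrC.
- move=> a b m n x _; rewrite !(linPZ (Zl _ _)) Zrel !scalerA scalerDr !scalerA.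
  congr (_ *: _ + _ *: _); first by ring.
  by rewrite mulrA [(_ * _) * kap a b]mulrC kap_tau.
- by move=> a m le; rewrite Zvac // scaler0.
by exists f.
Qed.

Definition theta c : V -> V := proj1_sig (cid (theta_ex c)).

Lemma theta_lin c : linear (theta c).
Proof. by rewrite /theta; case: cid => f []. Qed.
Lemma theta_vac c : theta c vac = vac.
Proof. by rewrite /theta; case: cid => f []. Qed.
Lemma theta_Z c a m v : theta c (ZV a m v) = tau c a *: ZV a m (theta c v).
Proof. by rewrite /theta; case: cid => f []. Qed.

Lemma eq_lin_subspace (M : lmodType C) (f g : V -> M) : linear f -> linear g ->
  subspace (fun v => f v = g v).
Proof.
move=> hf hg; split; first by rewrite (linP0 hf) (linP0 hg).
by move=> k x y ex ey; rewrite hf hg ex ey.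
Qed.

Lemma comp_lin (M1 M2 M3 : lmodType C) (f : M2 -> M3) (g : M1 -> M2) :
  linear f -> linear g -> linear (fun v => f (g v)).
Proof. by move=> hf hg k x y; rewrite hg hf. Qed.

Lemma theta_cat c d v : theta (c ++ d) v = theta c (theta d v).
Proof.
have [Zl _] := univ_qmodule; move: v; apply: (universal_ind univ).
- by apply: eq_lin_subspace; [exact: theta_lin|apply: comp_lin; exact: theta_lin].
- by rewrite !theta_vac.
move=> a n v IH; rewrite !theta_Z IH (linPZ (theta_lin c)) theta_Z scalerA tau_cat.
by rewrite mulrC.
Qed.

Lemma theta_cons a c v : theta (a :: c) v = theta [:: a] (theta c v).
Proof. exact: (theta_cat [:: a]). Qed.

Lemma eq_theta c d : tau c =1 tau d -> theta c =1 theta d.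
Proof.
move=> e; apply: (universal_ind univ).
- by apply: eq_lin_subspace; exact: theta_lin.
- by rewrite !theta_vac.
by move=> a n v IH; rewrite !theta_Z IH e.
Qed.

Lemma theta_id c v : (forall b, tau c b = 1) -> theta c v = v.
Proof.
move=> e; move: v; apply: (universal_ind univ).
- by apply: eq_lin_subspace => //; exact: theta_lin.
- by rewrite !theta_vac.
by move=> a n v IH; rewrite !theta_Z IH e scale1r.
Qed.

Lemma theta_nil v : theta [::] v = v.
Proof. by apply: theta_id => b; rewrite tau_nil. Qed.

Lemma theta_swap a c v : theta [:: a] (theta c v) = theta c (theta [:: a] v).
Proof. by rewrite -!theta_cat; apply: eq_theta => b; rewrite !tau_cat mulrC. Qed.

Lemma theta_comm c d v : theta c (theta d v) = theta d (theta c v).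
Proof. by rewrite -!theta_cat; apply: eq_theta => b; rewrite !tau_cat mulrC. Qed.

Lemma theta_kap a b v : kap a b != 0 -> theta [:: a] (theta [:: b] v) = v.
Proof.
move=> h; rewrite -theta_cat; apply: theta_id => c.
by rewrite !tau_cons tau_nil mulr1 (kap_qf c h).
Qed.

Section Action.
Variables (W : lmodType C) (Z : D -> int -> W -> W).
Hypotheses (hZ : qmodule Z) (hs : smooth Z).

Lemma fieldmap_ex : exists f : V -> fields D W,
  [/\ linear f, f vac = @fvac D W, (forall a m v, f (ZV a m v) = fact Z a m (f v)) &
      forall v, isfield (f v)].
Proof.
apply: (universal_hom univ).
- exact: isfield_subspace.
- by move=> a n x; apply: isfield_fact.
- by move=> a n k x y; apply: fact_lin.
- by move=> a b m n x; apply: fact_rel.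
- exact: isfield_fvac.
by move=> a m; apply: fact_fvac.
Qed.

Definition fieldmap : V -> fields D W := proj1_sig (cid fieldmap_ex).

Lemma fieldmap_lin : linear fieldmap.
Proof. by rewrite /fieldmap; case: cid => f []. Qed.
Lemma fieldmap_vac : fieldmap vac = @fvac D W.
Proof. by rewrite /fieldmap; case: cid => f []. Qed.
Lemma fieldmap_Z a m v : fieldmap (ZV a m v) = fact Z a m (fieldmap v).
Proof. by rewrite /fieldmap; case: cid => f []. Qed.
Lemma fieldmapP v : isfield (fieldmap v).
Proof. by rewrite /fieldmap; case: cid => f []. Qed.

Definition vop (v : V) (n : int) (w : W) : W := fieldmap v [::] n w.

Lemma fieldmap_linE k x y c p w :
  fieldmap (k *: x + y) c p w = k *: fieldmap x c p w + fieldmap y c p w.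
Proof. by rewrite fieldmap_lin. Qed.

(** Identifies the index of a family with a twist of the vector. The index [d] is arbitrary because
    the right action enlarges it. *)
Lemma fieldmap_theta v : forall c d p w, fieldmap (theta c v) d p w = fieldmap v (c ++ d) p w.
Proof.
move: v; apply: (universal_ind univ).
- split=> [|k x y IHx IHy] c d p w.
    by rewrite (linP0 (theta_lin c)) (linP0 fieldmap_lin).
  by rewrite theta_lin !fieldmap_linE IHx IHy.
- by move=> c d p w; rewrite theta_vac fieldmap_vac.
move=> a n v IH c d p w; rewrite theta_Z (linPZ fieldmap_lin) !fieldmap_Z.
have E (k : C) (x : fields D W) c' p' w' : (k *: x) c' p' w' = k *: x c' p' w' by [].
have [_ _ hv] := fieldmapP v.
rewrite E /fact scalerA tau_cat; congr (_ *: (_ - _ *: _)).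
  by apply: eq_ext => s q; rewrite /fleft IH.
apply: eq_ext => q s; rewrite /fright IH; apply: hv => b.
by rewrite !(tau_cat, tau_cons) mulrCA.
Qed.

Lemma fieldmapE v c : fieldmap v c = vop (theta c v).
Proof.
by apply/funext => p; apply/funext => w; rewrite /vop fieldmap_theta cats0.
Qed.

Lemma vop_linl n w : linear (fun v => vop v n w).
Proof. by move=> k x y; rewrite /vop fieldmap_linE. Qed.

Lemma vop_linr v n : linear (vop v n).
Proof. by have [h _ _] := fieldmapP v; apply: h. Qed.

Lemma vop_trunc v w : exists K : int, forall n, K <= n -> vop v n w = 0.
Proof. by have [_ h _] := fieldmapP v; apply: h. Qed.

Lemma vop_vac n w : vop vac n w = if n == -1 then w else 0.
Proof. by rewrite /vop fieldmap_vac. Qed.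

Lemma vop_gen a n w : vop (ZV a (-1) vac) n w = Z a n w.
Proof. by rewrite /vop fieldmap_Z fieldmap_vac fact_fvacE. Qed.

Lemma vop_iter a m v p w : vop (ZV a m v) p w =
  ext (fun s q => Z a s (vop v q w)) 0 p m -
  sgn m *: ext (fun q s => vop (theta [:: a] v) q (Z a s w)) p 0 m.
Proof.
rewrite /vop fieldmap_Z /fact tau_nil scale1r; congr (_ - _ *: _).
by apply: eq_ext => q s; rewrite /fright fieldmapE.
Qed.

Lemma left_utrunc a v w : utrunc (fun s q => Z a s (vop v q w)).
Proof.
have [K h] := vop_trunc v w; exists K => s q le.
by rewrite h // (linP0 (Zlin hZ _ _)).
Qed.

Lemma right_utrunc a v w : utrunc (fun q s => vop v q (Z a s w)).
Proof.
have [K h] := hs w; exists K => q s le.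
by rewrite h // (linP0 (vop_linr _ _)).
Qed.

Definition qcomm a v w s p := Z a s (vop v p w) - vop (theta [:: a] v) p (Z a s w).

Lemma qcomm_lin a w s p : linear (fun v => qcomm a v w s p).
Proof.
move=> k x y; rewrite /qcomm vop_linl (Zlin hZ) theta_lin vop_linl.
by rewrite scalerBr opprD addrACA.
Qed.

(** The part of the commutator of [a] with [b_n v] caused by the delta function in the commutator of
    [a] and [b]. *)
Definition contact v w n s p : W :=
  ext (fun t q => (s + t + 1 == 0)%:R *: vop v q w) 0 p n -
  sgn n *: ext (fun q t => (s + t + 1 == 0)%:R *: vop v q w) p 0 n.

Lemma qcomm_linr a v s p : linear (fun w => qcomm a v w s p).
Proof.
move=> k x y; rewrite /qcomm vop_linr !(Zlin hZ) vop_linr.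
by rewrite scalerBr opprD addrACA.
Qed.

(** A twisted Leibniz rule: moving [a] through the residue that defines [b_n v] leaves a commutator
    with [v] on either side of [b], and the contact term. *)
Lemma qcomm_Z a b n v w s p : qcomm a (ZV b n v) w s p =
  qf a b *: ext (fun t q => Z b t (qcomm a v w s q)) 0 p n -
  sgn n *: ext (fun q t => qcomm a (theta [:: b] v) (Z b t w) s q) p 0 n +
  kap a b *: contact v w n s p.
Proof.
have [_ Zrel] := hZ.
pose G1 t q := Z b t (vop (theta [:: a] v) q (Z a s w)).
pose G2 q t := vop (theta [:: b] (theta [:: a] v)) q (Z b t (Z a s w)).
pose H1 t q := Z b t (qcomm a v w s q).
pose H2 q t := qcomm a (theta [:: b] v) (Z b t w) s q.
pose D1 t q := (s + t + 1 == 0)%:R *: vop v q w.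
pose D2 q t := (s + t + 1 == 0)%:R *: vop v q w.
have uG1 : utrunc G1 by apply: left_utrunc.
have uG2 : utrunc G2 by apply: right_utrunc.
have uH1 : utrunc H1.
  have [K h] := vop_trunc v w; have [K' h'] := vop_trunc (theta [:: a] v) (Z a s w).
  exists (Num.max K K') => t q; rewrite ge_max => /andP[l1 l2].
  by rewrite /H1 /qcomm h // h' // !(linP0 (Zlin hZ _ _)) subrr (linP0 (Zlin hZ _ _)).
have uH2 : utrunc H2.
  have [K h] := hs w; exists K => q t le.
  by rewrite /H2 h // (linP0 (qcomm_linr _ _ _ _)).
have uD1 : utrunc D1.
  by have [K h] := vop_trunc v w; exists K => t q le; rewrite /D1 h // scaler0.
have uD2 : utrunc D2.
  by exists (- s) => q t le; rewrite /D2 (_ : (_ == 0) = false) ?scale0r //; lia.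
rewrite {1}/qcomm theta_Z tau_cons tau_nil mulr1 (linPZ (vop_linl _ _)) !vop_iter.
rewrite (linPB (Zlin hZ _ _)) (linPZ (Zlin hZ _ _)).
rewrite !(ext_lin (Zlin hZ _ _)); [|exact: right_utrunc|exact: left_utrunc].
rewrite (@eq_ext _ _ (fun t q => qf a b *: (H1 t q + G1 t q) + kap a b *: D1 t q)); last first.
  move=> t q; rewrite Zrel /H1 /G1 /D1 scalerA; congr (_ *: _ + _).
  by rewrite /qcomm (linPB (Zlin hZ _ _)) subrK.
rewrite [X in _ - _ *: X - _](@eq_ext _ _
  (fun q t => (H2 q t + qf a b *: G2 q t) + kap a b *: D2 q t)); last first.
  move=> q t; have e : vop (theta [:: a] (theta [:: b] v)) q (Z a s (Z b t w)) =
    qf a b *: G2 q t + kap a b *: D2 q t.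
    rewrite Zrel vop_linr (linPZ (vop_linr _ _)) theta_swap -scalerA; congr (_ + _).
    have [->|k0] := eqVneq (kap a b) 0; first by rewrite !scale0r.
    by rewrite /D2 -theta_swap theta_kap.
  by rewrite -addrA -e /H2 /qcomm subrK.
rewrite (@extD _ (fun t q => qf a b *: (H1 t q + G1 t q)) (fun t q => kap a b *: D1 t q));
  try exact/utruncZ; last exact/utruncZ/utruncD.
rewrite (@extD _ (fun q t => H2 q t + qf a b *: G2 q t) (fun q t => kap a b *: D2 q t));
  try exact/utruncZ; last by apply: utruncD => //; apply: utruncZ.
rewrite (@extD _ H2 (fun q t => qf a b *: G2 q t)) //; last exact: utruncZ.
rewrite !(extZ (M := W)) //; last exact: utruncD.
rewrite (extD (f := H1) (g := G1)) //.
rewrite /contact -/(ext H1) -/(ext H2) -/(ext D1) -/(ext D2).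
set h1 := ext H1 0 p n; set h2 := ext H2 p 0 n; set g1 := ext G1 0 p n.
set g2 := ext G2 p 0 n; set d1 := ext D1 0 p n; set d2 := ext D2 p 0 n.
rewrite !scalerDr !scalerN !scalerA [sgn n * qf a b]mulrC [sgn n * kap a b]mulrC.
rewrite !opprD !opprK -!addrA; congr (_ + _).
move: (qf a b *: g1) ((qf a b * sgn n) *: g2) (kap a b *: d1) ((kap a b * sgn n) *: d2).
move: (sgn n *: h2) => A B E F G.
by rewrite addrC -!addrA [E + B]addrC addKr [- G + E]addrC addKr addrCA.
Qed.

(** Against the delta function, [z - x] may be replaced by the difference inside the residue, so [k]
    factors raise the exponent [n] to [n + k]. Once this is nonnegative, both expansions agree and
    cancel. *)
Lemma contact_dlt v w n k s p : 0 <= n + k%:Z -> dlt k (contact v w n) s p = 0.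
Proof.
pose E s t0 p n :=
  ext (fun t q => (s + t + 1 == 0)%:R *: vop v q w) t0 p n -
  sgn n *: ext (fun q t => (s + t + 1 == 0)%:R *: vop v q w) p t0 n.
have hE r : pascal (E r).
  apply: pascalB.
    apply: extS; have [K h] := vop_trunc v w; exists K => t q le.
    by rewrite h // scaler0.
  apply: pascal_swap; exists (- r) => q t le.
  by rewrite (_ : (_ == 0) = false) ?scale0r //; lia.
have Esh r t q m : E (r + 1) t q m = E r (t + 1) q m.
  rewrite /E ext_shiftl ext_shiftr; congr (_ - _ *: _); apply: eq_ext => *.
    by congr (_%:R *: _); congr (nat_of_bool (_ == _)); lia.
  by congr (_%:R *: _); congr (nat_of_bool (_ == _)); lia.
have dE r t q m : dlt k (fun s p => E s t p m) r q = E r t q (m + k%:Z).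
  elim: k m => [|k IH] m; first by rewrite addr0.
  rewrite dltS (@eq_dlt _ _ _ (fun s p => E s t p (m + 1))).
    by rewrite IH; idx.
  by move=> s' p'; rewrite Esh hE addrC addKr.
move=> le; rewrite (dE s 0 p n) -(gez0_abs le); apply: (pascal_nat (hE s)) => t q.
by rewrite /E !ext0 sgn0 scale1r subrr.
Qed.

(** Dong's lemma for twisted commutators. The order is uniform in the twist because the induction
    step twists [v] by a further generator. *)
Lemma qcomm_local v : exists k : nat, forall a c w s p,
  dlt k (qcomm a (theta c v) w) s p = 0.
Proof.
move: v; apply: (universal_ind univ (P := fun v => exists k : nat, forall a c w s p,
  dlt k (qcomm a (theta c v) w) s p = 0)).
- split.
    exists 0%N => a c w s p.
    by rewrite /= (linP0 (theta_lin c)) (linP0 (qcomm_lin _ _ _ _)).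
  move=> k x y [k1 h1] [k2 h2]; exists (maxn k1 k2) => a c w s p.
  rewrite (@eq_dlt _ _ _ (fun s p => k *: qcomm a (theta c x) w s p + qcomm a (theta c y) w s p)).
    rewrite dltD dltZ (@dlt_le _ k1) ?(@dlt_le _ k2) ?leq_maxl ?leq_maxr //.
    by rewrite scaler0 addr0.
  by move=> s' p'; rewrite theta_lin qcomm_lin.
- exists 0%N => a c w s p; rewrite /= /qcomm !theta_vac !vop_vac.
  by case: eqP => _; rewrite ?(linP0 (Zlin hZ _ _)) subrr.
(* Order [k] handles the two inherited commutators, and order [|n|] the contact term, as [n + |n|]
   is nonnegative. *)
move=> b n v [k hk]; exists (maxn k `|n|) => a c w s p.
rewrite (@eq_dlt _ _ _ (fun s p => tau c b *: qcomm a (ZV b n (theta c v)) w s p)); last first.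
  by move=> s' p'; rewrite theta_Z (linPZ (qcomm_lin _ _ _ _)).
rewrite dltZ (@eq_dlt _ _ _ (fun s p =>
  qf a b *: ext (fun t q => Z b t (qcomm a (theta c v) w s q)) 0 p n -
  sgn n *: ext (fun q t => qcomm a (theta (b :: c) v) (Z b t w) s q) p 0 n +
  kap a b *: contact (theta c v) w n s p)); last first.
  by move=> s' p'; rewrite qcomm_Z -theta_cons.
rewrite dltD dltB !dltZ contact_dlt ?scaler0 ?addr0; last by lia.
rewrite (dlt_extr _ _ _ _ _ (G := fun s t q => Z b t (qcomm a (theta c v) w s q))); last first.
  move=> r; have [K h] := vop_trunc (theta c v) w.
  have [K' h'] := vop_trunc (theta [:: a] (theta c v)) (Z a r w).
  exists (Num.max K K') => t q; rewrite ge_max => /andP[l1 l2].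
  by rewrite /qcomm h // h' // !(linP0 (Zlin hZ _ _)) subrr (linP0 (Zlin hZ _ _)).
rewrite (dlt_extl _ _ _ _ _ (G := fun s q t => qcomm a (theta (b :: c) v) (Z b t w) s q));
  last first.
  move=> r; have [K h] := hs w; exists K => q t le.
  by rewrite h // (linP0 (qcomm_linr _ _ _ _)).
rewrite !ext_zero ?scaler0 ?subrr ?scaler0 // => t q.
  by apply: (@dlt_le _ k); rewrite ?leq_maxl.
rewrite -(dlt_lin _ _ _ _ (Zlin hZ b t)) (@dlt_le _ k) ?leq_maxl //.
exact: (linP0 (Zlin hZ _ _)).
Qed.

Lemma jacobi_gen a v w : jacobi (fun s p => Z a s (vop v p w))
  (fun p s => vop (theta [:: a] v) p (Z a s w)) (fun m p => vop (ZV a m v) p w).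
Proof.
have [k hk] := qcomm_local v; have [K hK] := univ_smooth v.
apply: (@jacobi_of_iterate _ _ _ _ k K).
- exact: left_utrunc.
- exact: right_utrunc.
- by move=> m p le; rewrite hK // (linP0 (vop_linl _ _)).
- by move=> s p; have := hk a [::] w s p; rewrite theta_nil.
by move=> p m; rewrite vop_iter.
Qed.

End Action.
End Vertex.

(** * The Jacobi identity *)

Lemma fsumn_exch (M : zmodType) (F : nat -> nat -> M) (N : nat) :
  (forall i j, (N <= i)%N -> F i j = 0) -> (forall i j, (N <= j)%N -> F i j = 0) ->
  fsumn (fun i => fsumn (F i)) = fsumn (fun j => fsumn (fun i => F i j)).
Proof.
move=> h1 h2; rewrite (@fsumnE _ _ N) => [|i le]; last by rewrite fsumn0 // => j; apply: h1.
rewrite [RHS](@fsumnE _ _ N) => [|j le]; last by rewrite fsumn0 // => i; apply: h2.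
rewrite (eq_bigr (fun i : 'I_N => \sum_(j < N) F i j)) => [|i _]; last first.
  by rewrite (@fsumnE _ _ N) // => j; apply: h2.
rewrite exchange_big; apply: eq_bigr => j _.
by rewrite (@fsumnE _ _ N) // => i; apply: h1.
Qed.

(** * Iterated residues *)

Section ExtExt.
Variable M : lmodType C.

Lemma scale_fsumn k (F : nat -> M) : sfin F -> k *: fsumn F = fsumn (fun j => k *: F j).
Proof.
move=> h; rewrite (@fsumn_additive _ _ ( *:%R k)) //.
by move=> x y; rewrite scalerBr.
Qed.

(** Fubini for two residues: the bound on [p] may depend on [q], but only finitely many values of
    [q] contribute. *)
Lemma ext_ext_r (G : int -> int -> int -> M) (s p q m r : int) :
  (exists K : int, forall s p q, K <= q -> G s p q = 0) ->
  (forall q, exists K : int, forall s p, K <= p -> G s p q = 0) ->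
  ext (fun p q => ext (fun s p => G s p q) s p m) p q r =
  ext (fun s p => ext (fun p q => G s p q) p q r) s p m.
Proof.
move=> [K hK] hq.
pose J := `|K - q|%N.
have [L hL] := @bound_below (fun j x => forall s p, x <= p -> G s p (q + j%:Z) = 0) J
  (fun j => let: ex_intro L h := hq (q + j%:Z) in
    ex_intro _ L (fun x lx s p le => h s p (le_trans lx le))).
pose L' := `|(L - p - r)%R|%N; pose N := (J + L' + J)%N.
pose F j i : M := ((binz r j * sgn j) * (binz m i * sgn i)) *:
  G (s + m - i%:Z) (p + r - j%:Z + i%:Z) (q + j%:Z).
have F1 j i : (N <= j)%N -> F j i = 0.
  by rewrite /N /L' => le; rewrite /F hK ?scaler0 //; lia.
have F2 j i : (N <= i)%N -> F j i = 0.
  rewrite /N /L' /F => le; case: (ltnP j J) => lj; last by rewrite hK ?scaler0 //; lia.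
  by rewrite (hL j L) ?scaler0 //; lia.
rewrite /ext (eq_fsumn (G := fun j => fsumn (F j))) => [|j]; last first.
  rewrite scale_fsumn; last first.
    case: (ltnP j J) => lj.
      by exists N => i le; rewrite (hL j L) ?scaler0 //; rewrite /N /L' in le; lia.
    by exists 0%N => i le; rewrite hK ?scaler0 //; lia.
  by apply: eq_fsumn => i; rewrite scalerA.
rewrite (fsumn_exch F1 F2); apply: eq_fsumn => i; rewrite scale_fsumn; last first.
  by exists N => j le; rewrite hK ?scaler0 //; rewrite /N /L' in le; lia.
apply: eq_fsumn => j; rewrite /F scalerA [X in X *: _]mulrC.
by have -> : p + r - j%:Z + i%:Z = p + i%:Z + r - j%:Z by lia.
Qed.

Lemma ext_ext_l (G : int -> int -> int -> M) (s p q m r : int) :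
  (exists K : int, forall s p q, K <= p -> G s p q = 0) ->
  ext (fun q p => ext (fun s p => G s p q) s p m) q p r =
  ext (fun s p => ext (fun q p => G s p q) q p r) s p m.
Proof.
move=> [K hK].
pose N := `|K - p|%N.
pose F j i : M := ((binz r j * sgn j) * (binz m i * sgn i)) *:
  G (s + m - i%:Z) (p + j%:Z + i%:Z) (q + r - j%:Z).
have F1 j i : (N <= j)%N -> F j i = 0.
  by rewrite /N => le; rewrite /F hK ?scaler0 //; lia.
have F2 j i : (N <= i)%N -> F j i = 0.
  by rewrite /N /F => le; rewrite hK ?scaler0 //; lia.
rewrite /ext (eq_fsumn (G := fun j => fsumn (F j))) => [|j]; last first.
  rewrite scale_fsumn; last first.
    by exists N => i le; rewrite hK ?scaler0 //; rewrite /N in le; lia.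
  by apply: eq_fsumn => i; rewrite scalerA.
rewrite (fsumn_exch F1 F2); apply: eq_fsumn => i; rewrite scale_fsumn; last first.
  by exists N => j le; rewrite hK ?scaler0 //; rewrite /N in le; lia.
apply: eq_fsumn => j; rewrite /F scalerA [X in X *: _]mulrC.
by have -> : p + j%:Z + i%:Z = p + i%:Z + j%:Z by lia.
Qed.

Lemma dlt_ext_paramr k (H : int -> int -> int -> M) (p s q n : int) :
  (forall q, utrunc (H q)) -> dlt k (fun s q => ext (H q) p s n) s q =
  ext (fun p s => dlt k (fun s q => H q p s) s q) p s n.
Proof.
elim: k H => [//|k IH] H hH; rewrite dltS.
pose H' q p s := H q p (s + 1) - H (q + 1) p s.
rewrite (@eq_dlt _ _ _ (fun s q => ext (H' q) p s n)); last first.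
  by move=> s' p'; rewrite ext_shiftr -extB //; apply: utrunc_shiftr.
rewrite IH; last by move=> s'; apply: utruncB => //; apply: utrunc_shiftr.
by apply: eq_ext => t' q'; rewrite dltS.
Qed.

Lemma dlt_ext_paraml k (H : int -> int -> int -> M) (p s q n : int) :
  (forall q, utrunc (H q)) -> dlt k (fun s q => ext (H q) s p n) s q =
  ext (fun s p => dlt k (fun s q => H q s p) s q) s p n.
Proof.
elim: k H => [//|k IH] H hH; rewrite dltS.
pose H' q s p := H q (s + 1) p - H (q + 1) s p.
rewrite (@eq_dlt _ _ _ (fun s q => ext (H' q) s p n)); last first.
  by move=> s' p'; rewrite ext_shiftl -extB //; apply: utrunc_shiftl.
rewrite IH; last by move=> s'; apply: utruncB => //; apply: utrunc_shiftl.
by apply: eq_ext => t' q'; rewrite dltS.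
Qed.

Lemma dlt_shiftl k (f : int -> int -> M) (s p : int) :
  dlt k (fun s p => f (s + 1) p) s p = dlt k f (s + 1) p.
Proof. by elim: k s p => //= k IH s p; rewrite !IH. Qed.

Lemma dlt_ge k (f : int -> int -> M) (S s p : int) :
  (forall s p, S <= s -> f s p = 0) -> S <= s -> dlt k f s p = 0.
Proof.
move=> h; elim: k s p => [|k IH] s p le /=; first exact: h.
by rewrite !IH ?subrr //; lia.
Qed.

End ExtExt.

(* Functionals on [(z - x1)^m x1^p x2^q (x1 - x2)^r]; [mulz] is multiplication by [z] and
   [mulzx2] multiplication by [z - x2]. *)
Section Lowering.
Variable M : lmodType C.
Definition func4 : Type := int -> int -> int -> int -> M.

Definition mulz (G : func4) : func4 := fun m p q r => G m (p + 1) q r + G (m + 1) p q r.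
Definition mulzx2 (G : func4) : func4 := fun m p q r => G (m + 1) p q r + G m p q (r + 1).

Definition mtrunc (G : func4) : Prop := exists K : int, forall m p q r, K <= m -> G m p q r = 0.

Lemma eq_func4 (G H : func4) : (forall m p q r, G m p q r = H m p q r) -> G = H.
Proof. by move=> e; do 4!apply/funext => ?. Qed.

(** Since [z = x1 + (z - x1)], a descent in [m] finds the second summand already zero, and
    multiplication by [x1] is invertible. *)
Lemma mulz_lower (G : func4) : mtrunc G -> (forall m p q r, mulz G m p q r = 0) ->
  forall m p q r, G m p q r = 0.
Proof.
move=> [K h] hz; suff H n m : K <= m + n%:Z -> forall p q r, G m p q r = 0.
  by move=> m; apply: (H `|K - m|%N); lia.
elim: n m => [|n IH] m le p q r; first by apply: h; lia.
by have := hz m (p - 1) q r; rewrite /mulz subrK (IH (m + 1)) ?addr0 //; lia.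
Qed.

Lemma mulzx2_lower (G : func4) : mtrunc G -> (forall m p q r, mulzx2 G m p q r = 0) ->
  forall m p q r, G m p q r = 0.
Proof.
move=> [K h] hz; suff H n m : K <= m + n%:Z -> forall p q r, G m p q r = 0.
  by move=> m; apply: (H `|K - m|%N); lia.
elim: n m => [|n IH] m le p q r; first by apply: h; lia.
by have := hz m p q (r - 1); rewrite /mulzx2 subrK (IH (m + 1)) ?add0r //; lia.
Qed.

Lemma mtrunc_mulz (G : func4) : mtrunc G -> mtrunc (mulz G).
Proof. by case=> K h; exists K => m p q r le; rewrite /mulz !h ?addr0 //; lia. Qed.

Lemma mtrunc_mulzx2 (G : func4) : mtrunc G -> mtrunc (mulzx2 G).
Proof. by case=> K h; exists K => m p q r le; rewrite /mulzx2 !h ?addr0 //; lia. Qed.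

Lemma iter_lower (S T : nat) (G : func4) : mtrunc G ->
  (forall m p q r, iter S mulz (iter T mulzx2 G) m p q r = 0) ->
  forall m p q r, G m p q r = 0.
Proof.
move=> hG h.
have hT n : mtrunc (iter n mulzx2 G) by elim: n => //= n; apply: mtrunc_mulzx2.
have hS n : mtrunc (iter n mulz (iter T mulzx2 G)).
  by elim: n => [|n IH]; [exact: hT|apply: mtrunc_mulz].
elim: S h => [|S IH] h; last by apply: IH; apply: mulz_lower.
elim: T h {hS} => [//|T IH] h; apply: IH; exact: (mulzx2_lower (hT T) h).
Qed.

Lemma iter_mulzB n (G H : func4) : iter n mulz (fun m p q r => G m p q r - H m p q r) =
  (fun m p q r => iter n mulz G m p q r - iter n mulz H m p q r).
Proof.
elim: n => //= n ->; apply: eq_func4 => m p q r.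
by rewrite /mulz opprD addrACA.
Qed.

Lemma iter_mulzx2B n (G H : func4) : iter n mulzx2 (fun m p q r => G m p q r - H m p q r) =
  (fun m p q r => iter n mulzx2 G m p q r - iter n mulzx2 H m p q r).
Proof.
elim: n => //= n ->; apply: eq_func4 => m p q r.
by rewrite /mulzx2 opprD addrACA.
Qed.

Lemma iter_family (op : func4 -> func4) (H : int -> func4) (n : nat) :
  (forall s, op (H s) = H (s + 1)) -> iter n op (H 0) = H n%:Z.
Proof. by move=> h; elim: n => //= n ->; rewrite h; congr H; lia. Qed.

(** [z - x2 = (z - x1) + (x1 - x2)]: on functionals that also record the exponent [s] of [z], this
    is the difference operator in [s] and [q]. *)
Lemma iter_mulzx2_dlt (H : int -> func4) (n : nat) (s : int) :
  (forall q r, pascal (fun s p m => H s m p q r)) ->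
  (forall s m, pascal (fun p q r => H s m p q r)) ->
  iter n mulzx2 (H s) = (fun m p q r => dlt n (fun s q => H s m p q r) s q).
Proof.
move=> h1 h2; elim: n s => [//|n IH] s.
rewrite iterS IH; apply: eq_func4 => m p q r.
rewrite /mulzx2 dltS -dltD; apply: eq_dlt => s' q'.
have -> := h1 q' r s' p m; have -> := h2 s' m p q' r.
by rewrite -[_ + _ + H s' (m + 1) _ _ _]addrA [_ + (_ + _)]addrC addrK addrC.
Qed.

End Lowering.

Section ExtTrunc.
Variable M : lmodType C.

Lemma ext_trunc_first (f : int -> int -> M) (t n : int) : utrunc f ->
  (forall s, exists K : int, forall q, K <= q -> f q s = 0) ->
  exists K : int, forall q, K <= q -> ext f q t n = 0.
Proof.
move=> [K hK] h; pose N := `|K - t|%N.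
have [L hL] := @bound_below (fun j q => f q (t + j%:Z) = 0) N (fun j => h (t + j%:Z)).
exists (L + `|n| + N%:Z) => q le; rewrite (@extE _ K N) //; last by rewrite /N; lia.
by rewrite big1 // => j _; rewrite (hL j) ?scaler0 //; have := ltn_ord j; lia.
Qed.

Lemma iter_ext_shiftm (c : int -> int -> M) (s p m : int) :
  iter_ext c s p (m + 1) = iter_ext (fun m p => c (m + 1) p) s p m.
Proof. by apply: eq_fsumn => j; idx. Qed.

Lemma iter_ext_shiftp (c : int -> int -> M) (s p m : int) :
  iter_ext c s (p + 1) m = iter_ext (fun m p => c m (p + 1)) s p m.
Proof. by apply: eq_fsumn => j; idx. Qed.

End ExtTrunc.

(** * From the Jacobi identity of [a] to that of [g_m a] *)

Section Step.
Variables (D : qdata) (V : lmodType C) (ZV : D -> int -> V -> V) (vac : V).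
Hypothesis univ : universal ZV vac.
Variables (W : lmodType C) (Z : D -> int -> W -> W).
Hypotheses (hZ : qmodule Z) (hs : smooth Z).

Local Notation Yw := (vop univ hZ hs).
Local Notation Yv := (vop univ (univ_qmodule univ) (univ_smooth univ)).
Local Notation th := (theta univ).

Variables (g : D) (a b : V) (c : seq D) (lam : C) (w : W).
Hypothesis theta_a : th [:: g] a = lam *: a.
Hypothesis jac_ab : jacobi (fun s p => Yw a s (Yw b p w))
  (fun p s => Yw (th c b) p (Yw a s w)) (fun m p => Yw (Yv a m b) p w).

Definition phi (s p m : int) (x : W) : W :=
  ext (fun s p => Z g s (Yw a p x)) s p m -
  (lam * sgn m) *: ext (fun p s => Yw a p (Z g s x)) p s m.

Definition phiV (t r m : int) : V :=
  ext (fun t r => ZV g t (Yv a r b)) t r m -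
  (lam * sgn m) *: ext (fun r t => Yv a r (ZV g t b)) r t m.

Lemma phi_pascal x : pascal (fun s p m => phi s p m x).
Proof.
apply: pascalB; first by apply: extS; apply: left_utrunc.
have := pascalZ lam (pascal_swap (right_utrunc univ hZ hs g a x)).
by move=> h s p m; have := h s p m; rewrite !scalerA.
Qed.

Lemma phiV_pascal : pascal phiV.
Proof.
apply: pascalB; first by apply: extS; apply: left_utrunc.
have := pascalZ lam (pascal_swap (right_utrunc univ (univ_qmodule univ) (univ_smooth univ) g a b)).
by move=> h s p m; have := h s p m; rewrite !scalerA.
Qed.

Lemma phiE p m x : Yw (ZV g m a) p x = phi 0 p m x.
Proof.
rewrite vop_iter /phi theta_a; congr (_ - _); rewrite mulrC -scalerA; congr (_ *: _).
rewrite -extZ; last exact: right_utrunc.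
by apply: eq_ext => q s; rewrite (linPZ (vop_linl _ _ _ _ _)).
Qed.

Lemma phiVE p m : Yv (ZV g m a) p b = phiV 0 p m.
Proof.
rewrite vop_iter /phiV theta_a; congr (_ - _); rewrite mulrC -scalerA; congr (_ *: _).
rewrite -extZ; last exact: right_utrunc.
by apply: eq_ext => q s; rewrite (linPZ (vop_linl _ _ _ _ _)).
Qed.

Lemma phi0 s p m : phi s p m 0 = 0.
Proof.
by rewrite /phi !ext_zero ?scaler0 ?subrr // => x y;
  rewrite ?(linP0 (Zlin hZ _ _)) !(linP0 (vop_linr _ _ _ _ _)) ?(linP0 (Zlin hZ _ _)).
Qed.

(** At exponent [0], [partA], [partB] and [partI] are the three terms of the identity to be proved.
    The additional exponent, of [z] in the products and of [z - x2] in the iterate, makes room for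
    the multiplications. *)
Definition partA (s : int) : func4 W := fun m p q r =>
  ext (fun p q => phi s p m (Yw b q w)) p q r.

Definition partB (s : int) : func4 W := fun m p q r =>
  sgn r *: ext (fun q p => Yw (th (g :: c) b) q (phi s p m w)) q p r.

Definition partI (t : int) : func4 W := fun m p q r =>
  iter_ext (fun r q => Yw (phiV t r m) q w) p q r.

Definition partAB (s : int) : func4 W := fun m p q r => partA s m p q r - partB s m p q r.

Lemma partA_utrunc s m : utrunc (fun p q => phi s p m (Yw b q w)).
Proof.
by have [K h] := vop_trunc univ hZ hs b w; exists K => p q le; rewrite h // phi0.
Qed.

Lemma phi_trunc s m : exists K : int, forall p, K <= p -> phi s p m w = 0.
Proof.
have [K h] := vop_trunc univ hZ hs a w.
have [K' h'] := ext_trunc_first s m (right_utrunc univ hZ hs g a w)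
  (fun t => vop_trunc univ hZ hs a (Z g t w)).
exists (Num.max K K') => p; rewrite ge_max => /andP[l l'].
rewrite /phi h' // scaler0 subr0 (@ext_trunc _ K) // => t q le.
by rewrite h // (linP0 (Zlin hZ _ _)).
Qed.

Lemma phiV_trunc t m : exists K : int, forall r, K <= r -> phiV t r m = 0.
Proof.
have [K h] := vop_trunc univ (univ_qmodule univ) (univ_smooth univ) a b.
have [K' h'] := ext_trunc_first t m
  (right_utrunc univ (univ_qmodule univ) (univ_smooth univ) g a b)
  (fun t => vop_trunc univ (univ_qmodule univ) (univ_smooth univ) a (ZV g t b)).
exists (Num.max K K') => p; rewrite ge_max => /andP[l l'].
rewrite /phiV h' // scaler0 subr0 (@ext_trunc _ K) // => s q le.
by rewrite h // (linP0 (Zlin (univ_qmodule univ) _ _)).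
Qed.

Lemma partB_utrunc s m : utrunc (fun q p => Yw (th (g :: c) b) q (phi s p m w)).
Proof.
have [K h] := phi_trunc s m; exists K => q p le.
by rewrite h // (linP0 (vop_linr _ _ _ _ _)).
Qed.

Lemma partAB_mulz s : mulz (partAB s) = partAB (s + 1).
Proof.
apply: eq_func4 => m p q r; rewrite /mulz /partAB addrACA -opprD; congr (_ - _).
  rewrite /partA ext_shiftl -extD; try exact: partA_utrunc; last first.
    exact: (utrunc_shiftl (partA_utrunc s m)).
  by apply: eq_ext => p' q'; rewrite -phi_pascal.
rewrite /partB -scalerDr; congr (_ *: _).
rewrite ext_shiftr -extD; try exact: partB_utrunc; last first.
  exact: (utrunc_shiftr (partB_utrunc s m)).
by apply: eq_ext => p' q'; rewrite -(linPD (vop_linr _ _ _ _ _)) -phi_pascal.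
Qed.

Lemma partAB_pascal1 q r : pascal (fun s p m => partAB s m p q r).
Proof.
by move=> s p m; have /(congr1 (fun F => F m p q r)) := partAB_mulz s; rewrite /mulz => <-.
Qed.

Lemma partAB_pascal2 s m : pascal (fun p q r => partAB s m p q r).
Proof.
apply: pascalB; first by apply: extS; apply: partA_utrunc.
by apply: pascal_swap; apply: partB_utrunc.
Qed.

(* In [partL] the generator [g] acts on the iterate of [a] and [b], in [movA] and [movB] on
   their two products; the other series arise by moving [g] to the right. *)
Definition partL (s : int) : func4 W := fun m p q r =>
  ext (fun s p => Z g s (iter_ext (fun r q => Yw (Yv a r b) q w) p q r)) s p m.

Definition movA s m p q r : W :=
  ext (fun p q => ext (fun s p => Z g s (Yw a p (Yw b q w))) s p m) p q r.
Definition movAr s m p q r : W :=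
  ext (fun p q => sgn m *: ext (fun p s => Yw a p (Z g s (Yw b q w))) p s m) p q r.
Definition movB s m p q r : W :=
  sgn r *: ext (fun q p => ext (fun s p => Z g s (Yw (th c b) q (Yw a p w))) s p m) q p r.
Definition movBm s m p q r : W :=
  sgn r *: ext (fun q p => Yw (th (g :: c) b) q (ext (fun s p => Z g s (Yw a p w)) s p m)) q p r.
Definition movBr s m p q r : W :=
  sgn r *: ext (fun q p => Yw (th (g :: c) b) q
                 (sgn m *: ext (fun p s => Yw a p (Z g s w)) p s m)) q p r.

Let a0 p : Yw a p 0 = 0. Proof. exact: (linP0 (vop_linr _ _ _ _ _)). Qed.
Let Z0 s : Z g s 0 = 0. Proof. exact: (linP0 (Zlin hZ _ _)). Qed.

Lemma partA_mov s m p q r : partA s m p q r = movA s m p q r - lam *: movAr s m p q r.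
Proof.
have [K h] := vop_trunc univ hZ hs b w.
have u1 : utrunc (fun p q => ext (fun s p => Z g s (Yw a p (Yw b q w))) s p m).
  by exists K => p' q' le; apply: ext_zero => x y; rewrite h // a0 Z0.
have u2 : utrunc (fun p q => sgn m *: ext (fun p s => Yw a p (Z g s (Yw b q w))) p s m).
  by exists K => p' q' le; rewrite ext_zero ?scaler0 // => x y; rewrite h // Z0 a0.
rewrite /movA /movAr -extZ // -extB //; last exact: utruncZ.
by apply: eq_ext => p' q'; rewrite /phi scalerA.
Qed.

Lemma partB_mov s m p q r : partB s m p q r = movBm s m p q r - lam *: movBr s m p q r.
Proof.
have [K h] := vop_trunc univ hZ hs a w.
have [K' h'] := ext_trunc_first s m (right_utrunc univ hZ hs g a w)
  (fun t => vop_trunc univ hZ hs a (Z g t w)).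
rewrite /movBm /movBr scalerA [lam * _]mulrC -scalerA -scalerBr -extZ ?(extB (M := W)).
- rewrite -extB.
  + congr (_ *: _); apply: eq_ext => q' p'.
    by rewrite -(linPZ (vop_linr _ _ _ _ _)) -(linPB (vop_linr _ _ _ _ _)) scalerA.
  + exists K => q' p' le; rewrite (@ext_trunc _ K) ?(linP0 (vop_linr _ _ _ _ _)) //.
    by move=> x y l; rewrite h // Z0.
  + by apply: utruncZ; exists K' => q' p' le; rewrite h' // scaler0 (linP0 (vop_linr _ _ _ _ _)).
by exists K' => q' p' le; rewrite h' // scaler0 (linP0 (vop_linr _ _ _ _ _)).
Qed.

Lemma movA_movB s m p q r : movA s m p q r - movB s m p q r = partL s m p q r.
Proof.
have [K h] := vop_trunc univ hZ hs b w; have [K' h'] := vop_trunc univ hZ hs a w.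
have uab : utrunc (fun p q => Yw a p (Yw b q w)) by exists K => x y le; rewrite h // a0.
have uba : utrunc (fun q p => Yw (th c b) q (Yw a p w)).
  by exists K' => x y le; rewrite h' // (linP0 (vop_linr _ _ _ _ _)).
rewrite /partL (@eq_ext _ _ (fun s p =>
  Z g s (ext (fun p q => Yw a p (Yw b q w)) p q r) -
  sgn r *: Z g s (ext (fun q p => Yw (th c b) q (Yw a p w)) q p r))); last first.
  by move=> x y; rewrite -jac_ab (linPB (Zlin hZ _ _)) (linPZ (Zlin hZ _ _)).
rewrite extB.
- rewrite extZ; last first.
    exists K' => x y le; rewrite (@ext_trunc _ K') ?Z0 // => x' y' l.
    by rewrite h' // (linP0 (vop_linr _ _ _ _ _)).
  rewrite /movA /movB ext_ext_r; first last.
  + by move=> x; have [L hL] := vop_trunc univ hZ hs a (Yw b x w); exists L => *; rewrite hL ?Z0.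
  + by exists K => x y z le; rewrite h // a0 Z0.
  rewrite ext_ext_l; last by exists K' => x y z le; rewrite h' // (linP0 (vop_linr _ _ _ _ _)) Z0.
  congr (_ - _ *: _); apply: eq_ext => x y; rewrite ext_lin //; exact: (Zlin hZ).
- have [L hL] := ext_trunc_first q r uab (fun x => vop_trunc univ hZ hs a (Yw b x w)).
  by exists L => x y le; rewrite hL ?Z0.
apply: utruncZ; exists K' => x y le; rewrite (@ext_trunc _ K') ?Z0 //.
by move=> x' y' l; rewrite h' // (linP0 (vop_linr _ _ _ _ _)).
Qed.

Section Local.
Variables (S : int) (T : nat).
Hypothesis hS : forall s, S <= s -> Z g s w = 0.
Hypothesis hT : forall d x s q, dlt T (qcomm univ hZ hs g (th d b) x) s q = 0.

(** Here [g] stands between [a] and [b]; the factor [(z - x2)^T] moves it past [b] onto [w], where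
    the modes from [S] on vanish. *)
Lemma movAr_local s m p q r : S <= s -> dlt T (fun s q => movAr s m p q r) s q = 0.
Proof.
move=> le; have [K h] := vop_trunc univ hZ hs b w.
rewrite (dlt_extr _ _ _ _ _ (G := fun s p q =>
  sgn m *: ext (fun p s => Yw a p (Z g s (Yw b q w))) p s m)); last first.
  by move=> x; exists K => y z l; rewrite ext_zero ?scaler0 // => *; rewrite h // Z0 a0.
apply: ext_zero => p' q'.
rewrite dltZ (dlt_ext_paramr _ _ _ _ _ (H := fun q p s => Yw a p (Z g s (Yw b q w))));
  last by move=> x; apply: right_utrunc.
rewrite (@ext_trunc _ S) ?scaler0 // => x y ly.
rewrite -(dlt_lin _ (fun s q => Z g s (Yw b q w)) y q' (vop_linr univ hZ hs a x)).
rewrite (@eq_dlt _ _ _ (fun s q => qcomm univ hZ hs g (th [::] b) w s q +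
  Yw (th [:: g] b) q (Z g s w))); last first.
  by move=> s1 q1; rewrite /qcomm theta_nil subrK.
rewrite dltD hT (@dlt_ge _ _ _ S) ?addr0 // => s1 q1 l.
by rewrite hS // (linP0 (vop_linr _ _ _ _ _)).
Qed.

(** After multiplication by [(z - x2)^T], it no longer matters on which side of [b] the generator
    stands. *)
Lemma movB_local s m p q r :
  dlt T (fun s q => movBm s m p q r) s q = dlt T (fun s q => movB s m p q r) s q.
Proof.
have [K h] := vop_trunc univ hZ hs a w.
apply/eqP; rewrite eq_sym -subr_eq0 -dltB; apply/eqP.
rewrite (@eq_dlt _ _ _ (fun s q => sgn r *: ext (fun q p =>
  ext (fun s p => qcomm univ hZ hs g (th c b) (Yw a p w) s q) s p m) q p r)).
  rewrite dltZ (dlt_extl _ _ _ _ _ (G := fun s q p =>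
    ext (fun s p => qcomm univ hZ hs g (th c b) (Yw a p w) s q) s p m)); last first.
    move=> x; exists K => y z l; apply: ext_trunc l => s' p' l.
    by rewrite h // (linP0 (qcomm_linr _ _ _ _ _ _ _)).
  rewrite ext_zero ?scaler0 // => x y.
  rewrite (dlt_ext_paraml _ _ _ _ _ (H := fun q s p =>
    qcomm univ hZ hs g (th c b) (Yw a p w) s q)); last first.
    by move=> z; exists K => s' p' l; rewrite h // (linP0 (qcomm_linr _ _ _ _ _ _ _)).
  by apply: ext_zero => *; apply: hT.
move=> x y; rewrite /movB /movBm -scalerBr -extB.
- congr (_ *: _); apply: eq_ext => q' p'.
  rewrite (ext_lin (vop_linr _ _ _ _ _)); last exact: left_utrunc.
  rewrite -extB.
  + by apply: eq_ext => s1 p1; rewrite /qcomm -theta_cons.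
  + by exists K => s1 p1 l; rewrite h // (linP0 (vop_linr _ _ _ _ _)) Z0.
  by exists K => s1 p1 l; rewrite h // Z0 (linP0 (vop_linr _ _ _ _ _)).
- exists K => s1 p1 l; apply: ext_trunc l => s2 p2 l.
  by rewrite h // (linP0 (vop_linr _ _ _ _ _)) Z0.
exists K => s1 p1 l; rewrite (@ext_trunc _ K) ?(linP0 (vop_linr _ _ _ _ _)) //.
by move=> s2 p2 l2; rewrite h // Z0.
Qed.

Lemma movBr_local s m p q r : S <= s -> movBr s m p q r = 0.
Proof.
move=> le; rewrite /movBr ext_zero ?scaler0 // => x y.
rewrite (@ext_trunc _ S) ?scaler0 ?(linP0 (vop_linr _ _ _ _ _)) //.
by move=> x' y' l; rewrite hS // a0.
Qed.

Lemma partAB_partL s m p q r : S <= s ->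
  dlt T (fun s q => partAB s m p q r) s q = dlt T (fun s q => partL s m p q r) s q.
Proof.
move=> le.
rewrite (@eq_dlt _ _ (fun s q => partAB s m p q r) (fun s q =>
  ((movA s m p q r - lam *: movAr s m p q r) - movBm s m p q r) +
   lam *: movBr s m p q r)); last first.
  by move=> x y; rewrite /partAB partA_mov partB_mov opprB addrA addrAC.
rewrite dltD dltB (dltB T (fun s q => movA s m p q r)).
rewrite (dltZ T lam (fun s q => movAr s m p q r)) movAr_local // scaler0 subr0.
rewrite (dltZ T lam (fun s q => movBr s m p q r)) movB_local -dltB.
rewrite (@dlt_ge _ _ (fun s q => movBr s m p q r) S) ?scaler0 ?addr0 //; last first.
  by move=> *; apply: movBr_local.
by apply: eq_dlt => *; rewrite movA_movB.
Qed.

End Local.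

Lemma partI_mulzx2 t : mulzx2 (partI t) = partI (t + 1).
Proof.
apply: eq_func4 => m p q r; rewrite /mulzx2 /partI iter_ext_shiftm.
have [K1 h1] := phiV_trunc t (m + 1); have [K2 h2] := phiV_trunc t m.
rewrite -(iter_extD (K := Num.max K1 (K2 - 1))).
- apply: eq_iter_ext => r' q'; rewrite -(linPD (vop_linl _ _ _ _ _)) phiV_pascal.
  by rewrite addrC.
- move=> r' q'; rewrite ge_max => /andP[l _].
  by rewrite h1 // (linP0 (vop_linl _ _ _ _ _)).
move=> r' q'; rewrite ge_max => /andP[_ l].
by rewrite h2 ?(linP0 (vop_linl _ _ _ _ _)) //; lia.
Qed.

(* [z^s (z - x2)^t] with [psi] standing for one of the two orderings of [u]. *)
Section Inner.
Variable psi : V -> int -> int -> int -> W.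
Hypothesis psi_pascal : forall v, pascal (psi v).
Hypothesis psi_0 : forall s q t, psi 0 s q t = 0.

Definition partY (s t : int) : func4 W := fun m p q r =>
  iter_ext (fun r q => ext (fun t r => psi (Yv a r b) s q t) t r m) p q r.

Lemma inner_trunc : exists K : int, forall s q t r, K <= r -> psi (Yv a r b) s q t = 0.
Proof.
have [K h] := vop_trunc univ (univ_qmodule univ) (univ_smooth univ) a b.
by exists K => s q t r le; rewrite h.
Qed.

Lemma partY_mulz s t : mulz (partY s t) = partY (s + 1) t.
Proof.
apply: eq_func4 => m p q r; rewrite /mulz; have [K h] := inner_trunc.
have tr s' t' m' r' q' : K <= r' ->
    ext (fun t r => psi (Yv a r b) s' q' t) t' r' m' = 0.
  by move=> le; apply: ext_trunc le => *; apply: h.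
have ut s' q' : utrunc (fun t r => psi (Yv a r b) s' q' t) by exists K => *; apply: h.
rewrite /partY (iter_extS (K := K)); last by move=> *; apply: tr.
rewrite -addrA iter_ext_shiftm -(iter_extD (K := K)); first last.
- by move=> *; apply: tr.
- by move=> *; apply: tr; lia.
rewrite iter_ext_shiftp -(iter_extD (K := K)); first last.
- by move=> *; rewrite !tr ?addr0 //; lia.
- by move=> *; apply: tr.
apply: eq_iter_ext => r' q'; have e : pascal (ext (fun t r => psi (Yv a r b) s q' t)).
  exact: extS.
rewrite -e ext_shiftl -extD //; last exact: (utrunc_shiftl (ut s q')).
by apply: eq_ext => t1 r1; rewrite psi_pascal.
Qed.

End Inner.

Definition psi2 v s q t : W := ext (fun s q => Z g s (Yw v q w)) s q t -
  sgn t *: ext (fun q s => Yw (th [:: g] v) q (Z g s w)) q s t.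
Definition psi1 v s q t : W := ext (fun s q => Z g s (Yw v q w)) s q t.

Lemma psi1_pascal v : pascal (psi1 v). Proof. by apply: extS; apply: left_utrunc. Qed.

Lemma psi2_pascal v : pascal (psi2 v).
Proof.
apply: pascalB; first by apply: extS; apply: left_utrunc.
by apply: pascal_swap; apply: right_utrunc.
Qed.

Lemma psi1_0 s q t : psi1 0 s q t = 0.
Proof. by apply: ext_zero => *; rewrite (linP0 (vop_linl _ _ _ _ _)) Z0. Qed.

Lemma psi2_0 s q t : psi2 0 s q t = 0.
Proof.
rewrite /psi2 -/(psi1 0 s q t) psi1_0 sub0r ext_zero ?scaler0 ?oppr0 // => *.
by rewrite (linP0 (theta_lin _ _)) (linP0 (vop_linl _ _ _ _ _)).
Qed.

(** The power [T] of [z - x2] kills the half of [phiV] in which [g] acts on [b] first. *)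
Lemma partI_partY (T : int) m p q r : (forall t, T <= t -> ZV g t b = 0) ->
  partI T m p q r = partY psi2 0 T m p q r.
Proof.
move=> hT; apply: eq_iter_ext => r' q'; rewrite /phiV [X in _ - _ *: X](@ext_trunc _ T) //.
  rewrite scaler0 subr0 (ext_lin (vop_linl _ _ _ _ _)); last exact: left_utrunc.
  by apply: eq_ext => t' r1; rewrite vop_iter.
by move=> r1 t le; rewrite hT // (linP0 (vop_linr _ _ _ _ _)).
Qed.

Lemma partY_partX (S t : int) m p q r : (forall s, S <= s -> Z g s w = 0) ->
  partY psi2 S t m p q r = partY psi1 S t m p q r.
Proof.
move=> hS; apply: eq_iter_ext => r' q'; apply: eq_ext => t' r1.
rewrite /psi2 [X in _ - _ *: X](@ext_trunc _ S) ?scaler0 ?subr0 // => q1 s le.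
by rewrite hS // (linP0 (vop_linr _ _ _ _ _)).
Qed.

Lemma partX_dlt (T : nat) s m p q r :
  partY psi1 s T m p q r = dlt T (fun s q => partY psi1 s 0 m p q r) s q.
Proof.
have [K h] := inner_trunc psi1_0.
elim: T s q => [//|T IH] s q; rewrite /= -!IH /partY iter_ext_shiftp.
rewrite -(iter_extB (K := K)); first last.
- by move=> r' q' le; apply: ext_trunc le => *; apply: h.
- by move=> r' q' le; apply: ext_trunc le => *; apply: h.
apply: eq_iter_ext => r' q'.
have -> : T.+1%:Z = T%:Z + 1 by lia.
rewrite -extB; try by exists K => *; apply: h.
rewrite ext_shiftl; apply: eq_ext => t1 r1.
by rewrite psi1_pascal [RHS]addrC addKr.
Qed.

(** With [g] leftmost, [(z - x1)^m] is expanded either through [z - x2] and [x1 - x2] or through [z]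
    and [x1]. The two agree at [m = 0], and truncation in [p] carries this to all [m]. *)
Lemma partX_partL s m p q r : partY psi1 s 0 m p q r = partL s m p q r.
Proof.
have [K h] := inner_trunc psi1_0.
have [Kv hv] := vop_trunc univ (univ_qmodule univ) (univ_smooth univ) a b.
have [L hL] : exists L : int, forall (j : nat) q, L <= q -> Yw (Yv a (r + j%:Z) b) q w = 0.
  have [L hL] := @bound_below (fun j q => Yw (Yv a (r + j%:Z) b) q w = 0) `|Kv - r|%N
    (fun j => vop_trunc univ hZ hs (Yv a (r + j%:Z) b) w).
  exists L => j q' le; case: (ltnP j `|Kv - r|%N) => lj; first exact: hL.
  by rewrite hv ?(linP0 (vop_linl _ _ _ _ _)) //; lia.
pose N := `|Kv - r|%N.
have trI p' : L - q + N%:Z <= p' ->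
    iter_ext (fun r q => Yw (Yv a r b) q w) p' q r = 0.
  move=> le; rewrite (@iter_extE _ Kv N); 
    [|by move=> *; rewrite hv ?(linP0 (vop_linl _ _ _ _ _))|by rewrite /N; lia].
  by rewrite big1 // => j _; rewrite hL ?scaler0 //; have := ltn_ord j; lia.
apply/eqP; rewrite -subr_eq0; apply/eqP.
apply: (pascal_uniq_m0 (F := fun s p m => partY psi1 s 0 m p q r - partL s m p q r)).
- apply: pascalB; last by apply: extS; exists (L - q + N%:Z) => x y le; rewrite trI ?Z0.
  move=> s' p' m'; have := partY_mulz psi1_pascal psi1_0 s' 0.
  by move=> /(congr1 (fun F => F m' p' q r)); rewrite /mulz => <-.
- move=> s' p'; rewrite /partL ext0 (iter_ext_lin (K := Kv) (Zlin hZ _ _)); last first.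
    by move=> *; rewrite hv ?(linP0 (vop_linl _ _ _ _ _)).
  rewrite /partY; apply/eqP; rewrite subr_eq0; apply/eqP; apply: eq_iter_ext => r' q'.
  by rewrite ext0 /psi1 ext0.
pose N' := `|K - r|%N.
move=> m'; exists (L - q + N%:Z + N'%:Z) => s' p' le.
rewrite /partL (@ext_trunc _ (L - q + N%:Z)) //; first last.
- by lia.
- by move=> x y l; rewrite trI ?Z0.
rewrite subr0 /partY (@iter_extE _ K N'); first last.
- by rewrite /N'; lia.
- by move=> r' q' l; apply: ext_trunc l => *; apply: h.
rewrite big1 // => j _; rewrite {1}/ext fsumn0 ?scaler0 // => i.
rewrite /psi1 (@ext_trunc _ L) ?scaler0 //; last by have := ltn_ord j; lia.
move=> s1 q1 l; have -> : r + j%:Z + i%:Z = r + (j + i)%N%:Z by lia.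
by rewrite hL // Z0.
Qed.

(** The defect vanishes for large [m], since [g_m a] does. It may therefore be tested after
    multiplication by [z^S (z - x2)^T], where products and iterate both reduce to [partL]. *)
Lemma jacobi_step m :
  jacobi (fun s p => Yw (ZV g m a) s (Yw b p w))
  (fun p s => Yw (th (g :: c) b) p (Yw (ZV g m a) s w))
  (fun n p => Yw (Yv (ZV g m a) n b) p w).
Proof.
have [S0 hS0] := hs w; pose S := `|S0|%N.
have hS s : S%:Z <= s -> Z g s w = 0 by move=> le; apply: hS0; rewrite /S in le; lia.
have [T1 hT1] := univ_smooth univ b; have [T2 hT2] := qcomm_local univ hZ hs b.
pose T := (`|T1| + T2)%N.
have hTa t : T%:Z <= t -> ZV g t b = 0 by move=> le; apply: hT1; rewrite /T in le; lia.
have hTb d x s q : dlt T (qcomm univ hZ hs g (th d b) x) s q = 0.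
  by apply: (@dlt_le _ T2) => [|*]; [rewrite leq_addl|exact: hT2].
have E n p q r : partAB 0 n p q r - partI 0 n p q r =
    ext (fun s p => Yw (ZV g n a) s (Yw b p w)) p q r -
    sgn r *: ext (fun p s => Yw (th (g :: c) b) p (Yw (ZV g n a) s w)) q p r -
    iter_ext (fun m p => Yw (Yv (ZV g n a) m b) p w) p q r.
  congr (_ - _ *: _ - _).
  - by apply: eq_ext => *; rewrite phiE.
  - by apply: eq_ext => *; rewrite phiE.
  by apply: eq_iter_ext => *; rewrite phiVE.
move=> s p r; apply/eqP; rewrite -subr_eq0 -E; apply/eqP; move: m s p r.
apply: (iter_lower (S := S) (T := T)).
  have [K hK] := univ_smooth univ a; exists K => n p q r le.
  rewrite E hK // ext_zero => [|*]; last by rewrite (linP0 (vop_linl _ _ _ _ _)).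
  rewrite ext_zero => [|*];
    last by rewrite (linP0 (vop_linl _ _ _ _ _)) (linP0 (vop_linr _ _ _ _ _)).
  rewrite scaler0 subrr sub0r /iter_ext fsumn0 ?oppr0 // => j.
  by rewrite (linP0 (vop_linl _ _ _ _ _)) (linP0 (vop_linl _ _ _ _ _)) scaler0.
move=> n p q r; rewrite iter_mulzx2B iter_mulzB.
rewrite (iter_family (H := partI)) ?(eq_func4 (fun m p q r => partI_partY m p q r hTa));
  last exact: partI_mulzx2.
rewrite (iter_family (H := fun s => partY psi2 s T%:Z)); last first.
  by move=> s; apply: (partY_mulz psi2_pascal psi2_0).
rewrite (partY_partX _ _ _ _ _ hS) partX_dlt.
rewrite (eq_dlt _ (g := fun s q => partL s n p q r)); last by move=> *; rewrite partX_partL.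
rewrite (iter_mulzx2_dlt _ _ partAB_pascal1 partAB_pascal2).
rewrite (iter_family (H := fun s m p q r => dlt T (fun s q => partAB s m p q r) s q)).
  by rewrite (partAB_partL hS hTb) ?subrr.
move=> s; apply: eq_func4 => m' p' q' r'; rewrite /mulz -dltD -dlt_shiftl.
by apply: eq_dlt => s1 q1; rewrite -partAB_mulz.
Qed.

End Step.

(** * Components of the axioms *)

Section FsumReindex.
Variable M : zmodType.

Lemma fsum_shift1 (H : int -> M) (N : nat) : (forall n : int, N%:Z < `|n| -> H n = 0) ->
  fsum (fun m => H (m + 1)) = fsum H.
Proof.
move=> h; rewrite (@fsumE _ _ N.+1); last by move=> n le; rewrite h //; lia.
rewrite (@fsumE _ H N.+2); last by move=> n le; rewrite h //; lia.
rewrite [N.+2.*2]doubleS [RHS]big_ord_recl h ?add0r; last by rewrite /=; lia.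
rewrite [RHS]big_ord_recl h ?add0r; last by rewrite /= /bump; lia.
by apply: eq_bigr => i _; congr H; rewrite /= /bump; lia.
Qed.

Lemma fsum_opp (H : int -> M) (N : nat) : (forall n : int, N%:Z < `|n| -> H n = 0) ->
  fsum (fun m => H (- m)) = fsum H.
Proof.
move=> h; rewrite (@fsumE _ _ N); last by move=> n le; rewrite h //; lia.
rewrite (@fsumE _ H N) // [RHS](reindex_inj rev_ord_inj) /=.
by apply: eq_bigr => i _; congr H; have := ltn_ord i; lia.
Qed.

Lemma fsum_shift (k : int) (H : int -> M) (N : nat) :
  (forall n : int, N%:Z < `|n| -> H n = 0) -> fsum (fun m => H (m + k)) = fsum H.
Proof.
have step (j : int) (K : nat) (G : int -> M) : (forall n : int, K%:Z < `|n| -> G n = 0) ->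
    forall n : int, (K + `|j|)%N%:Z < `|n| -> G (n + j) = 0.
  by move=> h n le; apply: h; lia.
move=> h; move: k; apply: (@int_updown _ 0).
- by congr fsum; apply/funext => m; rewrite addr0.
- move=> k <-; rewrite -(@fsum_shift1 (fun m => H (m + k)) (N + `|k|)); last exact: step.
  by congr fsum; apply/funext => m; congr H; lia.
move=> k <-; rewrite -(@fsum_shift1 (fun m => H (m + k)) (N + `|k|)); last exact: step.
by congr fsum; apply/funext => m; congr H; lia.
Qed.

Lemma fsum_reflect (k : int) (F : nat -> M) : sfin F ->
  fsum (fun m => match k - m with Posz j => F j | Negz _ => 0 end) = fsumn F.
Proof.
case=> N h; rewrite /fsumn.
set H := fun z : int => match z with Posz n => F n | Negz _ => 0 end.
have hH n : N%:Z < `|n| -> H n = 0 by case: n => // n le; apply: h; lia.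
rewrite -(fsum_opp hH) -(@fsum_shift (- k) (fun m => H (- m)) N); last first.
  by move=> n le; apply: hH; lia.
by congr fsum; apply/funext => m; rewrite /H; congr (match _ with Posz n => _ | _ => _ end); lia.
Qed.

End FsumReindex.

Section Interface.
Variables (V W : lmodType C) (Yv : V -> int -> V -> V) (YW : V -> int -> W -> W).
Hypotheses (Yv_tr : truncated Yv) (YW_lin : bilinear_op YW) (YW_tr : truncated YW).

Lemma op_linr u n : linear (YW u n).
Proof. by case: YW_lin => h _ k x y; apply: h. Qed.

Lemma op_linl n w : linear (fun u => YW u n w).
Proof. by case: YW_lin => _ h k x y; apply: h. Qed.

Definition lprod u v w : int -> int -> W := fun s p => YW u s (YW v p w).
Definition rprod u v w : int -> int -> W := fun p s => YW v p (YW u s w).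
Definition iprod u v w : int -> int -> W := fun m p => YW (Yv u m v) p w.

Lemma lprod_utrunc u v w : utrunc (lprod u v w).
Proof.
by have [K h] := YW_tr v w; exists K => s p le; rewrite /lprod h // (linP0 (op_linr _ _)).
Qed.

Lemma rprod_utrunc u v w : utrunc (rprod u v w).
Proof.
by have [K h] := YW_tr u w; exists K => s p le; rewrite /rprod h // (linP0 (op_linr _ _)).
Qed.

Lemma iprod_trunc u v w : exists K, forall m p, K <= m -> iprod u v w m p = 0.
Proof.
by have [K h] := Yv_tr u v; exists K => s p le; rewrite /iprod h // (linP0 (op_linl _ _)).
Qed.

(** With [z = x0 + x2], expanding powers of [x0 + x2] is dual to expanding powers of [z - x2]; upper
    negation matches the coefficients. *)
Lemma YY_shiftE u v w a b : YY_shift YW u v w a b = ext (lprod u v w) 0 (- b - 1) (- a - 1).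
Proof.
rewrite /ext -(@fsum_reflect _ (- 1 - a)); last exact: ext_sfin (lprod_utrunc _ _ _).
congr fsum; apply/funext => m; have -> : - m - 1 - a = - 1 - a - m by lia.
case E : (- 1 - a - m) => [j|//].
have -> : - m - 1 = (a + 1) - 1 + j%:Z by lia.
rewrite -[binz (- a - 1) j](_ : binz (- (a + 1)) j = _); last by congr binz; lia.
rewrite -binz_neg -mulrA sgnM mulr1 /lprod; idx.
Qed.

Lemma mul_sum_powE (F : int -> int -> int -> W) l s t : pascal F ->
  mul_sum_pow l (fun a b => F 0 (- b - 1) (- a - 1)) s t = F l (- t - 1) (- s - 1).
Proof.
move=> hF; rewrite -[l%:Z]add0r -(pascal_pow _ _ _ _ hF).
by apply: eq_bigr => j _; congr (_ *: _); congr F; lia.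
Qed.

(** By [pascal_pow], multiplication by [(x0 + x2)^l] is a shift by [l] of the exponent of [z]. *)
Lemma weak_assocP u v w (l : nat) :
  (forall a b, mul_sum_pow l (YY_shift YW u v w) a b = mul_sum_pow l (Y_iter Yv YW u v w) a b)
  <-> (forall p m, ext (lprod u v w) l p m = iter_ext (iprod u v w) l p m).
Proof.
have [K hK] := iprod_trunc u v w.
have e1 a b : mul_sum_pow l (YY_shift YW u v w) a b =
    ext (lprod u v w) l (- b - 1) (- a - 1).
  rewrite -(mul_sum_powE _ _ _ (extS (lprod_utrunc u v w))).
  by apply: eq_bigr => j _; rewrite YY_shiftE.
have e2 a b : mul_sum_pow l (Y_iter Yv YW u v w) a b =
    iter_ext (iprod u v w) l (- b - 1) (- a - 1).
  rewrite -(mul_sum_powE _ _ _ (iter_extS hK)).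
  by apply: eq_bigr => j _; rewrite iter_ext0.
split=> h p m; last by rewrite e1 e2.
have := h (- m - 1) (- p - 1); rewrite e1 e2.
have -> : - (- m - 1) - 1 = m by lia.
by have -> : - (- p - 1) - 1 = p by lia.
Qed.

(* Both sides satisfy [pascal], so the case [s = l] implies the others. *)
Definition wassoc u v w : Prop := exists l : int, forall s p m, l <= s ->
  ext (lprod u v w) s p m = iter_ext (iprod u v w) s p m.

Lemma wassoc_weak_assoc : (forall u v w, wassoc u v w) -> weak_assoc Yv YW.
Proof.
move=> h u v w; have [l hl] := h u v w; exists `|l|%N.
by apply/weak_assocP => p m; apply: hl; lia.
Qed.

Lemma weak_assoc_wassoc : weak_assoc Yv YW -> forall u v w, wassoc u v w.
Proof.
move=> h u v w; have [l hl] := h u v w; have [K hK] := iprod_trunc u v w.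
move/weak_assocP in hl; exists l => s p m le.
have -> : s = l%:Z + `|s - l%:Z|%N by lia.
elim: `|s - l%:Z|%N p m => [|n IH] p m; first by rewrite addr0.
have -> : l%:Z + n.+1%:Z = l%:Z + n%:Z + 1 by lia.
by rewrite (extS (lprod_utrunc u v w)) (iter_extS hK) !IH.
Qed.

End Interface.

(** * Vertex algebra and module structures *)

Section Structure.
Variables (D : qdata) (V : lmodType C) (ZV : D -> int -> V -> V) (vac : V).
Hypothesis univ : universal ZV vac.
Local Notation Yv := (vop univ (univ_qmodule univ) (univ_smooth univ)).
Local Notation th := (theta univ).

(** Scalar multiples are included because a twist maps such a vector to a multiple of itself. *)
Inductive mono : seq D -> V -> Prop :=
| mono_vac : mono [::] vac
| mono_scale k c v : mono c v -> mono c (k *: v)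
| mono_Z a n c v : mono c v -> mono (a :: c) (ZV a n v).

Definition chi (d c : seq D) : C := \prod_(b <- c) tau d b.

Lemma mono_theta d c v : mono c v -> th d v = chi d c *: v.
Proof.
elim=> [|k {}c {}v _ IH|a n {}c {}v _ IH].
- by rewrite theta_vac /chi big_nil scale1r.
- by rewrite (linPZ (theta_lin univ d)) IH !scalerA mulrC.
rewrite theta_Z IH (linPZ (Zlin (univ_qmodule univ) _ _)) scalerA.
by rewrite /chi big_cons.
Qed.

Lemma mono_span (P : V -> Prop) : subspace P -> (forall c v, mono c v -> P v) ->
  forall v, P v.
Proof.
move=> hP hm v.
(* The claim is generalized over [P], so that a generator applied to [v] is treated by pulling [P]
   back along it. *)
suff: forall P : V -> Prop, subspace P -> (forall c v, mono c v -> P v) -> P v by apply.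
apply: (universal_ind univ (P := fun v =>
  forall P : V -> Prop, subspace P -> (forall c v, mono c v -> P v) -> P v)).
- split=> [Q [] //|k x y hx hy Q hQ hm'].
  by case: (hQ) => _; apply; [apply: hx|apply: hy].
- by move=> Q _ h; apply: (h [::]); constructor.
move=> a n {}v hv Q hQ h; apply: (hv (fun x => Q (ZV a n x))).
  split; first by rewrite (linP0 (Zlin (univ_qmodule univ) _ _)); case: hQ.
  by move=> k x y; rewrite (Zlin (univ_qmodule univ)); case: hQ => _; apply.
by move=> c x hx; apply: (h (a :: c)); constructor.
Qed.

Section Modules.
Variables (W : lmodType C) (Z : D -> int -> W -> W).
Hypotheses (hZ : qmodule Z) (hs : smooth Z).
Local Notation Yw := (vop univ hZ hs).

Lemma vop_bilinear : bilinear_op Yw.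
Proof. by split=> *; [apply: vop_linr|apply: vop_linl]. Qed.

Lemma vop_truncated : truncated Yw.
Proof. exact: vop_trunc. Qed.

Lemma jacobi_vac b w : jacobi (fun s p => Yw vac s (Yw b p w))
  (fun p s => Yw (th [::] b) p (Yw vac s w)) (fun m p => Yw (Yv vac m b) p w).
Proof.
apply: (@jacobi_of_iterate _ _ _ _ 0 0).
- exact: lprod_utrunc vop_bilinear vop_truncated _ _ _.
- exact: rprod_utrunc vop_bilinear vop_truncated _ _ _.
- move=> m p le; rewrite vop_vac; case: eqP => [|_]; first by lia.
  exact: (linP0 (vop_linl _ _ _ _ _)).
- move=> s p; rewrite /= theta_nil !vop_vac; case: eqP => _; rewrite ?subrr //.
  by rewrite (linP0 (vop_linr _ _ _ _ _)) subrr.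
move=> p m; rewrite [X in _ - _ *: X]fsumn0 ?scaler0 ?subr0 => [|j]; last first.
  rewrite vop_vac; case: eqP => [|_]; first by lia.
  by rewrite (linP0 (vop_linr _ _ _ _ _)) scaler0.
rewrite vop_vac; case: eqP => [->|ne].
  rewrite /ext fsumn1 => [|j]; last by rewrite vop_vac; case: eqP; rewrite ?scaler0 //; lia.
  by rewrite binz_0 sgn0 mul1r scale1r vop_vac addr0 subr0.
rewrite (linP0 (vop_linl _ _ _ _ _)) /ext fsumn0 // => j.
rewrite vop_vac; case: eqP => [e|_]; last by rewrite scaler0.
have -> : m = (j.-1)%:Z by lia.
by rewrite binz_small ?mul0r ?scale0r //; lia.
Qed.

Lemma jacobi_mono c a : mono c a -> forall b w,
  jacobi (fun s p => Yw a s (Yw b p w))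
  (fun p s => Yw (th c b) p (Yw a s w)) (fun m p => Yw (Yv a m b) p w).
Proof.
elim=> [|k {}c {}a _ IH|g m {}c {}a ha IH] b w; first exact: jacobi_vac.
  have [K hK] := iprod_trunc (vop_trunc univ (univ_qmodule univ) (univ_smooth univ))
    vop_bilinear a b w.
  move=> s p m; rewrite (@eq_ext _ _ (fun s p => k *: Yw a s (Yw b p w))) => [|x y];
    last by rewrite (linPZ (vop_linl _ _ _ _ _)).
  rewrite [X in _ - _ *: X](@eq_ext _ _ (fun p s => k *: Yw (th c b) p (Yw a s w))) => [|x y];
    last by rewrite (linPZ (vop_linl _ _ _ _ _)) (linPZ (vop_linr _ _ _ _ _)).
  rewrite !extZ; first last.
  - exact: lprod_utrunc vop_bilinear vop_truncated _ _ _.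
  - exact: rprod_utrunc vop_bilinear vop_truncated _ _ _.
  rewrite scalerA mulrC -scalerA -scalerBr IH (iter_ext_lin (scale_linear k) _ _ _ hK).
  by apply: eq_iter_ext => x y; rewrite !(linPZ (vop_linl _ _ _ _ _)).
exact: (jacobi_step (mono_theta _ ha) (IH b w)).
Qed.

(** For a monomial [u], powers of [z] beyond the truncation of [u] on [w] remove the opposite
    product from the Jacobi identity. *)
Lemma vop_wassoc u v w : wassoc Yv Yw u v w.
Proof.
have tv := vop_trunc univ (univ_qmodule univ) (univ_smooth univ).
move: u; apply: mono_span.
- split.
    exists 0 => s p m _; rewrite ext_zero => [|*];
      last by rewrite /lprod (linP0 (vop_linl _ _ _ _ _)).
    rewrite /iter_ext fsumn0 // => j.
    by rewrite /iprod (linP0 (vop_linl _ _ _ _ _)) (linP0 (vop_linl _ _ _ _ _)) scaler0.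
  move=> k x y [l1 h1] [l2 h2]; exists (Num.max l1 l2) => s p m.
  rewrite ge_max => /andP[le1 le2].
  have ux := lprod_utrunc vop_bilinear vop_truncated x v w.
  have uy := lprod_utrunc vop_bilinear vop_truncated y v w.
  have [K hK] := iprod_trunc tv vop_bilinear x v w.
  have [K' hK'] := iprod_trunc tv vop_bilinear y v w.
  rewrite (@eq_ext _ _ (fun s p => k *: lprod Yw x v w s p + lprod Yw y v w s p)); last first.
    by move=> *; rewrite /lprod vop_linl.
  rewrite extD ?extZ //; last exact: utruncZ.
  rewrite h1 // h2 // (iter_ext_lin (scale_linear k) _ _ _ hK).
  rewrite -(iter_extD (K := Num.max K K')).
  - by apply: eq_iter_ext => *; rewrite /iprod !vop_linl.
  - by move=> *; rewrite hK ?scaler0 //; lia.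
  by move=> *; rewrite hK' //; lia.
move=> c a ha; have [K h] := vop_trunc univ hZ hs a w; exists K => s p m le.
rewrite -[RHS](jacobi_mono ha v w s p m) [X in _ = _ - _ *: X](@ext_trunc _ K) //.
  by rewrite scaler0 subr0.
by move=> x y l; rewrite h // (linP0 (vop_linr _ _ _ _ _)).
Qed.

Lemma vop_module : VA_module Yv vac Yw.
Proof.
split; [exact: vop_bilinear|exact: vop_truncated|by move=> n w; rewrite vop_vac|].
apply: (wassoc_weak_assoc _ vop_bilinear vop_truncated) => [|u v w].
  exact: vop_trunc.
exact: vop_wassoc.
Qed.

End Modules.

Lemma vop_creation v : (forall n, 0 <= n -> Yv v n vac = 0) /\ Yv v (-1) vac = v.
Proof.
have hq := univ_qmodule univ; have [_ hvac _] := univ.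
move: v; apply: (universal_ind univ
  (P := fun v => (forall n, 0 <= n -> Yv v n vac = 0) /\ Yv v (-1) vac = v)).
- split; first by split=> [n _|]; rewrite (linP0 (vop_linl _ _ _ _ _)).
  move=> k x y [h1 h2] [h3 h4]; split=> [n le|]; rewrite vop_linl.
    by rewrite h1 // h3 // scaler0 addr0.
  by rewrite h2 h4.
- by split=> [n le|]; rewrite vop_vac //; case: eqP => //; lia.
move=> a m v [h1 h2].
have e p : Yv (ZV a m v) p vac = ext (fun s q => ZV a s (Yv v q vac)) 0 p m.
  rewrite vop_iter [X in _ - _ *: X](@ext_trunc _ 0) ?scaler0 ?subr0 // => x y le.
  by rewrite hvac // (linP0 (vop_linr _ _ _ _ _)).
have tr s q : 0 <= q -> ZV a s (Yv v q vac) = 0.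
  by move=> le; rewrite h1 // (linP0 (Zlin hq _ _)).
split=> [n le|]; rewrite e; first exact: (ext_trunc _ _ tr).
rewrite (@extE _ 0 1) // big_ord1 binz_0 sgn0 mul1r scale1r add0r subr0 addr0.
by rewrite h2.
Qed.

Lemma vop_nonlocal : nonlocal_VA Yv vac.
Proof.
have [h1 h2 h3 h4] := vop_module (univ_qmodule univ) (univ_smooth univ).
split=> //; split=> // [v n le|v]; have [c1 c2] := vop_creation v => //.
exact: c1.
Qed.

(** Weak associativity fixes the iterate for large powers of [z], and truncation recovers it at
    power [0], where it is the action of [a_m v]. Two algebra structures are allowed, so that the
    lemma applies to the algebra itself as well as to modules. *)
Lemma module_uniq (W : lmodType C) (Yv1 Yv2 : V -> int -> V -> V)
    (Y1 Y2 : V -> int -> W -> W) :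
  truncated Yv1 -> truncated Yv2 -> VA_module Yv1 vac Y1 -> VA_module Yv2 vac Y2 ->
  (forall a n v, Yv1 (ZV a (-1) vac) n v = ZV a n v) ->
  (forall a n v, Yv2 (ZV a (-1) vac) n v = ZV a n v) ->
  (forall a n w, Y1 (ZV a (-1) vac) n w = Y2 (ZV a (-1) vac) n w) ->
  forall a n w, Y1 a n w = Y2 a n w.
Proof.
move=> tv1 tv2 [b1 t1 v1 wa1] [b2 t2 v2 wa2] g1 g2 g12; apply: (universal_ind univ).
- split=> [n w|k x y h h' n w].
    by rewrite (linP0 (op_linl b1 _ _)) (linP0 (op_linl b2 _ _)).
  by rewrite (op_linl b1) (op_linl b2) h h'.
- by move=> n w; rewrite v1 v2.
move=> a m v IH p w; set u := ZV a (-1) vac in g1 g2 g12.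
have [l1 h1] := weak_assoc_wassoc tv1 b1 t1 wa1 u v w.
have [l2 h2] := weak_assoc_wassoc tv2 b2 t2 wa2 u v w.
have [K1 k1] := iprod_trunc tv1 b1 u v w; have [K2 k2] := iprod_trunc tv2 b2 u v w.
pose F s p m := iter_ext (iprod Yv1 Y1 u v w) s p m - iter_ext (iprod Yv2 Y2 u v w) s p m.
suff : F 0 p m = 0.
  by rewrite /F !iter_ext0 /iprod g1 g2 => /eqP; rewrite subr_eq0 => /eqP.
apply: (@pascal_uniq_s _ F (Num.max l1 l2)).
- by apply: pascalB; [exact: iter_extS k1|exact: iter_extS k2].
- move=> p' m'; rewrite /F -h1 ?le_max ?lexx // -h2 ?le_max ?lexx ?orbT //.
  apply/eqP; rewrite subr_eq0; apply/eqP; apply: eq_ext => s q.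
  by rewrite /lprod g12 IH.
exists (Num.max K1 K2) => s p' m'; rewrite ge_max => /andP[le1 le2].
by rewrite /F (iter_ext_trunc _ _ k1) // (iter_ext_trunc _ _ k2) // subrr.
Qed.

End Structure.

(** * The quantum Yang-Baxter operator *)

Lemma fsum_pick (M : zmodType) (H : int -> M) (n : int) :
  (forall r, r != n -> H r = 0) -> fsum H = H n.
Proof.
move=> h; rewrite (@fsumE _ _ `|n|%N) => [|r lt]; last by apply: h; lia.
have lt : (`|(n + `|n|%N%:Z)%R|%N < (`|n|%N.*2).+1)%N by lia.
rewrite (bigD1 (Ordinal lt)) //= big1 => [|i ne].
  by rewrite addr0; congr H; lia.
by apply: h; move: ne; rewrite -val_eqE /=; lia.
Qed.

Definition const1 : laur := fun n => if n == 0 then 1 else 0.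

Lemma const1_neq n : n != 0 -> const1 n = 0.
Proof. by rewrite /const1 => /negbTE ->. Qed.

Lemma const1_laurent : laurent const1.
Proof. by exists 0 => n lt; rewrite const1_neq //; lia. Qed.

Section Quantum.
Variables (D : qdata) (V : lmodType C) (ZV : D -> int -> V -> V) (vac : V).
Hypothesis univ : universal ZV vac.
Local Notation Yv := (vop univ (univ_qmodule univ) (univ_smooth univ)).
Local Notation th := (theta univ).

Let blin := vop_bilinear univ (univ_qmodule univ) (univ_smooth univ).
Let trn := vop_truncated univ (univ_qmodule univ) (univ_smooth univ).

Definition monos (L : seq (seq D * V)) : Prop := List.Forall (fun e => mono ZV vac e.1 e.2) L.

Lemma monos_cat L L' : monos L -> monos L' -> monos (L ++ L').
Proof. by move=> h h'; apply/List.Forall_app. Qed.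

Lemma monos_scale k L : monos L -> monos [seq (e.1, k *: e.2) | e <- L].
Proof.
by elim=> [|e {}L h _ IH] /=; constructor => //; apply: mono_scale.
Qed.

Lemma monos_theta d L : monos L -> monos [seq (e.1, th d e.2) | e <- L].
Proof.
elim=> [|e {}L h _ IH] /=; constructor => //=.
by rewrite (mono_theta univ d h); apply: mono_scale.
Qed.

Lemma dec_ex v : exists L, monos L /\ v = \sum_(e <- L) e.2.
Proof.
move: v; apply: (mono_span univ (P := fun v => exists L, monos L /\ v = \sum_(e <- L) e.2)).
- split; first by exists [::]; rewrite big_nil; split=> //; constructor.
  move=> k x y [L [h ->]] [L' [h' ->]].
  exists ([seq (e.1, k *: e.2) | e <- L] ++ L'); split.
    by apply: monos_cat => //; apply: monos_scale.
  by rewrite big_cat big_map scaler_sumr.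
by move=> c v h; exists [:: (c, v)]; rewrite big_seq1; split=> //; constructor.
Qed.

Definition dec v : seq (seq D * V) := proj1_sig (cid (dec_ex v)).

Lemma dec_mono v : monos (dec v).
Proof. by rewrite /dec; case: cid => L []. Qed.

Lemma dec_sum v : \sum_(e <- dec v) e.2 = v.
Proof. by rewrite /dec; case: cid => L []. Qed.

(* On vectors of weights [c] and [d] the operator is multiplication by the bicharacter. *)
Definition Sq (x y : V) : tens2 V := [seq ((th e.1 x, e.2), const1) | e <- dec y].

Definition bilform (F : V -> V -> C) : Prop :=
  (forall y, linear (fun x => F x y : C^o)) /\ (forall x, linear (fun y => F x y : C^o)).

(** The weight inverse to [c], as [bar a] has the inverse exchange factors of [a]. *)
Definition bars (c : seq D) : seq D := [seq bar a | a <- c].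

Lemma qf_bar (a b : D) : qf (bar a) b = qf b a.
Proof.
have := kap_qf b (kap_bar a) => /(congr1 (fun x => x * qf b a)).
by rewrite mul1r mulrAC qfV mul1r.
Qed.

Lemma tau_bars c b : tau (bars c) b = \prod_(a <- c) qf b a.
Proof. by rewrite /tau big_map; apply: eq_bigr => a _; rewrite qf_bar. Qed.

Lemma chi_bars c d : chi (bars d) c = chi c d.
Proof.
by rewrite /chi (eq_bigr _ (fun b _ => tau_bars d b)) exchange_big.
Qed.

Lemma theta_bars c v : th (bars c) (th c v) = v.
Proof.
rewrite -theta_cat; apply: theta_id => b; rewrite tau_cat tau_bars /tau.
have : \prod_(a <- c) (qf b a * qf a b) = 1 by apply: big1 => a _; rewrite qfV.
by rewrite big_split.
Qed.

(** Both sides are the double sum weighted by the bicharacter. Thus the twist may be put on either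
    slot, and the result depends on neither decomposition. *)
Lemma twist_sum F x y Lx Ly : bilform F -> monos Lx -> monos Ly ->
  x = \sum_(d <- Lx) d.2 -> y = \sum_(e <- Ly) e.2 ->
  \sum_(e <- Ly) F (th e.1 x) e.2 = \sum_(d <- Lx) F d.2 (th (bars d.1) y).
Proof.
move=> [F1 F2] hx hy -> ->.
have E1 : \sum_(e <- Ly) F (th e.1 (\sum_(d <- Lx) d.2)) e.2 =
    \sum_(e <- Ly) \sum_(d <- Lx) chi e.1 d.1 * F d.2 e.2.
  apply: eq_bigr => e _; elim: hx => [|d L hd _ IH].
    by rewrite !big_nil (linP0 (theta_lin _ _)) (linP0 (F1 _)).
  rewrite !big_cons (linPD (theta_lin _ _)) (linPD (F1 _)) IH (mono_theta univ _ hd).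
  by rewrite (linPZ (F1 _)).
have E2 : \sum_(d <- Lx) F d.2 (th (bars d.1) (\sum_(e <- Ly) e.2)) =
    \sum_(d <- Lx) \sum_(e <- Ly) chi e.1 d.1 * F d.2 e.2.
  apply: eq_bigr => d _; elim: hy => [|e L he _ IH].
    by rewrite !big_nil (linP0 (theta_lin _ _)) (linP0 (F2 _)).
  rewrite !big_cons (linPD (theta_lin _ _)) (linPD (F2 _)) IH (mono_theta univ _ he).
  by rewrite (linPZ (F2 _)) chi_bars.
by rewrite E1 E2 exchange_big.
Qed.

Definition tw F x y : C := \sum_(e <- dec y) F (th e.1 x) e.2.

Lemma twE F x y Ly : bilform F -> monos Ly -> y = \sum_(e <- Ly) e.2 ->
  tw F x y = \sum_(e <- Ly) F (th e.1 x) e.2.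
Proof.
move=> hF hy ey; have ex := esym (dec_sum x); have hx := dec_mono x.
rewrite /tw (twist_sum hF hx (dec_mono y) ex (esym (dec_sum y))).
by rewrite (twist_sum hF hx hy ex ey).
Qed.

Lemma tw_monor F c x y : bilform F -> mono ZV vac c y -> tw F x y = F (th c x) y.
Proof.
move=> hF h; rewrite (@twE _ _ _ [:: (c, y)]) ?big_seq1 //.
by constructor=> //; constructor.
Qed.

Lemma tw_monol F c x y : bilform F -> mono ZV vac c x -> tw F x y = F x (th (bars c) y).
Proof.
move=> hF h; rewrite /tw (@twist_sum F x y [:: (c, x)] (dec y)) ?big_seq1 ?dec_sum //.
  by constructor=> //; constructor.
exact: dec_mono.
Qed.

Lemma bilform_mul (phi psi : {scalar V}) : bilform (fun x y => phi x * psi y).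
Proof.
split=> z k x y; rewrite linearP /=.
  by rewrite mulrDl -mulrA.
by rewrite mulrDr mulrCA.
Qed.

Lemma pair2_Sq (phi psi : {scalar V}) x y n :
  pair2 phi psi (Sq x y) n = tw (fun x y => phi x * psi y) x y * const1 n.
Proof. by rewrite /pair2 /Sq big_map /tw mulr_suml. Qed.

Lemma Sq_linear : S_linear Sq.
Proof.
split=> [a b|].
  by rewrite /Sq; elim: (dec b) => //= e L IH; constructor=> //; exact: const1_laurent.
split=> [phi psi n c a1 a2 b|phi psi n c a b1 b2]; have hF := bilform_mul phi psi.
  rewrite !pair2_Sq mulrA -mulrDl; congr (_ * _); rewrite /tw mulr_sumr -big_split /=.
  by apply: eq_bigr => e _; rewrite theta_lin linearP /= mulrDl mulrA.
rewrite !pair2_Sq mulrA -mulrDl; congr (_ * _).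
rewrite (@twE _ _ _ ([seq (e.1, c *: e.2) | e <- dec b1] ++ dec b2)) //.
- rewrite big_cat big_map /= /tw mulr_sumr; apply: congr2 => //; apply: eq_bigr => e _.
  by rewrite linearZ /= mulrCA.
- by apply: monos_cat; [apply: monos_scale|]; apply: dec_mono.
by rewrite big_cat big_map /= -scaler_sumr !dec_sum.
Qed.

Lemma lmul_const1 n : lmul const1 (fun k => sgn k * const1 k) n = const1 n.
Proof.
rewrite /lmul (@fsum_pick _ _ 0) => [|k ne]; last by rewrite const1_neq // mul0r.
rewrite subr0 mul1r /const1; case: eqP => [->|]; rewrite ?mulr0 //.
by rewrite sgn0 mul1r.
Qed.

Lemma dec_sum_ind (M : zmodType) (G : seq D * V -> M) (H : V -> M) y :
  (forall e, mono ZV vac e.1 e.2 -> G e = H e.2) ->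
  \sum_(e <- dec y) G e = \sum_(e <- dec y) H e.2.
Proof.
by move=> h; elim: (dec_mono y) => [|e L he _ IH]; rewrite ?big_nil // !big_cons IH h.
Qed.

(** On a component of weight [c], the second application undoes [theta c] by [theta (bars c)]. *)
Lemma Sq_unitary : S_unitary Sq.
Proof.
move=> a b phi psi n; have hF := bilform_mul phi psi.
rewrite {1}/Sq big_map /=.
rewrite (@dec_sum_ind _ _ (fun x => phi x * psi b * const1 n)) => [|e he].
  rewrite -mulr_suml -mulr_suml -[in RHS](dec_sum a) raddf_sum //.
rewrite /Sq big_map /=.
rewrite (eq_bigr (fun d => (phi (th d.1 e.2) * psi d.2) * const1 n)) => [|d _].
  rewrite -mulr_suml; apply: congr2 => //; rewrite -/(tw (fun x y => phi x * psi y) _ _).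
  by rewrite (tw_monol _ hF he) theta_bars.
by rewrite lmul_const1.
Qed.

(** Both sides twist each of the three pairs once; they differ only in the order of two twists of
    [a], which commute. *)
Lemma Sq_YBE : S_YBE Sq.
Proof.
move=> a b c phi1 phi2 phi3 s t; have hF := bilform_mul phi1 phi2.
have hF' := bilform_mul phi2 phi3.
set K := ser3 const1 const1 const1 s t.
transitivity (\sum_(e <- dec c) \sum_(f <- dec b)
  phi1 (th f.1 (th e.1 a)) * phi2 (th e.1 f.2) * phi3 e.2 * K).
  rewrite {1}/Sq big_map /=.
  have h : forall e, mono ZV vac e.1 e.2 ->
    \sum_(e2 <- Sq a e.2) \sum_(e3 <- Sq e2.1.1 (th e.1 b))
       phi1 e3.1.1 * phi2 e3.1.2 * phi3 e2.1.2 * ser3 e3.2 e2.2 const1 s t =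
    \sum_(f <- dec b) phi1 (th f.1 (th e.1 a)) * phi2 (th e.1 f.2) * phi3 e.2 * K.
    move=> e he.
    pose F x y := tw (fun x y => phi1 x * phi2 y) x (th e.1 b) * phi3 y.
    have bF : bilform F.
      split=> z k x y; rewrite /F; last by rewrite linearP /= mulrDr mulrCA.
      rewrite /GRing.scale /= mulrA -mulrDl; apply: congr2 => //.
      rewrite /tw mulr_sumr -big_split; apply: eq_bigr => d _ /=.
      by rewrite theta_lin linearP /= mulrDl mulrA.
    transitivity (tw F a e.2 * K).
      rewrite /Sq big_map /tw mulr_suml; apply: eq_bigr => d _ /=.
      by rewrite big_map /F /tw mulr_suml mulr_suml.
    rewrite (tw_monor _ bF he) /F.
    rewrite (@twE _ _ _ [seq (f.1, th e.1 f.2) | f <- dec b]) //.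
    - by rewrite big_map /= !mulr_suml.
    - by apply: monos_theta; apply: dec_mono.
    by rewrite big_map /= -(linP_sum (theta_lin _ _)) dec_sum.
  by elim: (dec_mono c) => [|e L he _ IH]; rewrite ?big_nil // !big_cons IH h.
rewrite exchange_big [RHS](_ : _ = \sum_(f <- dec b) \sum_(e <- dec c)
  phi1 (th e.1 (th f.1 a)) * phi2 (th e.1 f.2) * phi3 e.2 * K); last first.
  rewrite {1}/Sq big_map /=; apply: eq_bigr => f _.
  rewrite {1}/Sq big_map /=.
  have h : forall e, mono ZV vac e.1 e.2 ->
    \sum_(e3 <- Sq f.2 e.2) phi1 (th e.1 (th f.1 a)) * phi2 e3.1.1 * phi3 e3.1.2 *
      ser3 const1 const1 e3.2 s t =
    phi1 (th e.1 (th f.1 a)) * phi2 (th e.1 f.2) * phi3 e.2 * K.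
    move=> e he; rewrite -(mulrA (phi1 _)) -(tw_monor f.2 hF' he).
    rewrite /Sq big_map /tw mulr_sumr mulr_suml.
    by apply: eq_bigr => d _ /=; rewrite mulrA.
  by elim: (dec_mono c) => [|e L he _ IH]; rewrite ?big_nil // !big_cons IH h.
by apply: eq_bigr => f _; apply: eq_bigr => e _; rewrite theta_comm.
Qed.

(** The additional twist [d] is carried because the iterate formula for [a_m v] involves the twist
    of [v] by [a]. *)
Lemma theta_vop c v : forall d p w, th c (Yv (th d v) p w) = Yv (th c (th d v)) p (th c w).
Proof.
have hq := univ_qmodule univ.
move: v; apply: (universal_ind univ
  (P := fun v => forall d p w, th c (Yv (th d v) p w) = Yv (th c (th d v)) p (th c w))).
- split=> [d p w|k x y hx hy d p w].
    by rewrite !(linP0 (theta_lin _ _)) !(linP0 (vop_linl _ _ _ _ _)) (linP0 (theta_lin _ _)).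
  by rewrite !(theta_lin, vop_linl) hx hy.
- move=> d p w; rewrite !theta_vac !vop_vac; case: eqP => // _.
  exact: (linP0 (theta_lin _ _)).
move=> a n v IH d p w.
rewrite theta_Z (linPZ (vop_linl _ _ _ _ _)) !(linPZ (theta_lin _ _)) (linPZ (vop_linl _ _ _ _ _)).
congr (_ *: _); rewrite theta_Z (linPZ (vop_linl _ _ _ _ _)) !vop_iter.
rewrite (linPB (theta_lin _ _)) (linPZ (theta_lin _ _)).
rewrite !(ext_lin (theta_lin _ _)); [|exact: right_utrunc|exact: left_utrunc].
rewrite scalerBr scalerA [X in _ = _ - X *: _]mulrC -scalerA.
rewrite -[X in _ = X - _]extZ; last exact: left_utrunc.
rewrite -[X in _ = _ - _ *: X]extZ; last exact: right_utrunc.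
congr (_ - _ *: _); apply: eq_ext => q s.
  by rewrite theta_Z IH.
rewrite -theta_cons IH theta_cons theta_Z (linPZ (vop_linr _ _ _ _ _)).
by rewrite -theta_swap.
Qed.

Lemma theta_vop1 c v p w : th c (Yv v p w) = Yv (th c v) p (th c w).
Proof. by have := theta_vop c v [::] p w; rewrite !theta_nil. Qed.

Lemma Sq_D_comm : S_D_comm Yv vac Sq.
Proof.
move=> a b phi psi n; rewrite !pair2_Sq.
have -> : (n + 1)%:~R * (tw (fun x y => phi x * psi y) a b * const1 (n + 1)) = 0.
  have [->|ne] := eqVneq (n + 1) 0; first by rewrite mul0r.
  by rewrite const1_neq // !mulr0.
rewrite oppr0 /Sq big_map /= /tw mulr_suml -sumrB big1 // => e _.
by rewrite /Dop theta_vop1 theta_vac subrr.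
Qed.

Lemma Sq_hexagon : S_hexagon Yv Sq.
Proof.
move=> a b c phi psi al be; rewrite pair2_Sq /tw {1}/Sq big_map /= mulr_suml.
have h : forall e, mono ZV vac e.1 e.2 ->
  phi (th e.1 (Yv a (- al - 1) b)) * psi e.2 * const1 be =
  \sum_(e2 <- Sq b e.2) psi e2.1.2 * fsumn (fun k => fsum (fun r =>
    phi (Yv (th e.1 a) (k%:Z - al - 1) e2.1.1) * const1 r * binz r k * e2.2 (be - (r - k%:Z)))).
  move=> e he; pose F x y := phi (Yv (th e.1 a) (- al - 1) x) * psi y.
  have bF : bilform F.
    split=> z k x y; rewrite /F; last by rewrite linearP /= mulrDr mulrCA.
    by rewrite vop_linr linearP /= mulrDl -mulrA.
  rewrite theta_vop1 -/(F _ _) -(tw_monor _ bF he) /Sq big_map /= mulr_suml.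
  apply: eq_bigr => d _; rewrite /F fsumn1.
    rewrite (@fsum_pick _ _ 0) => [|r ne]; last by rewrite const1_neq // mulr0 !mul0r.
    rewrite mulr1 binz_0 mulr1 !subr0 sub0r mulrA; apply: congr2 => //.
    by rewrite mulrC.
  move=> j; rewrite (@fsum_pick _ _ 0) => [|r ne]; last by rewrite const1_neq // mulr0 !mul0r.
  by rewrite binzE0 mulr0 mul0r.
by elim: (dec_mono c) => [|e L he _ IH]; rewrite ?big_nil // !big_cons IH h.
Qed.

Lemma jacobi_sum u v w s p m :
  ext (lprod Yv u v w) s p m -
  \sum_(e <- dec u) sgn m *: ext (rprod Yv e.2 (th e.1 v) w) p s m =
  iter_ext (iprod Yv Yv u v w) s p m.
Proof.
rewrite -{1 3}(dec_sum u); elim: (dec_mono u) => [|[c a] L /= ha _ IH].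
  rewrite !big_nil subr0 ext_zero => [|x y]; last by rewrite /lprod (linP0 (vop_linl _ _ _ _ _)).
  rewrite /iter_ext fsumn0 // => j.
  by rewrite /iprod (linP0 (vop_linl _ _ _ _ _)) (linP0 (vop_linl _ _ _ _ _)) scaler0.
rewrite !big_cons /=; move: (\sum_(j <- L) j.2) IH => u' IH.
have l1 := lprod_utrunc blin trn a v w; have l2 := lprod_utrunc blin trn u' v w.
have [K hK] := iprod_trunc trn blin a v w; have [K' hK'] := iprod_trunc trn blin u' v w.
rewrite (@eq_ext _ (lprod Yv (a + u') v w) (fun s p => lprod Yv a v w s p + lprod Yv u' v w s p));
  last by move=> x y; rewrite /lprod (linPD (vop_linl _ _ _ _ _)).
have e : ext (lprod Yv a v w) s p m - sgn m *: ext (rprod Yv a (th c v) w) p s m =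
  iter_ext (iprod Yv Yv a v w) s p m := jacobi_mono univ _ _ ha v w s p m.
rewrite extD // opprD addrACA IH e.
rewrite -(iter_extD (K := Num.max K K')).
- by apply: eq_iter_ext => x y; rewrite /iprod !(linPD (vop_linl _ _ _ _ _)).
- by move=> x y le; rewrite hK //; lia.
by move=> x y le; rewrite hK' //; lia.
Qed.

Lemma Sq_Jacobi : S_Jacobi Yv Sq.
Proof.
move=> u v w a b c; pose s := - b - 1; pose p := - c - 1; pose m := - a - 1.
transitivity (ext (lprod Yv u v w) s p m -
  \sum_(e <- dec u) sgn m *: ext (rprod Yv e.2 (th e.1 v) w) p s m); last first.
  rewrite jacobi_sum; apply: eq_fsumn => j; rewrite /iprod /s /p /m.
  have -> : b + j%:Z = (b + 1) - 1 + j%:Z by lia.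
  rewrite binz_neg; have -> : - (b + 1) = - b - 1 by lia.
  by idx.
congr (_ - _); first by apply: eq_fsumn => j; rewrite /YY /lprod /s /p /m; idx.
rewrite /Sq big_map; apply: eq_bigr => e _ /=.
rewrite /ext scale_fsumn; last exact: ext_sfin (rprod_utrunc blin trn _ _ _).
apply: eq_fsumn => j; rewrite (@fsum_pick _ _ 0) => [|r ne]; last first.
  by rewrite const1_neq // !mul0r scale0r.
rewrite /const1 eqxx sgn0 !mul1r /rprod /YYop scalerA mulrA.
have -> : 0 - a - 1 = m by rewrite /m; lia.
by rewrite -!mulrA /s /p /m; idx.
Qed.

Lemma mul_f21_const1 (G : int -> int -> V) s t : mul_f21 const1 G s t = G s t.
Proof.
rewrite /mul_f21 fsumn1 => [|j]; rewrite (@fsum_pick _ _ 0).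
- by rewrite /const1 eqxx binz_0 sgn0 !mulr1 scale1r !subr0.
- by move=> r ne; rewrite const1_neq // !mul0r scale0r.
- by rewrite binzE0 mulr0 mul0r scale0r.
by move=> r ne; rewrite const1_neq // !mul0r scale0r.
Qed.

Lemma mul_diff_pow_l k u v w s t :
  mul_diff_pow k (YY Yv u v w) s t = ext (lprod Yv u v w) (- s - 1) (- t - 1) k.
Proof.
rewrite /ext (@fsumnE _ _ k.+1) => [|j lt]; last by rewrite binz_small // mul0r scale0r.
by apply: eq_bigr => j _; rewrite /YY /lprod; have := ltn_ord j; idx.
Qed.

Lemma mul_diff_pow_r k u v w s t :
  mul_diff_pow k (YYop Yv v u w) s t =
  sgn k *: ext (rprod Yv u v w) (- t - 1) (- s - 1) k.
Proof.
rewrite /ext (@fsumnE _ _ k.+1) => [|j lt]; last by rewrite binz_small // mul0r scale0r.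
rewrite scaler_sumr [RHS](reindex_inj rev_ord_inj) /=.
apply: eq_bigr => j _; have := ltn_ord j => lt.
rewrite subSS scalerA mulrCA binz_sub; last by lia.
have -> : sgn k * sgn (k - j)%N = sgn j.
  have -> : sgn k = sgn (k - j)%N * sgn j by rewrite -sgnD; congr sgn; lia.
  by rewrite mulrAC sgnM mul1r.
by rewrite /YYop /rprod; idx.
Qed.

Lemma vop_weak_QVA : weak_QVA Yv vac.
Proof.
split; first exact: vop_nonlocal.
(* From the power [K] of [x1 - x2] on, the iterate drops out of the Jacobi identity, since
   [u_n v = 0] for [K <= n]. *)
move=> u v; have [K hK] := trn u v; exists (Sq v u), `|K|%N; split.
  by case: Sq_linear.
move=> w s t; rewrite mul_diff_pow_l.
have := jacobi_sum u v w (- s - 1) (- t - 1) `|K|%N.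
rewrite (@iter_ext_trunc _ K); last 2 first.
- by move=> x y le; rewrite /iprod hK // (linP0 (vop_linl _ _ _ _ _)).
- by lia.
move/eqP; rewrite subr_eq0 => /eqP ->.
rewrite /mul_diff_pow (eq_bigr (fun e => mul_diff_pow `|K| (YYop Yv (th e.1 v) e.2 w) s t));
  last by move=> e _; rewrite mul_diff_pow_r.
rewrite /mul_diff_pow exchange_big; apply: eq_bigr => j _; rewrite -scaler_sumr.
congr (_ *: _); rewrite /Sq big_map; apply: eq_bigr => e _ /=.
by rewrite mul_f21_const1.
Qed.

Lemma vop_QVA : QVA Yv vac Sq.
Proof.
split; [exact: vop_weak_QVA| |exact: Sq_Jacobi|exact: Sq_D_comm|exact: Sq_hexagon].
by split; [exact: Sq_linear|exact: Sq_unitary|exact: Sq_YBE].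
Qed.

End Quantum.

(** * Fock space and irreducibility *)

Section Fock.
Variable D : qdata.

(* The letter [(a, m)] stands for the annihilation mode [(a, m)], or for the creation mode
   [(a, -m-1)].  A vector [v] is recorded by the vacuum coefficients of all words of
   annihilation modes applied to [v]. *)
Definition letter : Type := (D * nat)%type.
Definition fock : lmodType C := (seq letter -> C^o).

Definition kapl (x y : letter) : C := kap x.1 y.1 * (x.2 == y.2)%:R.

(** Vacuum coefficient of the word [s] applied after the creation mode [y]: each annihilation letter
    is moved past [y] at the cost of a contact term, and a creation mode that ends up leftmost
    contributes [0]. *)
Fixpoint create (y : letter) (s : seq letter) (phi : fock) : C :=
  if s is x :: s' then
    kapl x y * phi s' + qf x.1 y.1 * create y s' (fun t => phi (x :: t))
  else 0.

Definition fock_act (a : D) (n : int) (phi : fock) : fock :=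
  match n with
  | Posz m => fun s => phi ((a, m) :: s)
  | Negz m => fun s => create (a, m) s phi
  end.

(** The exchange relations among annihilation modes. The head of a word is the mode applied first,
    whence the order of the arguments of [qf]. *)
Definition qsym (phi : fock) : Prop :=
  forall s x y t, phi (s ++ y :: x :: t) = qf x.1 y.1 * phi (s ++ x :: y :: t).

Definition fock_vac : fock := fun s => (s == [::])%:R.

Lemma fockE k (phi psi : fock) s : (k *: phi + psi) s = k * phi s + psi s.
Proof. by []. Qed.

Lemma create_nil y phi : create y [::] phi = 0. Proof. by []. Qed.

Lemma create_cons y x s phi : create y (x :: s) phi =
  kapl x y * phi s + qf x.1 y.1 * create y s (fun t => phi (x :: t)).
Proof. by []. Qed.

Lemma create_lin y s k (phi psi : fock) :
  create y s (k *: phi + psi) = k * create y s phi + create y s psi.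
Proof.
elim: s phi psi => [|x s IH] phi psi; first by rewrite !create_nil mulr0 addr0.
rewrite !create_cons.
have -> : (fun t => (k *: phi + psi) (x :: t)) =
  k *: (fun t => phi (x :: t) : C^o) + (fun t => psi (x :: t)) by [].
rewrite IH fockE; set u := create _ _ _; set v := create _ _ _.
have E (R : comRingType) (a b c d e f g : R) :
  a * (b * c + d) + e * (b * f + g) = b * (a * c + e * f) + (a * d + e * g) by ring.
exact: E.
Qed.

Lemma create0 y s phi : (forall t, phi t = 0) -> create y s phi = 0.
Proof.
elim: s phi => [//|x s IH] phi h.
by rewrite create_cons h mulr0 add0r IH ?mulr0.
Qed.

Lemma kapl0P x y : kapl x y = 0 \/ forall c : D, qf x.1 c * qf y.1 c = 1.
Proof.
have [e|h] := eqVneq (kap x.1 y.1) 0; first by left; rewrite /kapl e mul0r.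
by right=> c; apply: kap_qf.
Qed.

Lemma qf_exch (a b c : D) : qf a c * qf b c = 1 -> qf a c = qf c b.
Proof.
by move=> h; have := congr1 (fun x => x * qf c b) h; rewrite mul1r -mulrA qfV mulr1.
Qed.

(** Letters with a nonzero contraction have inverse exchange factors, which makes the coefficients
    of the singly contracted terms agree. *)
Lemma create_comm x y s (phi : fock) :
  create x s (fun t => create y t phi) = qf x.1 y.1 * create y s (fun t => create x t phi).
Proof.
elim: s phi => [|z s IH] phi; first by rewrite !create_nil mulr0.
rewrite !create_cons.
have E u v : (fun t => create u (z :: t) v) =
  kapl z u *: v + qf z.1 u.1 *: (fun t => create u t (fun t => v (z :: t)) : C^o) by [].
have cl u k l (f g : fock) : create u s (k *: f + l *: g) =
    k * create u s f + l * create u s g.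
  have := create_lin u s l g 0; rewrite addr0 (@create0 u s 0) // addr0 => <-.
  exact: create_lin.
rewrite !E !cl IH.
have ring1 (R : comRingType) (a b q zx zy A B F : R) :
    q * zy * a = a -> q * b = zx * b -> a * A + zx * (b * B + zy * (q * F)) =
    q * (b * B + zy * (a * A + zx * F)).
  by move=> h1 h2; rewrite !mulrDr !mulrA h1 h2; ring.
apply: ring1.
  have [->|h] := kapl0P z x; first by rewrite mulr0.
  have -> : qf z.1 y.1 = qf y.1 x.1 by apply: qf_exch.
  by rewrite qfV mul1r.
have [->|h] := kapl0P z y; first by rewrite !mulr0.
by congr (_ * _); apply/esym/qf_exch.
Qed.

Lemma qsym_subspace : subspace qsym.
Proof.
split=> [s x y t|k phi psi h h' s x y t]; first by rewrite mulr0.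
by rewrite !fockE h h' mulrDr mulrCA.
Qed.

Lemma qsym_shift z phi : qsym phi -> qsym (fun t => phi (z :: t)).
Proof. by move=> h s x y t; apply: (h (z :: s)). Qed.

Lemma qsym_create z phi : qsym phi -> qsym (fun s => create z s phi).
Proof.
move=> h s; elim: s phi h => [|w s IH] phi h x y t; last first.
  rewrite !cat_cons !create_cons h (IH _ (qsym_shift w h)).
  by rewrite mulrDr; congr (_ + _); rewrite mulrCA.
rewrite !cat0s !create_cons.
have -> : (fun t => phi [:: y, x & t]) =
    qf x.1 y.1 *: (fun t => phi [:: x, y & t] : C^o) :> fock.
  by apply/funext => u; rewrite (h [::]).
have -> : create z t (qf x.1 y.1 *: (fun t => phi [:: x, y & t] : C^o)) =
    qf x.1 y.1 * create z t (fun t => phi [:: x, y & t]).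
  have := create_lin z t (qf x.1 y.1) (fun t => phi [:: x, y & t]) 0.
  by rewrite addr0 (@create0 z t 0) // addr0 => <-.
have ring2 (R : comRingType) (a b q yz xz A B F : R) :
    q * xz * a = a -> q * b = yz * b -> a * A + yz * (b * B + xz * (q * F)) =
    q * (b * B + xz * (a * A + yz * F)).
  by move=> h1 h2; rewrite !mulrDr !mulrA h1 h2; ring.
apply: ring2.
  have [->|k] := kapl0P y z; first by rewrite mulr0.
  have -> : qf x.1 z.1 = qf y.1 x.1 by have := k x.1 => /(congr1 (fun u => qf x.1 z.1 * u));
    rewrite mulr1 mulrCA qfV mulr1.
  by rewrite qfV mul1r.
have [->|k] := kapl0P x z; first by rewrite !mulr0.
congr (_ * _); have := k y.1 => /(congr1 (fun u => qf y.1 z.1 * u)).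
by rewrite mulr1 mulrCA qfV mulr1.
Qed.

Lemma fock_act_rel a b m n phi : qsym phi -> fock_act a m (fock_act b n phi) =
  qf a b *: fock_act b n (fock_act a m phi) + (kap a b * (m + n + 1 == 0)%:R) *: phi.
Proof.
move=> h; apply/funext => s; rewrite fockE.
have -> : ((kap a b * (m + n + 1 == 0)%:R) *: phi) s =
  kap a b * (m + n + 1 == 0)%:R * phi s by [].
case: m n => m [] n.
- rewrite (_ : (_ == 0) = false); last by lia.
  by rewrite mulr0 mul0r addr0 /fock_act (h [::]).
- rewrite [LHS]create_cons [LHS]addrC; apply: congr2 => //; apply: congr2 => //.
  by rewrite /kapl (_ : (m%:Z + Negz n + 1 == 0) = (m == n)) //; lia.
- have -> : fock_act b n (fock_act a (Negz m) phi) s =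
    kapl (b, n) (a, m) * phi s + qf b a * create (a, m) s (fun t => phi ((b, n) :: t)) by [].
  have -> : (Negz m + n%:Z + 1 == 0) = (n == m) by lia.
  rewrite /kapl kapC; set d := (n == m)%:R; rewrite -/d.
  have ring3 (R : comRingType) (q q' k e A B : R) : q * q' = 1 ->
      B = q * (- (q' * k) * e * A + q' * B) + k * e * A.
    move=> h3; rewrite mulrDr [q * (q' * B)]mulrA h3 mul1r addrAC.
    rewrite !mulrA mulrN mulrA h3 mul1r; ring.
  exact: (ring3 C _ _ _ _ _ _ (qfV a b)).
rewrite (_ : (_ == 0) = false); last by lia.
rewrite mulr0 mul0r addr0; exact: create_comm.
Qed.

(** * Vacuum coefficients and degree components in [V] *)

Section Rep.
Variables (V : lmodType C) (ZV : D -> int -> V -> V) (vac : V).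
Hypothesis univ : universal ZV vac.

Let hq := univ_qmodule univ.
Let Zrel := hq.2.
Let Zvac : vaclike ZV vac. Proof. by case: univ. Qed.

Lemma fockmap_ex : exists f : V -> fock,
  [/\ linear f, f vac = fock_vac & forall a n v, f (ZV a n v) = fock_act a n (f v)].
Proof.
have [||||||f [f1 f2 f3 _]] := universal_hom univ (P := qsym) (act := fock_act)
  (w := fock_vac).
- exact: qsym_subspace.
- by move=> a [] n phi h; [apply: qsym_shift|apply: qsym_create].
- move=> a [] n k x y _ _ //; apply/funext => s; exact: create_lin.
- exact: fock_act_rel.
- by move=> [|z s] x y t; rewrite /fock_vac /= mulr0.
- by move=> a [] n // _; apply/funext => s.
by exists f.
Qed.

Definition fockmap : V -> fock := proj1_sig (cid fockmap_ex).

Lemma fockmap_lin : linear fockmap.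
Proof. by rewrite /fockmap; case: cid => f []. Qed.
Lemma fockmap_vac : fockmap vac = fock_vac.
Proof. by rewrite /fockmap; case: cid => f []. Qed.
Lemma fockmap_Z a n v : fockmap (ZV a n v) = fock_act a n (fockmap v).
Proof. by rewrite /fockmap; case: cid => f []. Qed.

Lemma fockmap_cons a (m : nat) v s : fockmap v ((a, m) :: s) = fockmap (ZV a m v) s.
Proof. by rewrite fockmap_Z. Qed.

Lemma fockmap_linE s : linear (fun v => fockmap v s : C^o).
Proof. by move=> k x y; rewrite fockmap_lin. Qed.

Lemma vac_neq0 : vac != 0.
Proof.
apply/eqP => e; have := congr1 (fun v => fockmap v [::]) e.
rewrite fockmap_vac (linP0 fockmap_lin) => h.
have /eqP : (1 : C) = 0 := h.
by rewrite oner_eq0.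
Qed.

Lemma barK a : bar (bar a) = a :> D.
Proof.
apply/esym/bar_kap; rewrite kapC oppr_eq0 mulf_neq0 ?qf_neq0 //; exact: kap_bar.
Qed.

Lemma kap_other (a b : D) : a != bar b -> kap a b = 0.
Proof.
move=> h; apply/eqP; apply: contraNT h => h.
by rewrite (bar_kap h) barK.
Qed.

(* The component of degree [k] of [v], recovered from its vacuum coefficients: by the Euler
   identity the number operator is [\sum_(a, m) (kap a (bar a))^-1 (bar a)_(-m-1) a_m]. *)
Fixpoint taylor (M k : nat) (v : V) : V :=
  if k is k'.+1 then
    (k'.+1)%:R^-1 *: \sum_(x : D) \sum_(m < M)
      (kap x (bar x))^-1 *: ZV (bar x) (Negz m) (taylor M k' (ZV x m v))
  else fockmap v [::] *: vac.

Lemma taylorS M k v : taylor M k.+1 v = (k.+1)%:R^-1 *: \sum_(x : D) \sum_(m < M)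
  (kap x (bar x))^-1 *: ZV (bar x) (Negz m) (taylor M k (ZV x m v)).
Proof. by []. Qed.

Lemma taylor_sum M k v : \sum_(x : D) \sum_(m < M)
  (kap x (bar x))^-1 *: ZV (bar x) (Negz m) (taylor M k (ZV x m v)) =
  (k.+1)%:R *: taylor M k.+1 v.
Proof. by rewrite taylorS scalerA divff ?scale1r // pnatr_eq0. Qed.

Lemma taylor_lin M k : linear (taylor M k).
Proof.
elim: k => [|k IH] c x y.
  by rewrite /= fockmap_linE scalerDl scalerA.
rewrite !taylorS scalerA mulrC -scalerA -scalerDr; congr (_ *: _).
rewrite scaler_sumr -big_split; apply: eq_bigr => a _ /=.
rewrite scaler_sumr -big_split; apply: eq_bigr => m _ /=.
by rewrite (Zlin hq) IH (Zlin hq) scalerDr !scalerA mulrC.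
Qed.

Lemma sum_pick2 (M : nat) (F : D -> 'I_M -> V) (b : D) (n : 'I_M) :
  (forall x m, (x, m) != (b, n) -> F x m = 0) -> \sum_(x : D) \sum_(m < M) F x m = F b n.
Proof.
move=> h; rewrite (bigD1 b) //= [X in _ + X]big1 => [|x ne]; last first.
  by rewrite big1 // => m _; apply: h; rewrite xpair_eqE (negbTE ne).
rewrite addr0 (bigD1 n) //= big1 ?addr0 // => m ne.
by apply: h; rewrite xpair_eqE (negbTE ne) andbF.
Qed.

Lemma natC_neq0 k : (k.+1)%:R != 0 :> C. Proof. by rewrite pnatr_eq0. Qed.

Lemma taylor0_up M b (n : nat) v : taylor M 0 (ZV b (Negz n) v) = 0.
Proof. by rewrite /taylor fockmap_Z scale0r. Qed.

Lemma Zlin2 a n (M : nat) (c : D -> 'I_M -> C) (F : D -> 'I_M -> V) :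
  ZV a n (\sum_(x : D) \sum_(m < M) c x m *: F x m) =
  \sum_(x : D) \sum_(m < M) c x m *: ZV a n (F x m).
Proof.
rewrite (linP_sum (Zlin hq a n)); apply: eq_bigr => x _.
rewrite (linP_sum (Zlin hq a n)); apply: eq_bigr => m _.
exact: (linPZ (Zlin hq a n)).
Qed.

Lemma sum2D (M : nat) (F G : D -> 'I_M -> V) :
  \sum_(x : D) \sum_(m < M) (F x m + G x m) =
  \sum_(x : D) \sum_(m < M) F x m + \sum_(x : D) \sum_(m < M) G x m.
Proof. by rewrite -big_split; apply: eq_bigr => x _; rewrite big_split. Qed.

Lemma eq_sum2 (M : nat) (F G : D -> 'I_M -> V) : (forall x m, F x m = G x m) ->
  \sum_(x : D) \sum_(m < M) F x m = \sum_(x : D) \sum_(m < M) G x m.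
Proof. by move=> e; apply: eq_bigr => x _; apply: eq_bigr => m _. Qed.

(** In moving a creation mode out of the number operator, the exchange factors with [x] and [bar x]
    cancel, and the single contraction, with the letter [(bar b, n)], raises the count by one. *)
Lemma taylor_up M k b (n : nat) v : (n < M)%N ->
  taylor M k.+1 (ZV b (Negz n) v) = ZV b (Negz n) (taylor M k v).
Proof.
move=> lt.
(* The hypothesis concerns the sum without its contact term, which is the missing summand [1] of
   [k' + 1]. *)
have main k' (u : V) : \sum_(x : D) \sum_(m < M)
    (kap x (bar x))^-1 *: ZV (bar x) (Negz m) (qf x b *: taylor M k' (ZV b (Negz n) (ZV x m u)))
    = k'%:R *: ZV b (Negz n) (taylor M k' u) ->
    taylor M k'.+1 (ZV b (Negz n) u) = ZV b (Negz n) (taylor M k' u).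
  move=> h; apply: (scalerI (natC_neq0 k')); rewrite -taylor_sum.
  rewrite (@eq_sum2 _ _ (fun x m =>
    (kap x (bar x))^-1 *: ZV (bar x) (Negz m) (qf x b *: taylor M k' (ZV b (Negz n) (ZV x m u)))
    + (kap x (bar x))^-1 *: ZV (bar x) (Negz m)
        ((kap x b * (m%:Z + Negz n + 1 == 0)%:R) *: taylor M k' u))); last first.
    move=> x m; rewrite Zrel taylor_lin (linPZ (taylor_lin M k')).
    by rewrite (linPD (Zlin hq _ _)) scalerDr.
  rewrite sum2D h (@sum_pick2 _ _ (bar b) (Ordinal lt)) => [|x m ne].
    rewrite /= barK (linPZ (Zlin hq _ _)) scalerA.
    rewrite (_ : (n%:Z + Negz n + 1 == 0) = true); last by lia.
    rewrite mulr1 mulVf; last by rewrite -{2}(barK b); apply: kap_bar.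
    by rewrite -scalerDl -natr1.
  rewrite (linPZ (Zlin hq _ _)) scalerA.
  have [e|ne'] := eqVneq x (bar b); last by rewrite (kap_other ne') mul0r mulr0 scale0r.
  rewrite (_ : (_ == 0) = false) ?mulr0 ?scale0r //.
  by move: ne; rewrite e xpair_eqE eqxx /= -val_eqE /=; lia.
elim: k v => [|k IH] v; apply: main.
  rewrite scale0r big1 // => x _; rewrite big1 // => m _.
  by rewrite taylor0_up scaler0 (linP0 (Zlin hq _ _)) scaler0.
rewrite (@eq_sum2 _ _ (fun x m => (kap x (bar x))^-1 *:
    ZV b (Negz n) (ZV (bar x) (Negz m) (taylor M k (ZV x m v))))); last first.
  move=> x m; rewrite IH (linPZ (Zlin hq _ _)) Zrel (_ : (_ == 0) = false); last by lia.
  by rewrite mulr0 scale0r addr0 !scalerA -mulrA (kap_qf b (kap_bar x)) mulr1.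
by rewrite -Zlin2 taylor_sum (linPZ (Zlin hq _ _)).
Qed.

Lemma qf_barr (a b : D) : qf a b * qf a (bar b) = 1.
Proof.
have := kap_qf a (kap_bar b) => /(congr1 (fun u => (qf a b * qf a (bar b)) * u)).
by rewrite mulr1 mulrACA !qfV mulr1.
Qed.

Lemma taylor0_dn M b (n : nat) v : ZV b n (taylor M 0 v) = 0.
Proof. by rewrite /taylor (linPZ (Zlin hq _ _)) Zvac ?scaler0. Qed.

Lemma taylor_dn M k b (n : nat) v : (n < M)%N ->
  ZV b n (taylor M k.+1 v) = taylor M k (ZV b n v).
Proof.
move=> lt.
have main k' (u : V) : \sum_(x : D) \sum_(m < M)
    (kap x (bar x))^-1 *: (qf b (bar x) *: ZV (bar x) (Negz m) (ZV b n (taylor M k' (ZV x m u))))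
    = k'%:R *: taylor M k' (ZV b n u) ->
    ZV b n (taylor M k'.+1 u) = taylor M k' (ZV b n u).
  move=> h; apply: (scalerI (natC_neq0 k')).
  rewrite -(linPZ (Zlin hq _ _)) -taylor_sum Zlin2.
  rewrite (@eq_sum2 _ _ (fun x m =>
    (kap x (bar x))^-1 *: (qf b (bar x) *: ZV (bar x) (Negz m) (ZV b n (taylor M k' (ZV x m u))))
    + (kap x (bar x))^-1 *: ((kap b (bar x) * (n%:Z + Negz m + 1 == 0)%:R) *:
        taylor M k' (ZV x m u)))); last by move=> x m; rewrite Zrel scalerDr.
  rewrite sum2D h (@sum_pick2 _ _ b (Ordinal lt)) => [|x m ne].
    rewrite /= scalerA (_ : (n%:Z + Negz n + 1 == 0) = true); last by lia.
    by rewrite mulr1 mulVf ?kap_bar // -scalerDl -natr1.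
  rewrite scalerA.
  have [e|ne'] := eqVneq x b; last first.
    by rewrite (@kap_other b (bar x)) ?mul0r ?mulr0 ?scale0r // barK eq_sym.
  rewrite (_ : (_ == 0) = false) ?mulr0 ?scale0r //.
  by move: ne; rewrite e xpair_eqE eqxx /= -val_eqE /=; lia.
elim: k v => [|k IH] v; apply: main.
  rewrite scale0r big1 // => x _; rewrite big1 // => m _.
  by rewrite taylor0_dn (linP0 (Zlin hq _ _)) !scaler0.
rewrite -taylor_sum; apply: eq_sum2 => x m; congr (_ *: _).
rewrite IH Zrel (_ : (_ == 0) = false); last by lia.
rewrite mulr0 scale0r addr0 (linPZ (taylor_lin M k)) (linPZ (Zlin hq _ _)) scalerA.
by rewrite mulrC qf_barr scale1r.
Qed.

Lemma taylor_vac M k : taylor M k vac = if k == 0%N then vac else 0.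
Proof.
case: k => [|k]; first by rewrite /taylor fockmap_vac /fock_vac /= scale1r.
rewrite taylorS big1 ?scaler0 // => x _; rewrite big1 // => m _.
by rewrite Zvac // (linP0 (taylor_lin M k)) (linP0 (Zlin hq _ _)) scaler0.
Qed.

(** Creation modes shift the components up and annihilation modes shift them down; [M] has to exceed
    the mode numbers used to build [v]. *)
Lemma taylorP v : exists N0 : nat, forall N M : nat, (N0 <= N)%N -> (N0 <= M)%N ->
  v = \sum_(k < N) taylor M k v.
Proof.
move: v; apply: (universal_ind univ (P := fun v => exists N0 : nat, forall N M : nat,
  (N0 <= N)%N -> (N0 <= M)%N -> v = \sum_(k < N) taylor M k v)).
- split.
    by exists 0%N => N M _ _; rewrite big1 // => k _; rewrite (linP0 (taylor_lin M k)).
  move=> c x y [N1 h1] [N2 h2]; exists (N1 + N2)%N => N M l1 l2.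
  have e1 : x = \sum_(k < N) taylor M k x by apply: h1; lia.
  have e2 : y = \sum_(k < N) taylor M k y by apply: h2; lia.
  rewrite [in LHS]e1 [in LHS]e2 scaler_sumr -big_split; apply: eq_bigr => k _.
  by rewrite (taylor_lin M k).
- exists 1%N => -[//|N] M _ _; rewrite big_ord_recl taylor_vac big1 ?addr0 // => k _.
  by rewrite taylor_vac.
move=> b [] n v [N0 h]; exists (N0 + n).+1 => N M l1 l2.
  have e : v = \sum_(k < N.+1) taylor M k v by apply: h; lia.
  rewrite [in LHS]e (linP_sum (Zlin hq _ _)) big_ord_recl taylor0_dn add0r.
  by apply: eq_bigr => k _; rewrite lift0 taylor_dn //; lia.
case: N l1 => // N l1; have e : v = \sum_(k < N) taylor M k v by apply: h; lia.
rewrite [in LHS]e (linP_sum (Zlin hq _ _)) big_ord_recl taylor0_up add0r.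
by apply: eq_bigr => k _; rewrite lift0 taylor_up //; lia.
Qed.

Lemma create_size y K s (phi : fock) : (forall t, (K <= size t)%N -> phi t = 0) ->
  (K < size s)%N -> create y s phi = 0.
Proof.
elim: s K phi => [//|x s IH] K phi h lt; rewrite create_cons h // mulr0 add0r.
case: K h lt => [|K] h lt; first by rewrite create0 ?mulr0 // => t; apply: h.
by rewrite (IH K) ?mulr0 // => t le; apply: h.
Qed.

Lemma fockmap_size v : exists K : nat, forall s, (K <= size s)%N -> fockmap v s = 0.
Proof.
move: v; apply: (universal_ind univ
  (P := fun v => exists K : nat, forall s, (K <= size s)%N -> fockmap v s = 0)).
- split; first by exists 0%N => s _; rewrite (linP0 fockmap_lin).
  move=> c x y [K1 h1] [K2 h2]; exists (maxn K1 K2) => s; rewrite geq_max => /andP[l1 l2].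
  by rewrite fockmap_linE h1 // h2 // scaler0 addr0.
- by exists 1%N => -[|x s] // _; rewrite fockmap_vac.
move=> a [] n v [K h]; exists K.+1 => s le; rewrite fockmap_Z /fock_act.
  by apply: h => /=; lia.
exact: (create_size _ h).
Qed.

Lemma taylor_eq0 M k v : (forall s, fockmap v s = 0) -> taylor M k v = 0.
Proof.
elim: k v => [|k IH] v h; first by rewrite /taylor h scale0r.
rewrite taylorS big1 ?scaler0 // => x _; rewrite big1 // => m _.
by rewrite IH ?(linP0 (Zlin hq _ _)) ?scaler0 // => s; rewrite -fockmap_cons h.
Qed.

Lemma fockmap_inj v : (forall s, fockmap v s = 0) -> v = 0.
Proof.
move=> h; have [N hN] := taylorP v; rewrite (hN N N) //.
by rewrite big1 // => k _; apply: taylor_eq0.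
Qed.

(** Each annihilation mode shortens the words with nonzero coefficient, so a nonzero element of [P]
    killed by all of them is reached. Its components of positive degree vanish, and it is a multiple
    of [vac]. *)
Lemma submodule_full (P : V -> Prop) : subspace P -> (forall a n w, P w -> P (ZV a n w)) ->
  (forall w, P w -> w = 0) \/ (forall w, P w).
Proof.
move=> hP hcl; have [h|h] := pselect (forall w, P w -> w = 0); [by left|right].
suff Pvac : P vac by apply: (universal_ind univ).
have [w [Pw w0]] : exists w, P w /\ w <> 0.
  apply: contrapT => k; apply: h => w Pw; apply: contrapT => w0; apply: k.
  by exists w.
have [K hK] := fockmap_size w; elim: K w Pw w0 hK {h} => [|K IH] w Pw w0 hK.
  by case: w0; apply: fockmap_inj => s; apply: hK.
have [[x [m hx]]|hx] := pselect (exists x (m : nat), ZV x m w <> 0).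
  apply: (IH (ZV x m w)) => //; first exact: hcl.
  by move=> s le; rewrite -fockmap_cons hK //=.
have [N hN] := taylorP w; have e : w = fockmap w [::] *: vac.
  rewrite {1}(hN N.+1 N.+1) // big_ord_recl big1 ?addr0 // => k _.
  rewrite lift0 taylorS big1 ?scaler0 // => x _; rewrite big1 // => m _.
  have -> : ZV x m w = 0 by apply: contrapT => h; apply: hx; exists x, m.
  by rewrite (linP0 (taylor_lin _ _)) (linP0 (Zlin hq _ _)) scaler0.
have c0 : fockmap w [::] != 0.
  by apply/eqP => c0; apply: w0; rewrite e c0 scale0r.
have -> : vac = (fockmap w [::])^-1 *: w + 0.
  by rewrite addr0 [X in _ *: X]e scalerA mulVf // scale1r.
by case: hP => P0 hP; apply: hP.
Qed.

Lemma vop_irreducible : irreducible_VA (vop univ (univ_qmodule univ) (univ_smooth univ)).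
Proof.
split; first by exists vac; apply/eqP; exact: vac_neq0.
move=> P hP hcl; apply: submodule_full => // a n w Pw.
by rewrite -(vop_gen univ (univ_qmodule univ) (univ_smooth univ)); apply: hcl.
Qed.

End Rep.
End Fock.

(** * Nondegeneracy *)

Lemma fsumD (M : zmodType) (F G : int -> M) : fin_supp F -> fin_supp G ->
  fsum (fun r => F r + G r) = fsum F + fsum G.
Proof.
case=> N hN [N' hN']; rewrite !(@fsumE _ _ (N + N')) -?big_split // => n le.
- by rewrite hN' //; lia.
- by rewrite hN //; lia.
by rewrite hN ?hN' ?addr0 //; lia.
Qed.

Lemma fsum_additive (M M' : zmodType) (L : M -> M') (F : int -> M) :
  {morph L : x y / x + y} -> fin_supp F -> L (fsum F) = fsum (fun r => L (F r)).
Proof.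
move=> LD [N hN]; have L0 : L 0 = 0.
  by apply: (addrI (L 0)); rewrite -LD !addr0.
rewrite (fsumE hN) (big_morph L LD L0) (@fsumE _ _ N) // => n le.
by rewrite hN.
Qed.

Lemma fsum_seq (M : zmodType) (I : Type) (r : seq I) (F : I -> int -> M) :
  List.Forall (fun i => fin_supp (F i)) r ->
  fin_supp (fun n => \sum_(i <- r) F i n) /\
  \sum_(i <- r) fsum (F i) = fsum (fun n => \sum_(i <- r) F i n).
Proof.
elim=> [|i {}r [N hN] _ [[N' hN'] IH]].
  split; first by exists 0%N => *; rewrite big_nil.
  by rewrite big_nil (@fsumE _ _ 0) ?big_ord1 ?big_nil // => *; rewrite big_nil.
split; first by exists (N + N')%N => n lt; rewrite big_cons hN ?hN' ?addr0 //; lia.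
rewrite big_cons IH -fsumD; [|by exists N|by exists N'].
by congr fsum; apply/funext => n; rewrite big_cons.
Qed.

Lemma fsum_fsumn_exch (M : zmodType) (F : nat -> int -> M) (N : nat) :
  (forall j r, (N <= j)%N -> F j r = 0) -> (forall j r, N%:Z < `|r| -> F j r = 0) ->
  fsumn (fun j => fsum (F j)) = fsum (fun r => fsumn (fun j => F j r)).
Proof.
move=> h1 h2; rewrite (@fsumnE _ _ N) => [|j le]; last first.
  by rewrite (@fsumE _ _ N) ?big1 // => *; rewrite h1.
rewrite (eq_bigr (fun j : 'I_N => \sum_(i < (N.*2).+1) F j (i%:Z - N%:Z))) => [|j _]; last first.
  by rewrite (@fsumE _ _ N) // => r; apply: h2.
rewrite exchange_big [RHS](@fsumE _ _ N) => [|r le]; last first.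
  by rewrite fsumn0 // => j; apply: h2.
by apply: eq_bigr => i _; rewrite (@fsumnE _ _ N) // => j; apply: h1.
Qed.

(* Functions of the form [\sum_i binom(n, i) z^(n-i) A_i] with [z = x2] and [z = x1] are
   linearly independent, since [x2 - x1] acts injectively. *)
Section Independence.
Variable M : lmodType C.
Local Notation func3 := (int -> int -> int -> M).
Implicit Types A B : nat -> func3.

(** Triangularity: at [n = i] the binomial of index [j] is zero for [j > i] and one for [j = i]. *)
Lemma indep_single J B : (forall (n : int) q p k,
    \sum_(i < J) binz n i *: B i q (p + n - i%:Z) k = 0) ->
  forall i q p k, (i < J)%N -> B i q p k = 0.
Proof.
move=> h i; have [n le] := ubnP i; elim: n i le => // n IH i le q p k lt.
have := h i%:Z q p k; rewrite (bigD1 (Ordinal lt)) //= big1 => [|j ne].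
  have -> : binz i i = 1 by rewrite -[X in binz _ X]subn0 binz_sub // binz_0.
  by rewrite addr0 scale1r addrK.
case: (ltngtP j i) => c.
- by rewrite IH ?scaler0 //; lia.
- by rewrite binz_small // scale0r.
by move: ne; rewrite -val_eqE /= c eqxx.
Qed.

Lemma binz_diff (n : int) (J : nat) (F : nat -> M) :
  \sum_(i < J.+1) (binz (n + 1) i - binz n i) *: F i = \sum_(i < J) binz n i *: F i.+1.
Proof.
rewrite big_ord_recl !binz_0 subrr scale0r add0r; apply: eq_bigr => i _.
by rewrite lift0 binz_pascal addrAC subrr add0r.
Qed.

(** Multiplication by [z - x2] shortens the first sum by one and replaces the coefficients of the
    second by [B (i + 1) - (x2 - x1) B i]. These vanish by induction, and the recursion is solved
    from the top index, a shift of the exponent of [x2 - x1] being invertible. *)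
Lemma indep_pair I J A B : (forall i, pascal (A i)) -> (forall i, pascal (B i)) ->
  (forall (n : int) q p k, \sum_(i < I) binz n i *: A i (q + n - i%:Z) p k +
    \sum_(i < J) binz n i *: B i q (p + n - i%:Z) k = 0) ->
  (forall i q p k, (i < I)%N -> A i q p k = 0) /\ (forall i q p k, (i < J)%N -> B i q p k = 0).
Proof.
elim: I A B => [|I IH] A B hA hB h.
  split=> // i q p k lt; apply: (@indep_single J B _ i q p k lt) => n q' p' k'.
  by have := h n q' p' k'; rewrite big_ord0 add0r.
(* Padding by zero makes the recursion valid at the top index too. *)
pose B0 i : func3 := if (i < J)%N then B i else fun _ _ _ => 0.
pose B' i : func3 := fun q p k => B0 i.+1 q p k - B0 i q p (k + 1).
have pB0 i : pascal (B0 i).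
  by rewrite /B0; case: ifP => // _ q p k; rewrite addr0.
have pB' i : pascal (B' i).
  apply: pascalB => //; move=> q p k; exact: pB0.
have B0E i : (i < J)%N -> B i = B0 i by rewrite /B0 => ->.
have step (n : int) q p k :
    \sum_(i < I) binz n i *: A i.+1 (q + n - i%:Z) p k +
    \sum_(i < J) binz n i *: B' i q (p + n - i%:Z) k = 0.
  have e1 : \sum_(i < I.+1) binz (n + 1) i *: A i (q + (n + 1) - i%:Z) p k -
      \sum_(i < I.+1) binz n i *: A i (q + 1 + n - i%:Z) p k =
      \sum_(i < I) binz n i *: A i.+1 (q + n - i%:Z) p k.
    rewrite -sumrB; have := binz_diff n I (fun i => A i (q + (n + 1) - i%:Z) p k) => /= e.
    rewrite (eq_bigr (fun i : 'I_I.+1 =>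
      (binz (n + 1) i - binz n i) *: A i (q + (n + 1) - i%:Z) p k)).
      by rewrite e; apply: eq_bigr => i _; idx.
    by move=> i _; rewrite scalerBl; congr (_ - _); idx.
  have e2 : \sum_(i < J) binz (n + 1) i *: B i q (p + (n + 1) - i%:Z) k -
      \sum_(i < J) binz n i *: B i (q + 1) (p + n - i%:Z) k =
      \sum_(i < J) binz n i *: B' i q (p + n - i%:Z) k.
    have := binz_diff n J (fun i => B0 i q (p + (n + 1) - i%:Z) k) => /= e.
    rewrite [RHS](eq_bigr (fun i : 'I_J =>
      binz n i *: B0 i.+1 q (p + (n + 1) - i.+1%:Z) k -
      binz n i *: B0 i q (p + n - i%:Z) (k + 1))); last first.
      by move=> i _; rewrite scalerBr; congr (_ - _); idx.
    rewrite sumrB -e big_ord_recr /= [B0 J](_ : _ = fun _ _ _ => 0); last first.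
      by rewrite /B0 ltnn.
    rewrite scaler0 addr0 -!sumrB; apply: eq_bigr => i _.
    rewrite B0E // pB0 scalerDr opprD scalerBl -!addrA; congr (_ + _).
    by rewrite addrA; congr (- _ - _); idx.
  rewrite -e1 -e2 addrACA -opprD.
  by have := h (n + 1) q p k; have := h n (q + 1) p k => -> ->; rewrite subrr.
have [hA' hB'] := IH (fun i => A i.+1) B' (fun i => hA i.+1) pB' step.
have hB0 i q p k : B0 i q p k = 0.
  suff H n : forall i q p k, (J <= i + n)%N -> B0 i q p k = 0 by apply: (H J); lia.
  elim: n => [|n IHn] {}i {}q {}p {}k le; first by rewrite /B0; case: ifP => //; lia.
  case: (ltnP i J) => lt; last by rewrite /B0 ltnNge lt.
  have := hB' i q p (k - 1) lt; rewrite /B' subrK IHn ?sub0r; last by lia.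
  by move/eqP; rewrite oppr_eq0 => /eqP.
split=> [[|i] q p k lt|i q p k lt]; first 1 last.
- exact: hA'.
- by rewrite B0E.
have := h 0 q p k; rewrite big_ord_recl binz_0 scale1r addr0 subr0.
rewrite big1 => [|i _]; last by rewrite lift0 hA' ?scaler0.
by rewrite addr0 big1 ?addr0 // => i _; rewrite B0E // hB0 scaler0.
Qed.

End Independence.

Lemma ext_shiftl_int (M : lmodType C) (f : int -> int -> M) (k s p m : int) :
  ext f (s + k) p m = ext (fun s p => f (s + k) p) s p m.
Proof. by apply: eq_fsumn => j; idx. Qed.

Lemma ext_shiftr_int (M : lmodType C) (f : int -> int -> M) (k s p m : int) :
  ext f s (p + k) m = ext (fun s p => f s (p + k)) s p m.
Proof. by apply: eq_fsumn => j; idx. Qed.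

Lemma ext_sum (M : lmodType C) (n : nat) (f : 'I_n -> int -> int -> M) (s p m : int) :
  (forall i, utrunc (f i)) ->
  utrunc (fun s p => \sum_(i < n) f i s p) /\
  ext (fun s p => \sum_(i < n) f i s p) s p m = \sum_(i < n) ext (f i) s p m.
Proof.
elim: n f => [|n IH] f h.
  split; first by exists 0 => *; rewrite big_ord0.
  by rewrite big_ord0 ext_zero // => *; rewrite big_ord0.
have [u e] := IH (fun i => f (lift ord0 i)) (fun i => h _).
split.
  have [K hK] := utruncD (h ord0) u.
  by exists K => x y le; rewrite big_ord_recl hK.
rewrite big_ord_recl -e -extD //; apply: eq_ext => x y; by rewrite big_ord_recl.
Qed.

(** * Tensors annihilated by products of two vertex operators *)

Section Nondegenerate.
Variables (D : qdata) (V : lmodType C) (ZV : D -> int -> V -> V) (vac : V).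
Hypothesis univ : universal ZV vac.
Local Notation Yv := (vop univ (univ_qmodule univ) (univ_smooth univ)).
Local Notation th := (theta univ).

Let hq := univ_qmodule univ.
Let blin := vop_bilinear univ (univ_qmodule univ) (univ_smooth univ).
Let trn := vop_truncated univ (univ_qmodule univ) (univ_smooth univ).

Lemma Yv0l n w : Yv 0 n w = 0. Proof. exact: (linP0 (op_linl blin n w)). Qed.
Lemma Yv0r v n : Yv v n 0 = 0. Proof. exact: (linP0 (op_linr blin v n)). Qed.

Lemma mode_comm g (n : int) a q y (I : nat) :
  (forall i : nat, (I <= i)%N -> ZV g i%:Z a = 0) ->
  ZV g n (Yv a q y) = Yv (th [:: g] a) q (ZV g n y) +
    \sum_(i < I) binz n i *: Yv (ZV g i%:Z a) (q + n - i%:Z) y.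
Proof.
move=> hI; have := jacobi_gen univ hq (univ_smooth univ) g a y n q 0.
rewrite !ext0 sgn0 scale1r => /eqP; rewrite subr_eq addrC => /eqP ->; congr (_ + _).
rewrite /iter_ext (@fsumnE _ _ I) => [|j le]; last by rewrite add0r hI // Yv0l scaler0.
by apply: eq_bigr => i _; rewrite add0r; idx.
Qed.

Definition prod2 a b w : int -> int -> V := lprod Yv a b w.

Lemma prod2_utrunc a b w : utrunc (prod2 a b w).
Proof. exact: lprod_utrunc blin trn a b w. Qed.

Lemma prod2_comm g (n : int) a b w (I : nat) q p m :
  (forall i : nat, (I <= i)%N -> ZV g i%:Z a = 0) ->
  (forall i : nat, (I <= i)%N -> ZV g i%:Z b = 0) ->
  ZV g n (ext (prod2 a b w) q p m) =
  ext (prod2 (th [:: g] a) (th [:: g] b) (ZV g n w)) q p m +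
  (\sum_(i < I) binz n i *: ext (prod2 (ZV g i%:Z a) b w) (q + n - i%:Z) p m +
   \sum_(i < I) binz n i *: ext (prod2 (th [:: g] a) (ZV g i%:Z b) w) q (p + n - i%:Z) m).
Proof.
move=> ha hb; rewrite (ext_lin (Zlin hq g n)); last exact: prod2_utrunc.
pose f1 (i : 'I_I) (q p : int) : V :=
  binz n i *: prod2 (ZV g i%:Z a) b w (q + (n - i%:Z)) p.
pose f2 (i : 'I_I) (q p : int) : V :=
  binz n i *: prod2 (th [:: g] a) (ZV g i%:Z b) w q (p + (n - i%:Z)).
have u1 i : utrunc (f1 i).
  apply: utruncZ; have [K h] := prod2_utrunc (ZV g (i : nat)%:Z a) b w.
  by exists K => x y le; apply: h.
have u2 i : utrunc (f2 i).
  apply: utruncZ; have [K h] := prod2_utrunc (th [:: g] a) (ZV g (i : nat)%:Z b) w.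
  by exists (K - (n - i%:Z)) => x y le; apply: h; lia.
have [v1 e1] := ext_sum q p m u1; have [v2 e2] := ext_sum q p m u2.
rewrite (@eq_ext _ _ (fun q p => prod2 (th [:: g] a) (th [:: g] b) (ZV g n w) q p +
  ((\sum_(i < I) f1 i q p) + (\sum_(i < I) f2 i q p)))); last first.
  move=> x y; rewrite /prod2 /lprod (mode_comm n x _ ha) (mode_comm n y _ hb).
  rewrite (linPD (op_linr blin _ _)) -addrA; congr (_ + _); rewrite addrC; congr (_ + _).
    by apply: eq_bigr => i _; rewrite /f1 /prod2 /lprod addrA.
  rewrite (linP_sum (op_linr blin _ _)); apply: eq_bigr => i _.
  by rewrite (linPZ (op_linr blin _ _)) /f2 /prod2 /lprod addrA.
rewrite extD; [|exact: prod2_utrunc|exact: utruncD].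
rewrite extD // e1 e2; congr (_ + (_ + _)); apply: eq_bigr => i _.
  rewrite -addrA ext_shiftl_int extZ //.
  have [K h] := prod2_utrunc (ZV g (i : nat)%:Z a) b w; exists K => x y le; exact: h.
rewrite -addrA ext_shiftr_int extZ //.
have [K h] := prod2_utrunc (th [:: g] a) (ZV g (i : nat)%:Z b) w.
by exists (K - (n - i%:Z)) => x y le; apply: h; lia.
Qed.

Lemma prod2_theta c a b w q p m :
  th c (ext (prod2 a b w) q p m) = ext (prod2 (th c a) (th c b) (th c w)) q p m.
Proof.
rewrite (ext_lin (theta_lin univ c)); last exact: prod2_utrunc.
by apply: eq_ext => x y; rewrite /prod2 /lprod !theta_vop1.
Qed.

(** Together with the lower bound on a Laurent series, this makes multiplication by [f(x2 - x1)] a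
    finite sum. *)
Lemma prod2_large a b w q p : exists R : int, forall m, R <= m -> ext (prod2 a b w) q p m = 0.
Proof.
have [K hK] := trn b w.
have [L hL] := @bound_below (fun j x => Yv a x (Yv b (p + j%:Z) w) = 0) `|K - p|%N
  (fun j => trn a (Yv b (p + j%:Z) w)).
exists (L - q + `|K - p|%N%:Z) => m le; apply: fsumn0 => j.
rewrite /prod2 /lprod; case: (ltnP j `|K - p|%N) => lt.
  by rewrite hL ?scaler0 //; lia.
by rewrite hK ?Yv0r ?scaler0 //; lia.
Qed.

(* The residue of [x2^q x1^p (x2 - x1)^k f(x2 - x1) Y(a, x2) Y(b, x1) w]. *)
Definition zterm (e : V * V * laur) w (q p k : int) : V :=
  fsum (fun r => e.2 r *: ext (prod2 e.1.1 e.1.2 w) q p (r + k)).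

Lemma zterm_fin e w q p k : laurent e.2 ->
  fin_supp (fun r => e.2 r *: ext (prod2 e.1.1 e.1.2 w) q p (r + k)).
Proof.
case=> N hN; have [R hR] := prod2_large e.1.1 e.1.2 w q p.
exists (`|N| + `|R| + `|k|)%N => r lt; case: (ltP r N) => c; first by rewrite hN // scale0r.
by rewrite hR ?scaler0 //; lia.
Qed.

Lemma zterm_pascal e w : laurent e.2 -> pascal (zterm e w).
Proof.
move=> he q p k; rewrite /zterm -fsumD; try exact: zterm_fin.
congr fsum; apply/funext => r; rewrite (extS (prod2_utrunc _ _ _)) scalerDr addrA.
by [].
Qed.

Lemma zterm_theta c e w q p k : laurent e.2 ->
  th c (zterm e w q p k) = zterm ((th c e.1.1, th c e.1.2), e.2) (th c w) q p k.
Proof.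
move=> he; rewrite /zterm (fsum_additive (linPD (theta_lin univ c))); last exact: zterm_fin.
by congr fsum; apply/funext => r; rewrite (linPZ (theta_lin univ c)) prod2_theta.
Qed.

Lemma zterm_comm g (n : int) e w (I : nat) q p k : laurent e.2 ->
  (forall i : nat, (I <= i)%N -> ZV g i%:Z e.1.1 = 0) ->
  (forall i : nat, (I <= i)%N -> ZV g i%:Z e.1.2 = 0) ->
  ZV g n (zterm e w q p k) =
  zterm ((th [:: g] e.1.1, th [:: g] e.1.2), e.2) (ZV g n w) q p k +
  (\sum_(i < I) binz n i *: zterm ((ZV g i%:Z e.1.1, e.1.2), e.2) w (q + n - i%:Z) p k +
   \sum_(i < I) binz n i *: zterm ((th [:: g] e.1.1, ZV g i%:Z e.1.2), e.2) w q (p + n - i%:Z) k).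
Proof.
case: e => [[a b] f] /= he ha hb; rewrite /zterm /=.
rewrite (fsum_additive (linPD (Zlin hq g n))); last exact: (@zterm_fin (a, b, f)).
have scal (x : C) (F : int -> V) : fin_supp F -> x *: fsum F = fsum (fun r => x *: F r).
  by move=> h; rewrite (fsum_additive (linPD (scale_linear x))).
pose F1 (i : 'I_I) r := binz n i *: (f r *: ext (prod2 (ZV g i%:Z a) b w) (q + n - i%:Z) p (r + k)).
pose F2 (i : 'I_I) r := binz n i *:
  (f r *: ext (prod2 (th [:: g] a) (ZV g i%:Z b) w) q (p + n - i%:Z) (r + k)).
have fZ (x : C) (F : int -> V) : fin_supp F -> fin_supp (fun r => x *: F r).
  by case=> N h; exists N => r lt; rewrite h ?scaler0.
have g1 i : fin_supp (F1 i) by apply/fZ/(@zterm_fin (ZV g (i : nat)%:Z a, b, f)).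
have g2 i : fin_supp (F2 i) by apply/fZ/(@zterm_fin (th [:: g] a, ZV g (i : nat)%:Z b, f)).
have all (F : 'I_I -> int -> V) : (forall i, fin_supp (F i)) ->
    List.Forall (fun i => fin_supp (F i)) (index_enum _).
  by move=> h; elim: index_enum => [|i r IH]; constructor.
have [s1 e1] := fsum_seq (all F1 g1); have [s2 e2] := fsum_seq (all F2 g2).
rewrite [X in _ + (X + _)](_ : _ = fsum (fun r => \sum_(i < I) F1 i r)); last first.
  rewrite -e1; apply: eq_bigr => i _; rewrite scal //.
  exact: (@zterm_fin (ZV g (i : nat)%:Z a, b, f)).
rewrite [X in _ + (_ + X)](_ : _ = fsum (fun r => \sum_(i < I) F2 i r)); last first.
  rewrite -e2; apply: eq_bigr => i _; rewrite scal //.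
  exact: (@zterm_fin (th [:: g] a, ZV g (i : nat)%:Z b, f)).
rewrite -fsumD // -fsumD; first last.
- case: s1 s2 => N1 h1 [N2 h2]; exists (N1 + N2)%N => r lt.
  by rewrite h1 ?h2 ?addr0 //; lia.
- exact: (@zterm_fin (th [:: g] a, th [:: g] b, f)).
congr fsum; apply/funext => r; rewrite (linPZ (Zlin hq g n)) (prod2_comm n w q p _ ha hb).
rewrite !scalerDr !scaler_sumr; congr (_ + (_ + _)); apply: eq_bigr => i _.
  by rewrite /F1 !scalerA mulrC.
by rewrite /F2 !scalerA mulrC.
Qed.

Definition zsum (T : tens2 V) w q p k : V := \sum_(e <- T) zterm e w q p k.

Definition laurents (T : tens2 V) : Prop := List.Forall (fun e => laurent e.2) T.

Definition degenerate (T : tens2 V) : Prop := forall w q p k, zsum T w q p k = 0.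

Definition tmap (A B : V -> V) (T : tens2 V) : tens2 V :=
  [seq ((A e.1.1, B e.1.2), e.2) | e <- T].

Lemma laurents_tmap A B T : laurents T -> laurents (tmap A B T).
Proof. by elim=> [|e {}T h _ IH] /=; constructor. Qed.

Lemma zsum_pascal T w : laurents T -> pascal (zsum T w).
Proof.
rewrite /zsum => h q p k; elim: h => [|e {}T he _ IH]; first by rewrite !big_nil addr0.
by rewrite !big_cons IH (zterm_pascal w he) addrACA.
Qed.

(** Twists are invertible automorphisms: [w] is written as a twist and [theta c] is taken
    outside. *)
Lemma degenerate_theta c T w q p k : laurents T -> degenerate T ->
  zsum (tmap (th c) (th c) T) w q p k = 0.
Proof.
move=> hT hd; have -> : w = th c (th (bars c) w) by rewrite theta_comm theta_bars.
have := congr1 (th c) (hd (th (bars c) w) q p k); rewrite (linP0 (theta_lin _ _)) => <-.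
rewrite /zsum big_map (linP_sum (theta_lin _ _)).
by elim: hT => [|e {hd}T he _ IH]; rewrite ?big_nil // !big_cons IH zterm_theta.
Qed.

Lemma zsum_comm g T : laurents T -> exists I0 : nat, forall I : nat, (I0 <= I)%N ->
  forall (n : int) w q p k,
  ZV g n (zsum T w q p k) = zsum (tmap (th [:: g]) (th [:: g]) T) (ZV g n w) q p k +
  (\sum_(i < I) binz n i *: zsum (tmap (ZV g i%:Z) id T) w (q + n - i%:Z) p k +
   \sum_(i < I) binz n i *: zsum (tmap (th [:: g]) (ZV g i%:Z) T) w q (p + n - i%:Z) k).
Proof.
rewrite /zsum; elim=> [|e {}T he _ [I0 IH]].
  exists 0%N => I _ n w q p k; rewrite !big_nil (linP0 (Zlin hq _ _)) add0r.
  by rewrite !big1 ?addr0 // => i _; rewrite big_nil scaler0.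
have [K1 h1] := univ_smooth univ e.1.1; have [K2 h2] := univ_smooth univ e.1.2.
exists (I0 + `|K1| + `|K2|)%N => I le n w q p k.
have leI : (I0 <= I)%N by lia.
rewrite !big_cons (linPD (Zlin hq _ _)) (IH I leI).
rewrite (@zterm_comm g n e w I) //; first last.
- by move=> i li; apply: h2; lia.
- by move=> i li; apply: h1; lia.
rewrite addrACA; congr (_ + _); rewrite addrACA.
by congr (_ + _); rewrite -big_split; apply: eq_bigr => i _; rewrite big_cons scalerDr.
Qed.

(** Applying [g_n] for all [n] to the zero series gives a vanishing combination of the modes [g_i]
    on the two slots, with coefficients [binom(n, i) z^(n - i)] at [z = x2] and [z = x1];
    [indep_pair] separates them. *)
Lemma degenerate_mode g (i : nat) T : laurents T -> degenerate T ->
  degenerate (tmap (ZV g i%:Z) id T) /\ degenerate (tmap (th [:: g]) (ZV g i%:Z) T).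
Proof.
move=> hT hd; have [I0 hI] := zsum_comm g hT.
suff H w : (forall j q p k, (j < I0 + i.+1)%N -> zsum (tmap (ZV g j%:Z) id T) w q p k = 0) /\
  (forall j q p k, (j < I0 + i.+1)%N -> zsum (tmap (th [:: g]) (ZV g j%:Z) T) w q p k = 0).
  by split=> w q p k; have [h1 h2] := H w; [apply: h1|apply: h2]; lia.
apply: indep_pair => [j|j|n q p k].
- by apply: zsum_pascal; apply: laurents_tmap.
- by apply: zsum_pascal; apply: laurents_tmap.
have := hI (I0 + i.+1)%N (leq_addr _ _) n w q p k.
by rewrite hd (linP0 (Zlin hq _ _)) degenerate_theta // add0r => <-.
Qed.

End Nondegenerate.

(** * Tensors and the vacuum coefficients of their two slots *)

Section Tensor.
Variables (D : qdata) (V : lmodType C) (ZV : D -> int -> V -> V) (vac : V).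
Hypothesis univ : universal ZV vac.
Local Notation Yv := (vop univ (univ_qmodule univ) (univ_smooth univ)).
Local Notation th := (theta univ).
Local Notation fm := (fockmap univ).

Let hq := univ_qmodule univ.
Let blin := vop_bilinear univ (univ_qmodule univ) (univ_smooth univ).

Lemma subspace_sum (M : lmodType C) (P : M -> Prop) (I : Type) (r : seq I) (F : I -> M) :
  subspace P -> (forall i, P (F i)) -> P (\sum_(i <- r) F i).
Proof.
case=> P0 PL h; apply: (big_ind P) => // x y hx hy.
by rewrite -[x]scale1r; apply: PL.
Qed.

(** The degree components of a vector are built from [vac] by creation modes alone. *)
Lemma creation_ind (P : V -> Prop) : subspace P -> P vac ->
  (forall b n v, P v -> P (ZV b (Negz n) v)) -> forall v, P v.
Proof.
move=> hP Pvac PZ v; have [N /(_ N N (leqnn _) (leqnn _)) ->] := taylorP univ v.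
have PS : forall c x, P x -> P (c *: x).
  by move=> c x h; rewrite -[_ *: _]addr0; apply: hP.2 => //; apply: hP.1.
apply: subspace_sum => // -[k _] /=; elim: k v => [|k IH] v; first exact: PS.
rewrite taylorS; apply: (PS); apply: subspace_sum => // x; apply: subspace_sum => // m.
by apply: (PS); apply: PZ.
Qed.

(** A twist rescales each annihilation mode by a nonzero factor and preserves the coefficient of the
    empty word; so it does not affect whether a coefficient vanishes. *)
Lemma fockmap_theta c t : exists2 k : C, k != 0 & forall v, fm (th c v) t = k * fm v t.
Proof.
elim: t => [|[a m] t [k k0 IH]].
  exists 1 => [|v]; first exact: oner_neq0.
  rewrite mul1r; move: v; apply: creation_ind.
  - apply: eq_lin_subspace; last exact: fockmap_linE.
    by apply: (@comp_lin V V C^o (fun v => fm v [::]) (th c));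
      [exact: fockmap_linE|exact: theta_lin].
  - by rewrite theta_vac.
  move=> b n v _; rewrite theta_Z (linPZ (fockmap_linE univ [::])) !fockmap_Z.
  exact: mulr0.
exists ((tau c a)^-1 * k) => [|v]; first by rewrite mulf_neq0 ?invr_eq0 ?tau_neq0.
rewrite !fockmap_cons -mulrA -IH theta_Z (linPZ (fockmap_linE univ t)).
by rewrite /GRing.scale /= mulKf // tau_neq0.
Qed.

(** The component of degree [k] depends only on words of length [k]. The map [B] varies in the
    induction in order to absorb creation modes. *)
Lemma taylor_slot (U M : lmodType C) (B : V -> U -> M) (N k : nat) (T : seq (V * U)) :
  (forall u, linear (B^~ u)) -> (forall v, linear (B v)) ->
  (forall s, size s = k -> \sum_(e <- T) fm e.1 s *: e.2 = 0) ->
  \sum_(e <- T) B (taylor univ N k e.1) e.2 = 0.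
Proof.
move=> B1 B2; elim: k T B B1 B2 => [|k IH] T B B1 B2 h.
  rewrite /= (eq_bigr (fun e => B vac (fm e.1 [::] *: e.2))) => [|e _].
    by rewrite -(linP_sum (B2 vac)) h // (linP0 (B2 vac)).
  by rewrite (linPZ (B1 _)) (linPZ (B2 _)).
rewrite (eq_bigr (fun e => k.+1%:R^-1 *: \sum_(x : D) \sum_(m < N) (kap x (bar x))^-1 *:
    B (ZV (bar x) (Negz m) (taylor univ N k (ZV x m e.1))) e.2)) => [|e _]; last first.
  rewrite taylorS (linPZ (B1 _)) (linP_sum (B1 _)); congr (_ *: _).
  apply: eq_bigr => x _; rewrite (linP_sum (B1 _)); apply: eq_bigr => m _.
  by rewrite (linPZ (B1 _)).
rewrite -scaler_sumr exchange_big big1 ?scaler0 // => x _.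
rewrite exchange_big big1 // => m _; rewrite -scaler_sumr.
have := IH [seq (ZV x m e.1, e.2) | e <- T] (fun v u => B (ZV (bar x) (Negz m) v) u).
rewrite big_map => -> //; first by rewrite scaler0.
- by move=> u c v w; rewrite (Zlin hq) B1.
move=> s es; rewrite big_map; have := h ((x, m : nat) :: s); rewrite /= es => /(_ erefl) e0.
by rewrite -[RHS]e0; apply: eq_bigr => e _; rewrite /= fockmap_cons.
Qed.

(* If the only nonzero vacuum coefficient of a tensor in its first slot is that of the empty
   word, the tensor is [vac (x) _]. *)
Lemma vac_slot (U M : lmodType C) (B : V -> U -> M) (T : seq (V * U)) :
  (forall u, linear (B^~ u)) -> (forall v, linear (B v)) ->
  (forall s, s <> [::] -> \sum_(e <- T) fm e.1 s *: e.2 = 0) ->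
  \sum_(e <- T) B e.1 e.2 = B vac (\sum_(e <- T) fm e.1 [::] *: e.2).
Proof.
move=> B1 B2 h.
have [N hN] : exists N : nat, \sum_(e <- T) B e.1 e.2 =
    \sum_(e <- T) B (\sum_(k < N.+1) taylor univ N.+1 k e.1) e.2.
  suff [N hN] : exists N : nat, forall N', (N <= N')%N -> \sum_(e <- T) B e.1 e.2 =
      \sum_(e <- T) B (\sum_(k < N') taylor univ N' k e.1) e.2 by exists N; apply: hN.
  elim: T {h} => [|e T [N IH]]; first by exists 0%N => *; rewrite !big_nil.
  have [K hK] := taylorP univ e.1; exists (N + K)%N => N' le.
  have l1 : (N <= N')%N by lia.
  have l2 : (K <= N')%N by lia.
  by rewrite !big_cons (IH N' l1) -(hK N' N' l2 l2).
rewrite hN (eq_bigr (fun e => \sum_(k < N.+1) B (taylor univ N.+1 k e.1) e.2)) => [|e _];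
  last by rewrite (linP_sum (B1 _)).
rewrite exchange_big /= big_ord_recl [X in _ + X]big1 => [|k _]; last first.
  by apply: taylor_slot => // s es; apply: h => s0; move: es; rewrite s0 lift0.
rewrite addr0 (linP_sum (B2 vac)); apply: eq_bigr => e _.
by rewrite /= (linPZ (B1 _)) (linPZ (B2 _)).
Qed.

Definition pairing (T : tens2 V) (s s' : seq (letter D)) (n : int) : C :=
  \sum_(e <- T) fm e.1.1 s * fm e.1.2 s' * e.2 n.

Lemma pairing_vac (M : lmodType C) (B : V -> V -> M) (T : tens2 V) n :
  (forall v, linear (B^~ v)) -> (forall v, linear (B v)) ->
  (forall s s', (s, s') <> ([::], [::]) -> pairing T s s' n = 0) ->
  \sum_(e <- T) e.2 n *: B e.1.1 e.1.2 = pairing T [::] [::] n *: B vac vac.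
Proof.
move=> B1 B2 h; pose T' : seq (V * V) := [seq (e.1.1, e.2 n *: e.1.2) | e <- T].
have fT s s' : fm (\sum_(e <- T') fm e.1 s *: e.2) s' = pairing T s s' n.
  rewrite (linP_sum (fockmap_linE univ s')) big_map; apply: eq_bigr => e _ /=.
  by rewrite !(linPZ (fockmap_linE univ s')) -mulrA [fm e.1.2 s' * _]mulrC.
rewrite (_ : \sum_(e <- T) _ = \sum_(e <- T') B e.1 e.2); last first.
  by rewrite big_map; apply: eq_bigr => e _; rewrite (linPZ (B2 _)).
rewrite (vac_slot B1 B2) => [|s s0]; last first.
  by apply: (@fockmap_inj _ _ _ _ univ) => s'; rewrite fT h //; case.
rewrite -(linPZ (B2 _)); congr (B vac _); apply/eqP; rewrite -subr_eq0; apply/eqP.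
apply: (@fockmap_inj _ _ _ _ univ) => s'; rewrite (linPB (fockmap_linE univ s')) fT.
rewrite (linPZ (fockmap_linE univ s')) fockmap_vac /fock_vac.
case: s' => [|x s']; last by rewrite h // scaler0 subr0.
by rewrite /GRing.scale /= mulr1 subrr.
Qed.

Lemma ext_vac m : ext (prod2 univ vac vac vac) (-1) (-1) m = if m == 0 then vac else 0.
Proof.
rewrite /ext fsumn1 => [|j]; last first.
  rewrite /prod2 /lprod [Yv vac (-1 + j.+1%:Z) vac]vop_vac.
  by case: eqP => [|_]; [lia|rewrite (linP0 (op_linr blin _ _)) scaler0].
rewrite binz_0 sgn0 mul1r scale1r subr0 addr0 /prod2 /lprod !vop_vac eqxx.
by congr (if _ then _ else _); lia.
Qed.

(** Induction on the total length from which the coefficients vanish. Stripping a letter applies a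
    mode to one slot and preserves degeneracy, so only the coefficient at two empty words is left,
    and the action on [vac] detects it. *)
Lemma degenerate_pairing T : laurents T -> degenerate univ T -> forall s s' n, pairing T s s' n = 0.
Proof.
suff main K : forall T, laurents T -> degenerate univ T ->
    (forall s s' n, (K <= size s + size s')%N -> pairing T s s' n = 0) ->
    forall s s' n, pairing T s s' n = 0.
  move=> hT hd; suff [K hK] : exists K : nat, forall s s' n,
    (K <= size s + size s')%N -> pairing T s s' n = 0 by apply: (main K).
  rewrite /pairing; elim: {hT hd} T => [|e T [K IH]].
    by exists 0%N => *; rewrite big_nil.
  have [K1 h1] := fockmap_size univ e.1.1; have [K2 h2] := fockmap_size univ e.1.2.
  exists (K + K1 + K2)%N => s s' n le; rewrite big_cons IH ?addr0; last by lia.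
  case: (leqP K1 (size s)) => c; first by rewrite h1 // !mul0r.
  by rewrite h2 ?mulr0 ?mul0r //; lia.
elim: K => [|K IH] {}T hT hd hK s s' n; first exact: hK.
have h0 s1 s2 k : (s1, s2) <> ([::], [::]) -> pairing T s1 s2 k = 0.
  case: s1 => [|[g i] s1] ne; last first.
    have [d1 _] := degenerate_mode g i hT hd.
    have := IH _ (laurents_tmap _ _ hT) d1 _ s1 s2 k; rewrite /pairing big_map => e.
    rewrite -[RHS]e => [|t1 t2 k' le]; first by apply: eq_bigr => x _; rewrite fockmap_cons.
    rewrite big_map -[RHS](hK ((g, i) :: t1) t2 k'); last by rewrite /=; lia.
    by apply: eq_bigr => x _; rewrite fockmap_cons.
  case: s2 ne => [//|[g i] s2] _.
  have [_ d1] := degenerate_mode g i hT hd.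
  have [c c0 hc] := fockmap_theta [:: g] [::].
  have := IH _ (laurents_tmap _ _ hT) d1 _ [::] s2 k; rewrite /pairing big_map => e.
  apply: (mulfI c0); rewrite mulr0 -[RHS]e => [|t1 t2 k' le].
    by rewrite mulr_sumr; apply: eq_bigr => x _; rewrite /= hc fockmap_cons -!mulrA.
  rewrite big_map; have [d d0 hd'] := fockmap_theta [:: g] t1.
  apply: etrans (_ : d * pairing T t1 ((g, i) :: t2) k' = _); last first.
    by rewrite hK ?mulr0 //=; lia.
  by rewrite mulr_sumr; apply: eq_bigr => x _; rewrite /= hd' fockmap_cons -!mulrA.
have [|/h0 ->//] := pselect ((s, s') = ([::], [::])); case=> -> ->.
(* The exponents [-1] isolate the constant term of the two identity fields, and the shift [- n]
   selects the coefficient of degree [n]. *)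
have := hd vac (-1) (-1) (- n); rewrite /zsum.
suff -> : \sum_(e <- T) zterm univ e vac (-1) (-1) (- n) = pairing T [::] [::] n *: vac.
  by move/eqP; rewrite scaler_eq0 (negbTE (vac_neq0 univ)) orbF => /eqP.
pose H r := \sum_(e <- T) e.2 r *: ext (prod2 univ e.1.1 e.1.2 vac) (-1) (-1) (r - n).
have bl1 r v : linear (fun u => ext (prod2 univ u v vac) (-1) (-1) r).
  move=> c x y; rewrite -extZ; last exact: prod2_utrunc.
  rewrite -extD; [|apply: utruncZ|]; try exact: prod2_utrunc.
  by apply: eq_ext => p q; rewrite /prod2 /lprod (op_linl blin).
have bl2 r v : linear (fun u => ext (prod2 univ v u vac) (-1) (-1) r).
  move=> c x y; rewrite -extZ; last exact: prod2_utrunc.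
  rewrite -extD; [|apply: utruncZ|]; try exact: prod2_utrunc.
  by apply: eq_ext => p q; rewrite /prod2 /lprod (op_linl blin) (op_linr blin).
have hH r : H r = if r == n then pairing T [::] [::] n *: vac else 0.
  rewrite /H (@pairing_vac _ (fun u v => ext (prod2 univ u v vac) (-1) (-1) (r - n))) //.
    by rewrite ext_vac subr_eq0; case: eqP => [->//|_]; rewrite scaler0.
  by move=> s1 s2; apply: h0.
have hF : List.Forall (fun e => fin_supp (fun r =>
    e.2 r *: ext (prod2 univ e.1.1 e.1.2 vac) (-1) (-1) (r - n))) T.
  elim: hT => [|e {IH hd hK h0 H hH}T he _ IHT]; constructor=> //.
  exact: (zterm_fin univ vac (-1) (-1) (- n) he).
have [_ ->] := fsum_seq hF; rewrite (@fsum_pick _ H n) => [|r /negbTE ne].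
  by rewrite hH eqxx.
by rewrite hH ne.
Qed.

End Tensor.

(** * Uniqueness of the Yang-Baxter operator *)

Section SUniqueness.
Variables (D : qdata) (V : lmodType C) (ZV : D -> int -> V -> V) (vac : V).
Hypothesis univ : universal ZV vac.
Local Notation Yv := (vop univ (univ_qmodule univ) (univ_smooth univ)).

Let blin := vop_bilinear univ (univ_qmodule univ) (univ_smooth univ).
Let trn := vop_truncated univ (univ_qmodule univ) (univ_smooth univ).

(** The delta function turns [f(-x0)] into multiplication by [f(x2 - x1)]: the signs [(-1)^r]
    cancel, and the two sums may be exchanged. *)
Lemma jacobi_term (e : V * V * laur) w (a b c : int) : laurent e.2 ->
  fsumn (fun j => fsum (fun r =>
    (e.2 r * sgn r * sgn (r - a - 1) * binz (r - a - 1) j * sgn j) *: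
      YYop Yv e.1.1 e.1.2 w (b - j%:Z) (c - (r - a - 1) + j%:Z))) =
  sgn (- a - 1) *: zterm univ e w (- c - 1) (- b - 1) (- a - 1).
Proof.
case: e => [[u v] f] /= [N hN]; have [K hK] := trn v w; pose J := `|(K + b + 1)%R|%N.
have [L hL] := @bound_below (fun j x => Yv u x (Yv v (- b - 1 + j%:Z) w) = 0) J
  (fun j => trn u (Yv v (- b - 1 + j%:Z) w)).
pose F (j : nat) (r : int) := (binz (r + (- a - 1)) j * sgn j) *:
  prod2 univ u v w (- c - 1 + (r + (- a - 1)) - j%:Z) (- b - 1 + j%:Z).
have F0 (j : nat) r : (J <= j)%N -> F j r = 0.
  by move=> le; rewrite /F /prod2 /lprod hK ?(linP0 (op_linr blin _ _)) ?scaler0 // /J; lia.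
rewrite (_ : (fun j => _) = fun j => fsum (fun r => (sgn (- a - 1) * f r) *: F j r)); last first.
  apply/funext => j; congr fsum; apply/funext => r.
  rewrite /F scalerA /YYop /prod2 /lprod; apply: congr2; last by idx.
  have -> : r - a - 1 = r + (- a - 1) by lia.
  have e : sgn r * sgn (r + (- a - 1)) = sgn (- a - 1) by rewrite sgnD mulrA sgnM mul1r.
  by rewrite -[f r * sgn r * _]mulrA e [f r * _]mulrC -!mulrA.
rewrite (@fsum_fsumn_exch _ _ (J + `|N| + `|(L + c + 1 + a + 1)%R| + J)%N).
- rewrite /zterm /= (fsum_additive (linPD (scale_linear (sgn (- a - 1))))); last first.
    exact: (@zterm_fin _ _ _ _ univ (u, v, f) w _ _ (- a - 1) (ex_intro _ N hN)).
  congr fsum; apply/funext => r; rewrite scalerA /ext scale_fsumn //.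
  by exists J => j le; apply: F0.
- by move=> j r le; rewrite F0 ?scaler0 // /J; lia.
move=> j r lt; case: (ltP r N) => lr; first by rewrite hN // mulr0 scale0r.
case: (leqP J j) => lj; first by rewrite F0 ?scaler0.
by rewrite /F /prod2 /lprod hL ?scaler0 // /J; lia.
Qed.

(** The first product and the iterate do not involve [S], so the difference of the two tensors is
    degenerate. All its vacuum coefficients vanish, hence so does its value under any pair of
    functionals. *)
Lemma S_Jacobi_uniq (S S' : V -> V -> tens2 V) : S_linear S -> S_linear S' ->
  S_Jacobi Yv S -> S_Jacobi Yv S' -> S_eq S' S.
Proof.
move=> [hS _] [hS' _] hJ hJ' v u phi psi n.
pose neg (e : V * V * laur) : V * V * laur := (e.1, fun n => - e.2 n).
pose T : tens2 V := S v u ++ [seq neg e | e <- S' v u].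
have lT : laurents T.
  apply/List.Forall_app; split; first exact: hS.
  elim: (hS' v u) => [|e L [N hN] _ IH] /=; constructor => //.
  by exists N => k lt; rewrite /= hN ?oppr0.
have dT : degenerate univ T.
  move=> w q p k; rewrite /zsum big_cat big_map /=.
  have E (R : V -> V -> tens2 V) : (forall a b, laurents (R a b)) -> 
    \sum_(e <- R v u)
      fsumn (fun j => fsum (fun r =>
        (e.2 r * sgn r * sgn (r - (- k - 1) - 1) * binz (r - (- k - 1) - 1) j * sgn j) *:
          YYop Yv e.1.1 e.1.2 w ((- p - 1) - j%:Z) ((- q - 1) - (r - (- k - 1) - 1) + j%:Z))) =
     sgn k *: \sum_(e <- R v u) zterm univ e w q p k.
    move=> hR; rewrite scaler_sumr; elim: (hR v u) => [|e L he _ IH].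
      by rewrite !big_nil.
    rewrite !big_cons IH; congr (_ + _); rewrite jacobi_term //.
    have -> : - (- k - 1) - 1 = k by lia.
    have -> : - (- q - 1) - 1 = q by lia.
    by have -> : - (- p - 1) - 1 = p by lia.
  have := hJ u v w (- k - 1) (- p - 1) (- q - 1); rewrite (E S hS).
  have := hJ' u v w (- k - 1) (- p - 1) (- q - 1); rewrite (E S' hS') => <- /addrI/oppr_inj.
  move/(scalerI (sgn_neq0 k)) => ->; elim: (hS' v u) => [|e L he _ IH].
    by rewrite !big_nil addr0.
  rewrite !big_cons addrACA IH addr0 /neg /zterm /=.
  rewrite -[X in X + _]opprK (fsum_additive (@opprD V)); last exact: zterm_fin.
  rewrite [X in - X](_ : _ = fsum (fun r =>
    - e.2 r *: ext (prod2 univ e.1.1 e.1.2 w) q p (r + k))) ?addNr //.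
  by congr fsum; apply/funext => r; rewrite scaleNr.
have := degenerate_pairing lT dT => pT.
have l1 b : linear (fun a => phi a * psi b : C^o).
  by move=> c x y; rewrite linearP mulrDl -mulrA.
have l2 a : linear (fun b => phi a * psi b : C^o).
  by move=> c x y; rewrite linearP mulrDr mulrCA.
have := pairing_vac l1 l2 (fun s s' _ => pT s s' n).
rewrite pT scale0r /T big_cat big_map => e0.
apply/esym/subr0_eq; rewrite /pair2 -sumrN -[RHS]e0; congr (_ + _); apply: eq_bigr => e _.
  exact: mulrC.
by rewrite /neg scaleNr; congr (- _); exact: mulrC.
Qed.

End SUniqueness.

(** * Modules over the vertex algebra *)

Lemma binz_negC (i j : nat) : binz (- 1 - j%:Z) i * sgn i = sgn j * binz (- 1 - i%:Z) j.
Proof.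
have e (a b : nat) : binz (- 1 - a%:Z) b * sgn b = 'C(a + b, b)%:R.
  have -> : - 1 - a%:Z = - (a%:Z + 1) by lia.
  rewrite -binz_neg -mulrA sgnM mulr1 -binz_bin.
  by have -> : a%:Z + 1 - 1 + b%:Z = (a + b)%N by lia.
rewrite [RHS]mulrC !e addnC -[in RHS]bin_sub ?leq_addl //.
by rewrite addnK.
Qed.

Lemma pascal_flip (M : lmodType C) (F : int -> int -> int -> M) : pascal F ->
  pascal (fun s p m => sgn m *: F p s m).
Proof. by move=> hF s p m; rewrite sgnS scaleNr -scalerBr hF addrK. Qed.

Section Converse.
Variables (D : qdata) (V : lmodType C) (ZV : D -> int -> V -> V) (vac : V).
Hypothesis univ : universal ZV vac.
Local Notation Yv := (vop univ (univ_qmodule univ) (univ_smooth univ)).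
Local Notation gen a := (ZV a (-1) vac).

Let hq := univ_qmodule univ.
Let trn := vop_truncated univ (univ_qmodule univ) (univ_smooth univ).
Let Zvac : vaclike ZV vac. Proof. by case: univ. Qed.

Lemma gen_gen a b (j : nat) : Yv (gen a) j (gen b) = (kap a b * (j == 0%N)%:R) *: vac.
Proof.
rewrite vop_gen; have [_ ->] := hq; rewrite Zvac // (linP0 (Zlin hq _ _)) scaler0 add0r.
by congr (_ * _ *: _); congr (_%:R); lia.
Qed.

(** The iterate is a difference of the two products, and exchanging the generators swaps these up to
    the factors shown. *)
Lemma skew_iter a b x (s p m : int) :
  iter_ext (iprod Yv Yv (gen a) (gen b) x) s p m =
  - qf a b *: (sgn m *: iter_ext (iprod Yv Yv (gen b) (gen a) x) p s m).
Proof.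
pose L c d s p m := ext (fun s p => ZV c s (Yv (gen d) p x)) s p m.
have J c d s' p' m' : iter_ext (iprod Yv Yv (gen c) (gen d) x) s' p' m' =
    L c d s' p' m' - qf c d *: (sgn m' *: L d c p' s' m').
  rewrite (eq_iter_ext (g := fun m p => Yv (ZV c m (gen d)) p x)); last first.
    by move=> *; rewrite /iprod vop_gen.
  rewrite -(jacobi_gen univ hq (univ_smooth univ) c (gen d) x s' p' m') /L.
  congr (_ - _); rewrite scalerA mulrC -scalerA; congr (_ *: _).
  rewrite theta_Z theta_vac tau_cons tau_nil mulr1.
  rewrite (@eq_ext _ _ (fun p s => qf c d *: ZV d p (Yv (gen c) s x))); last first.
    by move=> *; rewrite (linPZ (vop_linl _ _ _ _ _)) !vop_gen.
  by rewrite extZ //; apply: left_utrunc.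
rewrite !J !scalerBr !scaleNr opprK !scalerA.
have -> : qf a b * sgn m * (qf b a * sgn m) = 1.
  by rewrite mulrACA qfV sgnM mulr1.
by rewrite scale1r addrC.
Qed.

(** The identity [skew_iter] on [vac], at exponents [0] and [-1]. It involves only products inside
    [V], the modes [-1 - j] on the vacuum playing the part of divided powers of [D], and can
    therefore be carried to a module. *)
Lemma skew_gen a b (r : int) : exists N : nat, forall M : nat, (N <= M)%N ->
  Yv (gen a) r (gen b) = - (qf a b * sgn r) *:
    \sum_(j < M) sgn j *: Yv (Yv (gen b) (r + j%:Z) (gen a)) (- 1 - j%:Z) vac.
Proof.
have [K hK] := iprod_trunc trn (vop_bilinear univ hq (univ_smooth univ)) (gen b) (gen a) vac.
exists `|(K - r)%R|%N => M le; have := skew_iter a b vac 0 (- 1) r.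
rewrite iter_ext0 /iprod (vop_creation _ _).2 => ->.
rewrite scalerA mulNr; congr (_ *: _); rewrite (@iter_extE _ K M) //; last by lia.
apply: eq_bigr => j _; rewrite addr0; congr (_ *: _).
by rewrite -binz_neg subrr add0r binz_bin binn mul1r.
Qed.

Section Module.
Variables (W : lmodType C) (YW : V -> int -> W -> W).
Hypothesis hW : VA_module Yv vac YW.

Let blW : bilinear_op YW. Proof. by case: hW. Qed.
Let tW : truncated YW. Proof. by case: hW. Qed.
Let vW n w : YW vac n w = if n == -1 then w else 0. Proof. by case: hW. Qed.
Let waW : forall u v w, wassoc Yv YW u v w.
Proof. by apply: weak_assoc_wassoc => //; case: hW. Qed.

(** Residue of [Y(c, z)] against [z^s x^p y^m] with [x = z - y] expanded in powers of [y]; [Negz j]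
    is the exponent [-j-1], which selects [y^j]. *)
Definition vacit c w (s p m : int) : W :=
  match m with
  | Posz _ => 0
  | Negz j => (sgn j * binz p j) *: YW c (s + p - j%:Z) w
  end.

Lemma vacit_pascal c w : pascal (vacit c w).
Proof.
move=> s p [m|[|j]].
- by rewrite addr0.
- by rewrite /vacit /= !binz_0 [RHS]addr0 !subr0 addrAC -addrA.
have -> : Negz j.+1 + 1 = Negz j by lia.
rewrite /vacit binz_pascal mulrDr.
have -> : s + 1 + p - j.+1%:Z = s + p - j%:Z by lia.
have -> : s + (p + 1) - j.+1%:Z = s + p - j%:Z by lia.
by rewrite -!scalerDl sgnSn !mulNr subrK.
Qed.

(* The value of [Y(Y(c, y) 1, x)] on a module is [Y(c, x + y)]. *)
Lemma iter_vac c w (s p m : int) : iter_ext (iprod Yv YW c vac w) s p m = vacit c w s p m.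
Proof.
have hc n : 0 <= n -> Yv c n vac = 0 by apply: (vop_creation univ c).1.
have [l hl] := waW c vac w; have [K hK] := tW c w.
have i0 n q : 0 <= n -> iprod Yv YW c vac w n q = 0.
  by move=> le; rewrite /iprod hc // (linP0 (op_linl blW _ _)).
apply/eqP; rewrite -subr_eq0; apply/eqP; move: s p m.
apply: (@pascal_uniq_s _ (fun s p m => iter_ext (iprod Yv YW c vac w) s p m - vacit c w s p m)
  (Num.max l K)).
- by apply: pascalB; [exact: (iter_extS i0)|exact: vacit_pascal].
- move=> p m; set s := Num.max l K.
  have le1 : l <= s by rewrite /s; lia.
  have le2 : K <= s by rewrite /s; lia.
  rewrite -hl //; apply/eqP; rewrite subr_eq0; apply/eqP.
  case: p => [p|i].
    rewrite (@ext_trunc _ 0) // => [|x y le]; last first.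
      by rewrite /lprod vW; case: eqP => [|_]; [lia|rewrite (linP0 (op_linr blW _ _))].
    case: m => [//|j]; rewrite /vacit; case: (ltnP p j) => lt.
      by rewrite binz_small // mulr0 scale0r.
    by rewrite hK ?scaler0 //; lia.
  rewrite /ext (@fsumn_pick _ _ i) => [|j ne]; last first.
    rewrite /lprod vW; case: eqP => [|_]; first by lia.
    by rewrite (linP0 (op_linr blW _ _)) scaler0.
  rewrite /lprod vW (_ : (Negz i + i%:Z == -1) = true); last by lia.
  case: m => [m|j].
    case: (ltnP m i) => lt; first by rewrite binz_small // mul0r scale0r.
    by rewrite hK ?scaler0 //; lia.
  rewrite /vacit !NegzE.
  have -> : - j.+1%:Z = - 1 - j%:Z by lia.
  rewrite binz_negC; have -> : - i.+1%:Z = - 1 - i%:Z by lia.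
  by idx.
exists 0 => s p [m|j] // _; rewrite /vacit subr0; exact: iter_ext_trunc i0 _.
Qed.

Lemma iter_vac_mode c w (j : nat) (q : int) :
  YW (Yv c (- 1 - j%:Z) vac) q w = (sgn j * binz q j) *: YW c (q - j%:Z) w.
Proof.
have := iter_vac c w 0 q (Negz j); rewrite iter_ext0 /iprod /vacit add0r => <-.
by rewrite NegzE; idx.
Qed.

(** At [s = 0] this is [skew_gen] read on the module through [iter_vac_mode]; truncation in [m]
    gives the other exponents. *)
Lemma skew_module a b w (s p m : int) :
  iter_ext (iprod Yv YW (gen a) (gen b) w) s p m =
  - qf a b *: (sgn m *: iter_ext (iprod Yv YW (gen b) (gen a) w) p s m).
Proof.
have [K1 h1] := iprod_trunc trn blW (gen a) (gen b) w.
have [K2 h2] := iprod_trunc trn blW (gen b) (gen a) w.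
apply/eqP; rewrite scaleNr -addr_eq0; apply/eqP; move: s p m.
apply: (@pascal_uniq_s _ (fun s p m => iter_ext (iprod Yv YW (gen a) (gen b) w) s p m +
  qf a b *: (sgn m *: iter_ext (iprod Yv YW (gen b) (gen a) w) p s m)) 0).
- apply: pascalD; first exact: iter_extS h1.
  by apply: pascalZ; apply: pascal_flip; apply: iter_extS h2.
- move=> p m; rewrite iter_ext0 /iprod.
  have [N hN] := skew_gen a b m; rewrite (hN (N + `|(K2 - m)%R|)%N) ?leq_addr //.
  rewrite (linPZ (op_linl blW _ _)) (linP_sum (op_linl blW _ _)).
  rewrite (@iter_extE _ K2 (N + `|(K2 - m)%R|)%N) //; last by lia.
  rewrite scaleNr scalerA addrC; apply/eqP; rewrite subr_eq0; apply/eqP; congr (_ *: _).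
  apply: eq_bigr => j _; rewrite (linPZ (op_linl blW _ _)) iter_vac_mode scalerA mulrA sgnM mul1r.
  by rewrite /iprod addr0.
exists (Num.max K1 K2) => s p m; rewrite ge_max => /andP[le1 le2].
by rewrite (iter_ext_trunc _ _ h1) // (iter_ext_trunc _ _ h2) // !scaler0 addr0.
Qed.

(** The Jacobi defect of two generators vanishes for large [s] by weak associativity, and for large
    [p] by weak associativity in the other order combined with skew symmetry. Hence it vanishes
    identically, and [m = 0] is the commutation relation. *)
Lemma module_qmodule : qmodule (fun a n => YW (gen a) n).
Proof.
split=> [a n|a b s p w]; first exact: op_linr.
pose u := gen a; pose v := gen b.
have [K1 h1] := tW u w; have [K2 h2] := tW v w.
have [l1 w1] := waW u v w; have [l2 w2] := waW v u w.
have [K hK] := iprod_trunc trn blW u v w.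
have ul : utrunc (lprod YW u v w) by apply: lprod_utrunc.
have ur : utrunc (lprod YW v u w) by apply: lprod_utrunc.
have z1 s' p' m' : K2 <= p' -> ext (lprod YW u v w) s' p' m' = 0.
  move=> le; apply: (@ext_trunc _ K2) => // x y l.
  by rewrite /lprod h2 // (linP0 (op_linr blW _ _)).
have z2 s' p' m' : K1 <= p' -> ext (lprod YW v u w) s' p' m' = 0.
  move=> le; apply: (@ext_trunc _ K1) => // x y l.
  by rewrite /lprod h1 // (linP0 (op_linr blW _ _)).
have := @pascal_uniq_sp _ (fun s p m => ext (lprod YW u v w) s p m -
  qf a b *: (sgn m *: ext (lprod YW v u w) p s m) - iter_ext (iprod Yv YW u v w) s p m)
  (Num.max l1 K1) (Num.max l2 K2) _ _ _ s p 0.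
rewrite !ext0 sgn0 scale1r /lprod => e.
apply/eqP; rewrite addrC -subr_eq -subr_eq0; apply/eqP; rewrite -[RHS]e.
(* Of the nonnegative products of two generators only the zeroth can be nonzero, so the iterate
   reduces to the contact term. *)
- congr (_ - _); rewrite /iter_ext fsumn1 => [|j]; last first.
    by rewrite /iprod add0r gen_gen mulr0 scale0r (linP0 (op_linl blW _ _)) scaler0.
  rewrite /iprod add0r gen_gen (linPZ (op_linl blW _ _)) vW binz_0 scale1r eqxx mulr1.
  rewrite subr0 (_ : (s + p + 1 == 0) = (s + p == -1)); last by lia.
  by case: eqP => _; rewrite ?mulr1 // mulr0 scale0r scaler0.
- apply: pascalB; last exact: iter_extS hK.
  by apply: pascalB; [exact: extS|apply: pascalZ; exact: pascal_swap].
- move=> s' p' m'; rewrite ge_max => /andP[le1 le2].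
  by rewrite w1 // z2 // !scaler0 subr0 subrr.
move=> s' p' m'; rewrite ge_max => /andP[le1 le2].
by rewrite z1 // w2 // sub0r (skew_module a b) scaleNr subrr.
Qed.

End Module.
End Converse.

(** * The algebra of [Q] *)

Section OfMatrix.
Variables (l : nat) (Q : 'M[C]_l).
Hypothesis hQ : forall i j : 'I_l, Q i j * Q j i = 1.
Local Notation index := ('I_l * bool)%type.

(* [(i, true)] stands for the generator [X_i] and [(i, false)] for [Y_i]. *)
Definition qfQ (a b : index) : C := if a.2 == b.2 then Q a.1 b.1 else Q b.1 a.1.

(** The value [- Q i i] results from solving the mixed relation for [Y_i X_i], as [Q i i] is its own
    inverse. *)
Definition kapQ (a b : index) : C :=
  (a.1 == b.1)%:R * (if a.2 == b.2 then 0 else if a.2 then 1 else - Q a.1 a.1).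

Definition barQ (a : index) : index := (a.1, ~~ a.2).

Lemma kapQ_neq0 a b : kapQ a b != 0 -> b = barQ a.
Proof.
case: a b => [i e] [j d]; rewrite /kapQ /barQ /=.
have [->|_] := eqVneq i j; last by rewrite mul0r eqxx.
by case: e d => [] [] //=; rewrite mulr0 eqxx.
Qed.

Fact qfQV a b : qfQ a b * qfQ b a = 1.
Proof. by rewrite /qfQ eq_sym; case: eqP => _; apply: hQ. Qed.

Fact kapQ_qf a b c : kapQ a b != 0 -> qfQ a c * qfQ b c = 1.
Proof.
move/kapQ_neq0 ->; rewrite /qfQ /barQ /=.
by case: a.2 c.2 => [] [] /=; apply: hQ.
Qed.

Fact kapQC a b : kapQ b a = - (qfQ b a * kapQ a b).
Proof.
case: a b => [i e] [j d]; rewrite /kapQ /qfQ /= eq_sym.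
have [->|_] := eqVneq i j; last by rewrite !mul0r mulr0 oppr0.
by case: e d => [] [] /=; rewrite ?mulr0 ?mulr1 ?mul1r ?mulrN ?hQ ?oppr0 ?opprK.
Qed.

Fact kapQ_bar a : kapQ a (barQ a) != 0.
Proof.
rewrite /kapQ /barQ /= eqxx mul1r; case: a.2 => /=; first exact: oner_neq0.
by rewrite oppr_eq0; apply: contra_eq_neq (hQ a.1 a.1) => ->; rewrite mul0r eq_sym oner_neq0.
Qed.

Definition dataQ : qdata := QData qfQV kapQ_qf kapQC kapQ_bar kapQ_neq0.

Section Modes.
Variables (W : lmodType C) (X Y : 'I_l -> int -> W -> W).

Definition modes (a : dataQ) (n : int) (w : W) : W := (if a.2 then X else Y) a.1 n w.

Lemma AQ_qmodule : AQ_module Q X Y -> qmodule modes.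
Proof.
case=> lX lY rX rY rXY; split=> [[i []] n|[i e] [j d] m n w]; [exact: lX|exact: lY|].
rewrite /modes /= /kapQ /qfQ /=; case: e d => [] [] /=.
- by rewrite mulr0 mul0r scale0r addr0.
- have /eqP := rXY i j m n w; rewrite subr_eq addrC => /eqP ->; congr (_ + _).
  by rewrite mulr1 -natrM mulnb; case: ifP; rewrite ?scale1r ?scale0r.
- have := rXY j i n m w; rewrite [n + m]addrC [j == i]eq_sym.
  move=> /(congr1 (fun x => Q j i *: x)); rewrite scalerBr scalerA hQ scale1r => e.
  rewrite -[LHS](subKr (Q j i *: X j n (Y i m w))) e; congr (_ + _).
  have [<-|_] := eqVneq i j; last by rewrite !mul0r scale0r scaler0 oppr0.
  by rewrite mul1r /=; case: eqP => _; rewrite ?mulr1 ?mulr0 ?scaleNr ?scaler0 ?scale0r ?oppr0.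
by rewrite mulr0 mul0r scale0r addr0.
Qed.

Lemma qmodule_AQ : qmodule modes -> AQ_module Q X Y.
Proof.
case=> lZ rZ; split=> [i n|i n|i j m n w|i j m n w|i j m n w].
- exact: (lZ (i, true)).
- exact: (lZ (i, false)).
- have := rZ (i, true) (j, true) m n w.
  by rewrite /= /kapQ /qfQ /= mulr0 mul0r scale0r addr0.
- have := rZ (i, false) (j, false) m n w.
  by rewrite /= /kapQ /qfQ /= mulr0 mul0r scale0r addr0.
have := rZ (i, true) (j, false) m n w; rewrite /modes /= /kapQ /qfQ /= => ->.
rewrite addrC addKr mulr1 -natrM mulnb.
by case: ifP; rewrite ?scale1r ?scale0r.
Qed.

Lemma vaclike_modes w : vacuum_like X Y w <-> vaclike modes w.
Proof.
split=> [h [i []] m le|h i m le]; [exact: (h i m le).1|exact: (h i m le).2|].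
by split; [exact: (h (i, true))|exact: (h (i, false))].
Qed.

Lemma locally_truncated_smooth : locally_truncated X Y -> smooth modes.
Proof.
move=> h w; have [N hN] := choice (h w).
exists (\sum_i `|N i|) => -[i e] m le.
have le' : N i <= m.
  apply: (le_trans (ler_norm _)); apply: le_trans le.
  by rewrite (bigD1 i) //= lerDl sumr_ge0.
by have [hX hY] := hN i m le'; case: e.
Qed.

End Modes.

Lemma modes_K (W : lmodType C) (Z : dataQ -> int -> W -> W) :
  modes (fun i => Z (i, true)) (fun i => Z (i, false)) = Z.
Proof. by apply/funext => -[i []]. Qed.

Lemma universalQ (V : lmodType C) (X Y : 'I_l -> int -> V -> V) (vac : V) :
  universal_vacuum_module Q X Y vac -> universal (modes X Y) vac.
Proof.
case=> hA hvac U; split; [exact: AQ_qmodule|exact/vaclike_modes|].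
move=> W ZW w hW hw; rewrite -(modes_K ZW) in hW hw.
have [f [f1 f2 f3 f4 f5]] := U W _ _ w (qmodule_AQ hW) (proj2 (vaclike_modes _ _ _) hw).
exists f; split=> //; first by move=> [i []] m v; [apply: f3|apply: f4].
move=> g g1 g2 g3 v; apply: f5 => // i m u.
  exact: (g3 (i, true)).
exact: (g3 (i, false)).
Qed.

End OfMatrix.

Theorem theorem3p7 (l : nat) (Q : 'M[C]_l)
  (hQ : forall i j : 'I_l, Q i j * Q j i = 1)
  (V : lmodType C) (X Y : 'I_l -> int -> V -> V) (vac : V)
  (hV : universal_vacuum_module Q X Y vac) :
  let u i := X i (-1) vac in
  let v i := Y i (-1) vac in
  exists (Yv : V -> int -> V -> V) (S : V -> V -> tens2 V),
    [/\ (* irreducible quantum vertex algebra with vacuum vac and the given generators *)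
        QVA Yv vac S /\ irreducible_VA Yv,
        (forall i n w, Yv (u i) n w = X i n w /\ Yv (v i) n w = Y i n w),
        (* uniqueness of the structure *)
        (forall (Yv' : V -> int -> V -> V) (S' : V -> V -> tens2 V),
           QVA Yv' vac S' -> irreducible_VA Yv' ->
           (forall i n w, Yv' (u i) n w = X i n w /\ Yv' (v i) n w = Y i n w) ->
           (forall a n b, Yv' a n b = Yv a n b) /\ S_eq S' S),
        (* modules from A_Q-modules *)
        (forall (W : lmodType C) (XW YW : 'I_l -> int -> W -> W),
           AQ_module Q XW YW -> locally_truncated XW YW ->
           exists YW0 : V -> int -> W -> W,
             [/\ VA_module Yv vac YW0,
                 (forall i n w, YW0 (u i) n w = XW i n w /\ YW0 (v i) n w = YW i n w) &
                 (forall YW1 : V -> int -> W -> W, VA_module Yv vac YW1 ->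
                    (forall i n w, YW1 (u i) n w = XW i n w /\ YW1 (v i) n w = YW i n w) ->
                    forall a n w, YW1 a n w = YW0 a n w)]) &
        (* conversely *)
        (forall (W : lmodType C) (YW : V -> int -> W -> W),
           VA_module Yv vac YW ->
           AQ_module Q (fun i n => YW (u i) n) (fun i n => YW (v i) n))].
Proof.
move=> u v; have univ := universalQ hQ hV.
have hq := univ_qmodule univ; have hs := univ_smooth univ.
pose gen (a : dataQ hQ) := modes X Y a (-1) vac.
have gens (W : lmodType C) (YW : V -> int -> W -> W) XW YW' :
    (forall i n w, YW (u i) n w = XW i n w /\ YW (v i) n w = YW' i n w) <->
    (forall a n w, YW (gen a) n w = modes XW YW' a n w).
  split=> [h [i []] n w|h i n w]; [exact: (h i n w).1|exact: (h i n w).2|].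
  by split; [exact: (h (i, true))|exact: (h (i, false))].
pose Yv := vop univ (univ_qmodule univ) (univ_smooth univ).
have trn : truncated Yv by exact: vop_truncated.
have gv : forall a n w, Yv (gen a) n w = modes X Y a n w by move=> a n w; exact: vop_gen.
have hQVA : QVA Yv vac (Sq univ) by exact: vop_QVA.
exists Yv, (Sq univ); split.
- by split=> //; exact: vop_irreducible.
- by apply/gens.
- move=> Yv' S' hQVA' _ /gens gv'.
  have [[[bl' [tr' vac' _ _ wa']] _] [lS' _ _] jS' _ _] := hQVA'.
  have e : forall a n b, Yv' a n b = Yv a n b.
    (* Each algebra structure is compared as a module over itself. *)
    apply: (module_uniq univ tr' trn) => //.
    - by exact: vop_module.
    by move=> a n w; rewrite gv gv'.
  split=> //; have eY : Yv' = Yv.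
    by apply/funext => a; apply/funext => n; apply/funext => b.
  rewrite eY in jS'; have [_ [lS _ _] jS _ _] := hQVA.
  exact: (S_Jacobi_uniq lS lS' jS jS').
- move=> W XW YW hA ht.
  have hqW := AQ_qmodule hQ hA; have hsW := locally_truncated_smooth hQ ht.
  have gW : forall a n w, vop univ hqW hsW (gen a) n w = modes XW YW a n w.
    by move=> a n w; exact: vop_gen.
  have mW : VA_module Yv vac (vop univ hqW hsW) by exact: vop_module.
  exists (vop univ hqW hsW); split=> //; first exact/gens.
  move=> YW1 hYW1 /gens g1; apply: (module_uniq univ trn trn) => //.
  by move=> a n w; rewrite g1 gW.
move=> W YW hYW; apply: (qmodule_AQ (hQ := hQ)).
have := module_qmodule hYW; congr (qmodule _); apply/funext => -[i []]; apply/funext => n //.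
Qed.
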